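(* Let $s\ge0$ be a real number and let $V\in B^s$ satisfy $2^{s/2}(2\pi)^{-n}\|V\|_{B^s}<1$. For every $f\in B^s$, the equation $$(1-\Delta+V)u=f\quad\text{in }\mathbb R^n$$ admits a unique solution $\mathbf u\in B^{s+2}$, and it satisfies $$\|\mathbf u\|_{B^{s+2}}\le\mathbf c\,\|f\|_{B^s},\qquad \mathbf c:=\left(1-2^{s/2}(2\pi)^{-n}\|V\|_{B^s}\right)^{-1}.$$
   Context: Functions are complex valued on $\mathbb R^n$; $\hat f(\xi)=\int_{\mathbb R^n}e^{-ix\cdot\xi}f(x)\,dx$ is the Fourier transform (extended to tempered distributions); $\langle\xi\rangle=\sqrt{1+|\xi|^2}$; $C_b^0$ is the space of bounded continuous functions on $\mathbb R^n$. For $s\ge0$, $B^s=\{f\in C_b^0:\ \langle\xi\rangle^s\hat f\in L^1(\mathbb R^n)\}$ with norm $\|f\|_{B^s}=\|\langle\xi\rangle^s\hat f\|_{L^1}$ (a Banach space). *)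

(* Defs.v *)
From HB Require Import structures.
From mathcomp Require Import all_boot all_order all_algebra.
From mathcomp Require Import all_classical all_reals all_analysis.
From mathcomp Require Import complex.
Set Implicit Arguments.
Unset Strict Implicit.
Unset Printing Implicit Defensive.
Import Order.TTheory GRing.Theory Num.Theory.
Import numFieldNormedType.Exports.
Local Open Scope classical_set_scope.
Local Open Scope ring_scope.

(* The sigma-algebra on 'rV[R]_n is generated by the n coordinates, as the
   library does for tuples; it is the Borel sigma-algebra of R^n. *)
Definition rV_display : measure_display.
Proof. exact: default_measure_display. Qed.

Section measurable_rV.
Context {R : realType} (n : nat).

Definition rV_coord (i : 'I_n) (x : 'rV[R]_n) : measurableTypeR R := x ord0 i.

Let rV_set0 : g_sigma_preimage rV_coord set0.
Proof. exact: sigma_algebra0. Qed.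

Let rV_setC A : g_sigma_preimage rV_coord A -> g_sigma_preimage rV_coord (~` A).
Proof. exact: sigma_algebraC. Qed.

Let rV_bigcup (F : (set 'rV[R]_n)^nat) :
  (forall i, g_sigma_preimage rV_coord (F i)) ->
  g_sigma_preimage rV_coord (\bigcup_i (F i)).
Proof. exact: sigma_algebra_bigcup. Qed.

HB.instance Definition _ := @isMeasurable.Build rV_display
  'rV[R]_n (g_sigma_preimage rV_coord) rV_set0 rV_setC rV_bigcup.

End measurable_rV.

Lemma measurable_rV_coord (R : realType) n (i : 'I_n) :
  measurable_fun [set: 'rV[R]_n] (@rV_coord R n i).
Proof.
move=> _ Y mY; rewrite setTI; apply: sub_sigma_algebra => /=.
rewrite -bigcup_seq/=; exists i => /=; first by rewrite mem_index_enum.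
by exists Y => //; rewrite setTI.
Qed.

Lemma measurable_fun_rVP d (T : measurableType d) (R : realType) n
    (f : T -> 'rV[R]_n) :
  measurable_fun [set: T] f <->
  forall i, measurable_fun [set: T] (rV_coord i \o f).
Proof.
split=> [mf i|mf].
  by apply: measurableT_comp mf; exact: measurable_rV_coord.
have : @g_sigma_preimage _ (measurableTypeR R) _ n
    (fun i => rV_coord i \o f) `<=` measurable.
  apply: smallest_sub; first exact: sigma_algebra_measurable.
  rewrite -bigcup_seq => A [i _ [B mB <-]]; exact: mf.
rewrite g_sigma_preimage_comp => prefS _ A mA.
by apply: prefS; exists A.
Qed.

(* Lebesgue measure on R^n as the n-fold product of the Lebesgue measure on R,
   transported along R x R^n ~ R^(n+1); it is the point mass for n = 0. *)
Section lebesgue_rV.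
Context {R : realType}.

Definition rV_cons n (p : measurableTypeR R * 'rV[R]_n) : 'rV[R]_n.+1 :=
  row_mx (const_mx p.1 : 'rV_1) p.2.

Let rV_uncons n (x : 'rV[R]_n.+1) : measurableTypeR R * 'rV[R]_n :=
  (x ord0 ord0, \row_i x ord0 (lift ord0 i)).

Lemma rV_cons0 n p : @rV_cons n p ord0 ord0 = p.1.
Proof.
rewrite /rV_cons; have -> : ord0 = lshift n (ord0 : 'I_1) by apply: val_inj.
by rewrite (row_mxEl (const_mx p.1 : 'rV_1)) mxE.
Qed.

Lemma rV_consS n p i : @rV_cons n p ord0 (lift ord0 i) = p.2 ord0 i.
Proof.
rewrite /rV_cons; have -> : lift ord0 i = rshift 1 i by apply: val_inj.
by rewrite (row_mxEr (const_mx p.1 : 'rV_1)).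
Qed.

Let rV_consK n : cancel (@rV_cons n) (@rV_uncons n).
Proof.
case=> a v; rewrite /rV_uncons rV_cons0; congr pair.
by apply/rowP => i; rewrite mxE rV_consS.
Qed.

Lemma measurable_rV_cons n : measurable_fun setT (@rV_cons n).
Proof.
apply/measurable_fun_rVP => i; case: (unliftP ord0 i) => [j|] ->.
  rewrite (_ : _ \o _ = rV_coord j \o snd).
    by apply: measurableT_comp; [exact: measurable_rV_coord|].
  by apply/funext => p /=; rewrite /rV_coord rV_consS.
rewrite (_ : _ \o _ = fst)//.
by apply/funext => p /=; rewrite /rV_coord rV_cons0.
Qed.

Let measurable_rV_uncons n : measurable_fun setT (@rV_uncons n).
Proof.
apply/measurable_fun_pairP; split; first exact: (measurable_rV_coord ord0).
apply/measurable_fun_rVP => i.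
rewrite (_ : _ \o _ = rV_coord (lift ord0 i)); first exact: measurable_rV_coord.
by apply/funext => p /=; rewrite /rV_coord !mxE.
Qed.

Section succ.
Variables (n : nat) (mu : {sigma_finite_measure set 'rV[R]_n -> \bar R}).

Definition lebesgue_rV_succ : set 'rV[R]_n.+1 -> \bar R :=
  pushforward (lebesgue_measure \x mu)%E (@rV_cons n).

Let preimage_rV_cons A : measurable A -> measurable (@rV_cons n @^-1` A).
Proof.
by move=> mA; rewrite -[X in measurable X]setTI; exact: measurable_rV_cons.
Qed.

Let lebesgue_rV_succ0 : lebesgue_rV_succ set0 = 0%E.
Proof. by rewrite /lebesgue_rV_succ /pushforward preimage_set0 measure0. Qed.

Let lebesgue_rV_succ_ge0 A : (0 <= lebesgue_rV_succ A)%E.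
Proof. by rewrite /lebesgue_rV_succ /pushforward; exact: measure_ge0. Qed.

Let lebesgue_rV_succ_sigma_additive : semi_sigma_additive lebesgue_rV_succ.
Proof.
move=> F mF tF mUF; rewrite /lebesgue_rV_succ /pushforward preimage_bigcup.
apply: measure_semi_sigma_additive.
- by move=> k; exact: preimage_rV_cons.
- apply/trivIsetP => /= i j _ _ ij; rewrite -preimage_setI.
  by move/trivIsetP : tF => /(_ _ _ _ _ ij) ->//; rewrite preimage_set0.
- by rewrite -preimage_bigcup; exact: preimage_rV_cons.
Qed.

HB.instance Definition _ := isMeasure.Build _ _ _ lebesgue_rV_succ
  lebesgue_rV_succ0 lebesgue_rV_succ_ge0 lebesgue_rV_succ_sigma_additive.

Let lebesgue_rV_succ_sigma_finite : sigma_finite setT lebesgue_rV_succ.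
Proof.
pose nu : {sigma_finite_measure set (measurableTypeR R) -> \bar R} :=
  @lebesgue_measure R.
have [G GT Goo] : sigma_finite setT (nu \x mu)%E.
  have /sigma_finiteP[F [TF ndF Foo]] := sigma_finiteT nu.
  have /sigma_finiteP[H [TH ndH Hoo]] := sigma_finiteT mu.
  exists (fun k => F k `*` H k).
    rewrite -setXTT TF TH predeqE => -[x y]; split.
      move=> [/= [k _ Fkx] [l _ Hly]]; exists (maxn k l) => //; split.
      - by move: x Fkx; exact/subsetPset/ndF/leq_maxl.
      - by move: y Hly; exact/subsetPset/ndH/leq_maxr.
    by move=> [k _ []/= ? ?]; split; exists k.
  move=> k; have [? ?] := Foo k; have [? ?] := Hoo k.
  split; first exact: measurableX.
  by rewrite product_measure1E// lte_mul_pinfty// ge0_fin_numE.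
exists (fun i => @rV_uncons n @^-1` G i).
  by rewrite -preimage_bigcup -GT preimage_setT.
move=> i; have [mG Gi] := Goo i; split.
  by rewrite -[X in measurable X]setTI; exact: measurable_rV_uncons.
rewrite /lebesgue_rV_succ /pushforward -comp_preimage.
rewrite (_ : _ @^-1` _ = G i)//.
by apply/seteqP; split=> p /=; rewrite rV_consK.
Qed.

HB.instance Definition _ :=
  @Measure_isSigmaFinite.Build _ _ _ lebesgue_rV_succ
    lebesgue_rV_succ_sigma_finite.

End succ.

Fixpoint lebesgue_rV n : {sigma_finite_measure set 'rV[R]_n -> \bar R} :=
  if n is m.+1 then lebesgue_rV_succ (lebesgue_rV m) else \d_(0 : 'rV[R]_0).

End lebesgue_rV.

(* R[i] has no normedModType R structure in the library, so continuity,
   derivatives and integrals are taken on real and imaginary parts. *)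
Section complex_valued.
Context {R : realType} {n : nat}.
Local Open Scope complex_scope.
Local Notation Rn := 'rV[R]_n.
Local Notation C := R[i].
Implicit Types (f g phi u V : Rn -> C) (x xi : Rn).

Definition dotp x xi : R := \sum_(i < n) x ord0 i * xi ord0 i.

Definition japanese xi : R := Num.sqrt (1 + dotp xi xi).

Definition cintegrable f : Prop :=
  (lebesgue_rV n).-integrable setT (fun x => (complex.Re (f x))%:E) /\
  (lebesgue_rV n).-integrable setT (fun x => (complex.Im (f x))%:E).

Definition cintegral f : C :=
  (\int[lebesgue_rV n]_x complex.Re (f x)) +i*
  (\int[lebesgue_rV n]_x complex.Im (f x)).

Definition ccontinuous f : Prop :=
  continuous (fun x => complex.Re (f x)) /\
  continuous (fun x => complex.Im (f x)).

Definition Cb0 f : Prop :=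
  ccontinuous f /\ exists M : R, forall x, Normc.normc (f x) <= M.

Definition pderivable (j : 'I_n) f : Prop := forall x,
  derivable (fun y => complex.Re (f y)) x (delta_mx ord0 j) /\
  derivable (fun y => complex.Im (f y)) x (delta_mx ord0 j).

Definition pderiv (j : 'I_n) f : Rn -> C := fun x =>
  'D_(delta_mx ord0 j) (fun y => complex.Re (f y)) x +i*
  'D_(delta_mx ord0 j) (fun y => complex.Im (f y)) x.

Definition pderivs (l : seq 'I_n) f : Rn -> C := foldr pderiv f l.

Definition Ck (k : nat) f : Prop := forall l : seq 'I_n, (size l <= k)%N ->
  ccontinuous (pderivs l f) /\
  ((size l < k)%N -> forall j, pderivable j (pderivs l f)).

Definition schwartz phi : Prop :=
  (forall k, Ck k phi) /\
  forall (l : seq 'I_n) (k : nat), exists M : R, forall x,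
    japanese x ^+ k * Normc.normc (pderivs l phi x) <= M.

Definition fourier_int phi : Rn -> C := fun xi =>
  cintegral (fun x => (cos (dotp x xi) -i* sin (dotp x xi)) * phi x).

(* Tempered distributions: tdist f is the distribution defined by the function
   f, and fourier_dist is the transpose of fourier_int on Schwartz functions. *)
Definition tdist f : (Rn -> C) -> C :=
  fun phi => cintegral (fun x => f x * phi x).

Definition fourier_dist (T : (Rn -> C) -> C) : (Rn -> C) -> C :=
  fun phi => T (fourier_int phi).

Definition has_fourier f g : Prop := cintegrable g /\
  forall phi, schwartz phi -> fourier_dist (tdist f) phi = tdist g phi.

(* A representative, unique almost everywhere, of the distributional Fourier
   transform when it is an L^1 function; the junk value 0 otherwise. *)
Definition fourier f : Rn -> C := xget (fun=> 0) [set g | has_fourier f g].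

(* Meant for s >= 0: then <xi>^s g in L^1 forces g in L^1, so asking that the
   Fourier transform be an L^1 function in has_fourier loses nothing. *)
Definition barron (s : R) f : Prop :=
  [/\ Cb0 f, has_fourier f (fourier f) &
      (lebesgue_rV n).-integrable setT
        (fun xi => (japanese xi `^ s * Normc.normc (fourier f xi))%:E)].

Definition barron_norm (s : R) f : R :=
  \int[lebesgue_rV n]_xi (japanese xi `^ s * Normc.normc (fourier f xi)).

Definition laplacian u : Rn -> C := fun x => \sum_(j < n) pderivs [:: j; j] u x.

(* Classical sense; every u in B^(s+2) with s >= 0 is of class C^2. *)
Definition schrodinger_sol V f u : Prop :=
  Ck 2 u /\ forall x, u x - laplacian u x + V x * u x = f x.

End complex_valued.

(* Main.v *)
(* On the Fourier side the equation for u reads w + (2 pi)^-n V^ * (J^-2 w) = f^,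
   where J = <xi> and w = J^2 u^. By Peetre's inequality, Young's inequality holds
   in the weighted space L^1(J^s) with constant 2^(s/2), so the convolution term
   is a contraction with ratio q = 2^(s/2) (2 pi)^-n |V|_{B^s}: the Neumann series
   for w converges and gives |w| <= |f^| / (1 - q), and |u|_{B^(s+2)} = |w|. The
   same contraction in L^1 (s = 0) gives uniqueness. Going back to physical space
   needs that a bounded continuous f with f^ in L^1 is the inverse Fourier integral
   of f^, and that f^ is unique a.e.: both follow by pairing with modulated gaussians,
   whose Fourier transforms are explicit approximate identities. *)

(* [fourier] is a chosen representative, fixed only almost everywhere, and [has_fourier] tests
   against Schwartz functions alone. Every identity is therefore proved for the explicit integral
   [inv_fourier] and then transferred. This forces the modulated gaussians and their Fourier
   transforms to be shown to be Schwartz, which is the purpose of [polygauss]. The factor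
   [(2 pi)^-n] in front of the convolution is the normalisation of the inverse transform, since a
   product of two inverse integrals carries it twice. The factor [2^(s/2)] is the power [s/2] of the
   constant in [|x + y|^2 <= 2 |x|^2 + 2 |y|^2]. The operator acts on [w] rather than on [u^] so
   that it maps the space weighted by [J^s] to itself, the two orders gained by [u] being contained
   in [J^-2 <= 1]. The Neumann series is summed pointwise in [xi], and the equation is checked after
   the inverse transform: there the series converges absolutely at every [x] and telescopes. *)
From HB Require Import structures.
Require Import Defs.
From mathcomp Require Import all_boot all_order all_algebra.
From mathcomp Require Import all_classical all_reals all_analysis.
From mathcomp Require Import complex measurable_realfun ring lra.
Set Implicit Arguments.
Unset Strict Implicit.
Unset Printing Implicit Defensive.
Import Order.TTheory GRing.Theory Num.Theory.
Import numFieldNormedType.Exports.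
Local Open Scope classical_set_scope.
Local Open Scope ring_scope.

(** * Complex-valued integrals *)

Section complex_numbers.
Context {R : realType}.
Local Open Scope complex_scope.
Implicit Types z w : R[i].

Lemma cReD z w : complex.Re (z + w) = complex.Re z + complex.Re w.
Proof. by case: z w => [a b] [c d]. Qed.

Lemma cImD z w : complex.Im (z + w) = complex.Im z + complex.Im w.
Proof. by case: z w => [a b] [c d]. Qed.

Lemma cReN z : complex.Re (- z) = - complex.Re z.
Proof. by case: z. Qed.

Lemma cImN z : complex.Im (- z) = - complex.Im z.
Proof. by case: z. Qed.

Lemma cReM z w : complex.Re (z * w) =
  complex.Re z * complex.Re w - complex.Im z * complex.Im w.
Proof. by case: z w => [a b] [c d]. Qed.

Lemma cImM z w : complex.Im (z * w) =
  complex.Re z * complex.Im w + complex.Im z * complex.Re w.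
Proof. by case: z w => [a b] [c d]. Qed.

Lemma complex_ext z w :
  complex.Re z = complex.Re w -> complex.Im z = complex.Im w -> z = w.
Proof. by case: z w => [a b] [c d] /= -> ->. Qed.

Lemma cnormcE z :
  Normc.normc z = Num.sqrt (complex.Re z ^+ 2 + complex.Im z ^+ 2).
Proof. by case: z. Qed.

Lemma normc_ge0 z : 0 <= Normc.normc z.
Proof. by rewrite cnormcE sqrtr_ge0. Qed.

Lemma normc_real (r : R) : Normc.normc r%:C = `|r|.
Proof. by rewrite cnormcE /= expr0n addr0 sqrtr_sqr. Qed.

Lemma ler_Re_normc z : `|complex.Re z| <= Normc.normc z.
Proof. by rewrite cnormcE -sqrtr_sqr ler_sqrt ?addr_ge0 ?sqr_ge0// lerDl sqr_ge0. Qed.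

Lemma ler_Im_normc z : `|complex.Im z| <= Normc.normc z.
Proof. by rewrite cnormcE -sqrtr_sqr ler_sqrt ?addr_ge0 ?sqr_ge0// lerDr sqr_ge0. Qed.

Lemma ler_normc_abs z : Normc.normc z <= `|complex.Re z| + `|complex.Im z|.
Proof.
rewrite cnormcE -(ler_pXn2r (n := 2)) ?nnegrE ?addr_ge0 ?sqrtr_ge0//.
rewrite sqr_sqrtr ?addr_ge0 ?sqr_ge0// sqrrD !real_normK ?num_real//.
by rewrite addrAC lerDl mulrn_wge0// mulr_ge0.
Qed.

Lemma normc_eq0 z : Normc.normc z = 0 -> z = 0.
Proof. exact: Normc.eq0_normc. Qed.

Lemma ler_normcD z w : Normc.normc (z + w) <= Normc.normc z + Normc.normc w.
Proof. exact: le_normcD. Qed.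

Definition cis (t : R) : R[i] := cos t +i* sin t.

Lemma cisD s t : cis (s + t) = cis s * cis t.
Proof. by apply: complex_ext; rewrite ?cReM ?cImM/= ?cosD ?sinD//; ring. Qed.

Lemma cis0 : cis 0 = 1.
Proof. by rewrite /cis cos0 sin0. Qed.

Lemma cisN t : cis (- t) = cos t -i* sin t.
Proof. by rewrite /cis cosN sinN. Qed.

Lemma normc_cis t : Normc.normc (cis t) = 1.
Proof. by rewrite cnormcE /= cos2Dsin2 sqrtr1. Qed.

End complex_numbers.

Section complex_measurable.
Context d (T : measurableType d) (R : realType).
Local Open Scope complex_scope.
Implicit Types (f g : T -> R[i]).

Definition cmeasurable f := measurable_fun [set: T] (fun x => complex.Re (f x)) /\
  measurable_fun [set: T] (fun x => complex.Im (f x)).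

Lemma cmeasurable_cst z : cmeasurable (fun=> z).
Proof. by split; exact: measurable_cst. Qed.

Lemma cmeasurableM f g : cmeasurable f -> cmeasurable g ->
  cmeasurable (fun x => f x * g x).
Proof.
move=> [f1 f2] [g1 g2]; split.
  by under eq_fun do rewrite cReM; apply: measurable_funB; exact: measurable_funM.
by under eq_fun do rewrite cImM; apply: measurable_funD; exact: measurable_funM.
Qed.

Lemma cmeasurable_real (h : T -> R) : measurable_fun setT h ->
  cmeasurable (fun x => (h x)%:C).
Proof. by split=> //=; exact: measurable_cst. Qed.

Lemma cmeasurable_cis (h : T -> R) : measurable_fun setT h ->
  cmeasurable (fun x => cis (h x)).
Proof.
move=> mh; split=> /=.
  by apply: measurableT_comp mh; apply: continuous_measurable_fun; exact: continuous_cos.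
by apply: measurableT_comp mh; apply: continuous_measurable_fun; exact: continuous_sin.
Qed.

Lemma cmeasurable_normc f : cmeasurable f ->
  measurable_fun setT (fun x => Normc.normc (f x)).
Proof.
move=> [f1 f2]; under eq_fun do rewrite cnormcE.
apply: (@measurableT_comp _ _ _ _ _ _ (@Num.sqrt R)).
  by apply: continuous_measurable_fun; exact: sqrt_continuous.
by apply: measurable_funD; exact: measurable_funX.
Qed.

End complex_measurable.

Lemma cmeasurable_comp d1 d2 (T1 : measurableType d1) (T2 : measurableType d2)
    (R : realType) (f : T2 -> R[i]) (h : T1 -> T2) :
  cmeasurable f -> measurable_fun setT h -> cmeasurable (fun x => f (h x)).
Proof.
by move=> [f1 f2] mh; split; [apply: measurableT_comp f1 mh|apply: measurableT_comp f2 mh].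
Qed.

Section complex_integral.
Context d (T : measurableType d) (R : realType).
Variable mu : {measure set T -> \bar R}.
Local Open Scope complex_scope.
Implicit Types (f g : T -> R[i]).

Definition cintegrable_on f :=
  mu.-integrable setT (fun x => (complex.Re (f x))%:E) /\
  mu.-integrable setT (fun x => (complex.Im (f x))%:E).

Definition cint f : R[i] :=
  (\int[mu]_x complex.Re (f x)) +i* (\int[mu]_x complex.Im (f x)).

(** Extended-real valued, so that a bound on it can establish integrability instead of presupposing
    it. *)
Definition L1norm f : \bar R := (\int[mu]_x (Normc.normc (f x))%:E)%E.

Lemma cintegrable_measurable f : cintegrable_on f -> cmeasurable f.
Proof. by move=> [/measurable_int/measurable_EFinP ? /measurable_int/measurable_EFinP]. Qed.

Lemma le_cintegrable f (g : T -> R) : cmeasurable f ->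
  (forall x, Normc.normc (f x) <= g x) -> mu.-integrable setT (EFin \o g) ->
  cintegrable_on f.
Proof.
move=> [f1 f2] fg ig; split.
  apply: le_integrable ig => //; first exact/measurable_EFinP.
  move=> x _ /=; rewrite lee_fin (le_trans (ler_Re_normc _))// (le_trans (fg x))//.
  exact: ler_norm.
apply: le_integrable ig => //; first exact/measurable_EFinP.
move=> x _ /=; rewrite lee_fin (le_trans (ler_Im_normc _))// (le_trans (fg x))//.
exact: ler_norm.
Qed.

Lemma cintegrable_normc f : cintegrable_on f ->
  mu.-integrable setT (fun x => (Normc.normc (f x))%:E).
Proof.
move=> cf; have mf := cintegrable_measurable cf; case: cf => f1 f2.
have : mu.-integrable setT (EFin \o
    (fun x => `|complex.Re (f x)| + `|complex.Im (f x)|)).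
  have := integrableD measurableT (integrable_norm f1) (integrable_norm f2).
  by apply: eq_integrable.
apply: le_integrable => //; first exact/measurable_EFinP/cmeasurable_normc.
move=> x _ /=; rewrite lee_fin (ger0_norm (normc_ge0 _)).
by rewrite (le_trans (ler_normc_abs _))// ler_norm.
Qed.

Lemma integrable_normcP f : cmeasurable f -> 
  mu.-integrable setT (fun x => (Normc.normc (f x))%:E) -> cintegrable_on f.
Proof. by move=> mf; apply: le_cintegrable. Qed.

Lemma L1norm_lty f : cmeasurable f -> (L1norm f < +oo)%E -> cintegrable_on f.
Proof.
move=> mf foo; apply: integrable_normcP => //; apply/integrableP; split.
  exact/measurable_EFinP/cmeasurable_normc.
by under eq_integral do rewrite gee0_abs ?lee_fin ?normc_ge0//.
Qed.

Lemma cintegrable_L1norm f : cintegrable_on f -> (L1norm f < +oo)%E.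
Proof.
move=> /cintegrable_normc /integrableP[_].
by under eq_integral do rewrite gee0_abs ?lee_fin ?normc_ge0//.
Qed.

Lemma cintegrableD f g : cintegrable_on f -> cintegrable_on g ->
  cintegrable_on (fun x => f x + g x).
Proof.
move=> [f1 f2] [g1 g2]; split.
  by under eq_fun do rewrite cReD EFinD; exact: integrableD.
by under eq_fun do rewrite cImD EFinD; exact: integrableD.
Qed.

Lemma cintegrableN f : cintegrable_on f -> cintegrable_on (fun x => - f x).
Proof.
move=> [f1 f2]; split.
  by under eq_fun do rewrite cReN EFinN; exact: integrableN.
by under eq_fun do rewrite cImN EFinN; exact: integrableN.
Qed.

Lemma cintegrableB f g : cintegrable_on f -> cintegrable_on g ->
  cintegrable_on (fun x => f x - g x).
Proof. by move=> ? ?; apply: cintegrableD => //; exact: cintegrableN. Qed.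

Lemma cintegrable_bndl (h f : T -> R[i]) (M : R) : cmeasurable h ->
  (forall x, Normc.normc (h x) <= M) -> cintegrable_on f ->
  cintegrable_on (fun x => h x * f x).
Proof.
move=> mh hM cf; apply: (@le_cintegrable _ (fun x => M * Normc.normc (f x))).
- by apply: cmeasurableM => //; exact: cintegrable_measurable.
- by move=> x; rewrite Normc.normcM ler_wpM2r// normc_ge0.
- exact: (integrableZl measurableT M (cintegrable_normc cf)).
Qed.

Lemma cintegrableZ z f : cintegrable_on f -> cintegrable_on (fun x => z * f x).
Proof. by apply: (@cintegrable_bndl _ _ (Normc.normc z)) => //; exact: cmeasurable_cst. Qed.

Lemma cintD f g : cintegrable_on f -> cintegrable_on g ->
  cint (fun x => f x + g x) = cint f + cint g.
Proof.
move=> [f1 f2] [g1 g2]; apply: complex_ext => /=.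
  by rewrite -RintegralD//; under eq_Rintegral do rewrite cReD.
by rewrite -RintegralD//; under eq_Rintegral do rewrite cImD.
Qed.

Lemma cintZ z f : cintegrable_on f -> cint (fun x => z * f x) = z * cint f.
Proof.
move=> [f1 f2]; apply: complex_ext.
  rewrite cReM /= -!RintegralZl// -RintegralB//.
  - by under eq_Rintegral do rewrite cReM.
  - exact: (integrableZl measurableT _ f1).
  - exact: (integrableZl measurableT _ f2).
rewrite cImM /= -!RintegralZl// -RintegralD//.
- by under eq_Rintegral do rewrite cImM.
- exact: (integrableZl measurableT _ f2).
- exact: (integrableZl measurableT _ f1).
Qed.

Lemma cintN f : cintegrable_on f -> cint (fun x => - f x) = - cint f.
Proof.
by move=> cf; rewrite -mulN1r -cintZ//; congr cint; apply/funext => x; rewrite mulN1r.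
Qed.

Lemma cintB f g : cintegrable_on f -> cintegrable_on g ->
  cint (fun x => f x - g x) = cint f - cint g.
Proof. by move=> ? ?; rewrite cintD ?cintN//; exact: cintegrableN. Qed.

Lemma eq_cint f g : f =1 g -> cint f = cint g.
Proof. by move=> /funext ->. Qed.

Lemma ae_eq_cint f g : cmeasurable f -> cmeasurable g ->
  (\forall x \ae mu, f x = g x) -> cint f = cint g.
Proof.
move=> [f1 f2] [g1 g2] fg; apply: complex_ext => /=; congr fine.
  apply: ae_eq_integral => //; [exact/measurable_EFinP|exact/measurable_EFinP|].
  by apply: filterS fg => x ->.
apply: ae_eq_integral => //; [exact/measurable_EFinP|exact/measurable_EFinP|].
by apply: filterS fg => x ->.
Qed.

(* With [c] the conjugate of [cint f] divided by its modulus, [|cint f|] is the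
   integral of the real function [Re (c f)]. *)
Lemma normc_cint f : cmeasurable f -> ((Normc.normc (cint f))%:E <= L1norm f)%E.
Proof.
move=> mf; have [->|] := eqVneq (L1norm f) +oo%E; first by rewrite leey.
rewrite -ltey => /(L1norm_lty mf) cf.
have [c0|c0] := eqVneq (cint f) 0.
  by rewrite c0 Normc.normc0 integral_ge0// => x _; rewrite lee_fin normc_ge0.
have n0 : 0 < Normc.normc (cint f).
  by rewrite lt_neqAle normc_ge0 andbT eq_sym; apply: contra c0 => /eqP/normc_eq0 ->.
pose c := (cint f)^*%C * ((Normc.normc (cint f))^-1)%:C.
have c1 : Normc.normc c = 1.
  rewrite Normc.normcM normc_real ger0_norm ?invr_ge0 ?normc_ge0//.
  have -> : Normc.normc (cint f)^*%C = Normc.normc (cint f).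
    by rewrite !cnormcE; case: (cint f) => a b /=; rewrite sqrrN.
  by rewrite divff// gt_eqF.
have E : complex.Re (cint (fun x => c * f x)) = Normc.normc (cint f).
  rewrite cintZ// /c mulrAC; move: (cint f) n0 {c0 c c1} => z n0.
  rewrite cReM [complex.Im _%:C]/= mulr0 subr0.
  have -> : complex.Re (z^*%C * z) = Normc.normc z ^+ 2.
    rewrite cnormcE sqr_sqrtr ?addr_ge0 ?sqr_ge0//.
    by case: z n0 => a b _ /=; ring.
  by rewrite /= expr2 mulfK// gt_eqF.
rewrite -E /= fineK; last first.
  by apply: integrable_fin_num => //; case: (cintegrableZ c cf).
apply: le_integral => //; [by case: (cintegrableZ c cf)|exact: cintegrable_normc|].
move=> x _; rewrite lee_fin (le_trans (ler_norm _))// (le_trans (ler_Re_normc _))//.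
by rewrite Normc.normcM c1 mul1r.
Qed.

Lemma normc_cint_le f (M : R) : cmeasurable f -> (L1norm f <= M%:E)%E ->
  Normc.normc (cint f) <= M.
Proof. by move=> mf fM; rewrite -lee_fin (le_trans (normc_cint mf)). Qed.

Definition ccvg (u : nat -> R[i]) (l : R[i]) :=
  (complex.Re (u k) @[k --> \oo] --> complex.Re l) /\
  (complex.Im (u k) @[k --> \oo] --> complex.Im l).

Lemma ccvg_unique u l l' : ccvg u l -> ccvg u l' -> l = l'.
Proof.
by move=> [a b] [a' b']; apply: complex_ext; [exact: cvg_unique a a'|exact: cvg_unique b b'].
Qed.

Lemma ccvg_cst z : ccvg (fun=> z) z.
Proof. by split; exact: cvg_cst. Qed.

Lemma ccvgM u v l m : ccvg u l -> ccvg v m -> ccvg (fun k => u k * v k) (l * m).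
Proof.
move=> [a b] [a' b']; split.
  by under eq_fun do rewrite cReM; rewrite cReM; apply: cvgB; exact: cvgM.
by under eq_fun do rewrite cImM; rewrite cImM; apply: cvgD; exact: cvgM.
Qed.

Lemma ccvg_real (u : nat -> R) (l : R) : u @ \oo --> l -> ccvg (fun k => (u k)%:C) l%:C.
Proof. by move=> h; split=> //=; exact: cvg_cst. Qed.

Lemma cdominated_cvg (f_ : nat -> T -> R[i]) f (g : T -> R) :
  (forall k, cmeasurable (f_ k)) -> cmeasurable f ->
  (\forall x \ae mu, ccvg (f_ ^~ x) (f x)) -> mu.-integrable setT (EFin \o g) ->
  (forall k x, Normc.normc (f_ k x) <= g x) ->
  ccvg (fun k => cint (f_ k)) (cint f).
Proof.
have main (h_ : nat -> T -> R) (h : T -> R) : (forall k, measurable_fun setT (h_ k)) ->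
    measurable_fun setT h -> (\forall x \ae mu, h_ k x @[k --> \oo] --> h x) ->
    mu.-integrable setT (EFin \o g) -> (forall k x, `|h_ k x| <= g x) ->
    \int[mu]_x h_ k x @[k --> \oo] --> \int[mu]_x h x.
  move=> mh_ mh hcvg ig hg; apply: fine_cvg.
  have [||||| ih _] := @dominated_convergence _ _ _ mu _ measurableT
    (fun k => EFin \o h_ k) (EFin \o h) (EFin \o g).
  - by move=> k; exact/measurable_EFinP.
  - exact/measurable_EFinP.
  - by apply: filterS hcvg => x hx _; apply: cvg_EFin; [exact: nearW|exact: hx].
  - exact: ig.
  - by apply: aeW => x k _; rewrite lee_fin.
  by rewrite /= -[X in _ --> X -> _]fineK//; exact: integrable_fin_num.
move=> mf_ [f1 f2] fcvg ig fg; split; apply: main (ig) _ => //.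
- by move=> k; case: (mf_ k).
- by apply: filterS fcvg => x [].
- by move=> k x; rewrite (le_trans (ler_Re_normc _)).
- by move=> k; case: (mf_ k).
- by apply: filterS fcvg => x [].
- by move=> k x; rewrite (le_trans (ler_Im_normc _)).
Qed.

End complex_integral.

(** * Fubini's theorem for complex-valued functions *)

Section complex_fubini.
Context d1 d2 (T1 : measurableType d1) (T2 : measurableType d2) (R : realType).
Variable m1 : {sigma_finite_measure set T1 -> \bar R}.
Variable m2 : {sigma_finite_measure set T2 -> \bar R}.
Implicit Type f : T1 * T2 -> R[i].

Lemma cmeasurable_pair1 f x : cmeasurable f -> cmeasurable (fun y => f (x, y)).
Proof. by move=> mf; apply: cmeasurable_comp mf _; exact: pair1_measurable. Qed.

Lemma cintegrable12 f : cmeasurable f ->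
  (\int[m1]_x \int[m2]_y (Normc.normc (f (x, y)))%:E < +oo)%E ->
  cintegrable_on (m1 \x m2)%E f.
Proof.
move=> mf foo; apply: integrable_normcP => //.
apply/integrable12ltyP; first exact/measurable_EFinP/cmeasurable_normc.
by under eq_integral do under eq_integral do
  rewrite gee0_abs ?lee_fin ?normc_ge0//.
Qed.

(** Tonelli makes the integrals of the positive and negative parts measurable in [x], and [fine] of
    their difference remains measurable even where the section is not integrable. *)
Lemma cmeasurable_fubini1 f : cmeasurable f ->
  cmeasurable (fun x => cint m2 (fun y => f (x, y))).
Proof.
have main (h : T1 * T2 -> R) : measurable_fun setT h ->
    measurable_fun setT (fun x => \int[m2]_y h (x, y)).
  move=> mh; apply: (@measurableT_comp _ _ _ _ _ _ fine) => //.
  rewrite (_ : (fun x => _) = (fun x => \int[m2]_y (EFin \o h)^\+ (x, y) -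
      \int[m2]_y (EFin \o h)^\- (x, y))%E).
    apply: emeasurable_funB.
      apply: (measurable_fun_fubini_tonelli_F ((EFin \o h)^\+)%E) => //.
      exact/measurable_funepos/measurable_EFinP.
    apply: (measurable_fun_fubini_tonelli_F ((EFin \o h)^\-)%E) => //.
    exact/measurable_funeneg/measurable_EFinP.
  by apply/funext => x; rewrite integralE; congr (_ - _)%E;
    apply: eq_integral => y _; rewrite ?funeposE ?funenegE.
by move=> [f1 f2]; split; [exact: main f1|exact: main f2].
Qed.

(** The inner integrals are real numbers produced by [fine]. They agree with the extended-real ones
    where the section is integrable, that is almost everywhere, which is enough for the outer
    integrals. *)
Lemma cFubini f : cintegrable_on (m1 \x m2)%E f ->
  cint m1 (fun x => cint m2 (fun y => f (x, y))) =
  cint m2 (fun y => cint m1 (fun x => f (x, y))).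
Proof.
have main (h : T1 * T2 -> R) : (m1 \x m2)%E.-integrable setT (EFin \o h) ->
    \int[m1]_x \int[m2]_y h (x, y) = \int[m2]_y \int[m1]_x h (x, y).
  move=> ih; rewrite /Rintegral.
  transitivity (fine (\int[m1]_x \int[m2]_y (h (x, y))%:E)).
    congr fine; apply: ae_eq_integral => //.
    - apply/measurable_EFinP/(@measurableT_comp _ _ _ _ _ _ fine) => //.
      exact: (measurable_fubini_F ih).
    - exact: (measurable_fubini_F ih).
    - apply: filterS (ae_integrable1 ih) => x ihx _.
      by rewrite fineK//; exact: integrable_fin_num.
  rewrite (Fubini ih); congr fine; apply: ae_eq_integral => //.
  - exact: (measurable_fubini_G ih).
  - apply/measurable_EFinP/(@measurableT_comp _ _ _ _ _ _ fine) => //.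
    exact: (measurable_fubini_G ih).
  - apply: filterS (ae_integrable2 ih) => x ihx _.
    by rewrite fineK//; exact: integrable_fin_num.
by move=> [f1 f2]; apply: complex_ext; [exact: main f1|exact: main f2].
Qed.

Lemma cint_prod1 f : cintegrable_on (m1 \x m2)%E f ->
  cint (m1 \x m2)%E f = cint m1 (fun x => cint m2 (fun y => f (x, y))).
Proof.
have main (h : T1 * T2 -> R) : (m1 \x m2)%E.-integrable setT (EFin \o h) ->
    \int[(m1 \x m2)%E]_z h z = \int[m1]_x \int[m2]_y h (x, y).
  move=> ih; rewrite /Rintegral -(integral12_prod_meas1 ih).
  congr fine; apply: ae_eq_integral => //.
  - exact: (measurable_fubini_F ih).
  - apply/measurable_EFinP/(@measurableT_comp _ _ _ _ _ _ fine) => //.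
    exact: (measurable_fubini_F ih).
  - apply: filterS (ae_integrable1 ih) => x ihx _.
    by rewrite fineK//; exact: integrable_fin_num.
by move=> [f1 f2]; apply: complex_ext; [exact: main f1|exact: main f2].
Qed.

End complex_fubini.

(** * Integration on R^n *)

Section change_of_variables.
Context d (T : measurableType d) (R : realType) (mu : {measure set T -> \bar R}).

(** Lifts a scaling law from nonnegative functions to complex ones: applied to the modulus it gives
    integrability, and applied to positive and negative parts it gives the identity. It is meant for
    affine maps of R and of R^n. *)
Lemma cint_change_of_variables (phi : T -> T) (c : R) (f : T -> R[i]) : 0 < c ->
  measurable_fun setT phi ->
  (forall F : T -> \bar R, measurable_fun setT F -> (forall x, 0 <= F x)%E ->
    (c%:E * \int[mu]_x F (phi x) = \int[mu]_x F x)%E) ->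
  cintegrable_on mu f ->
  cintegrable_on mu (fun x => f (phi x)) /\
  (c%:C)%C * cint mu (fun x => f (phi x)) = cint mu f.
Proof.
move=> c0 mphi cphi If; have mf := cintegrable_measurable If.
have mfp : cmeasurable (fun x => f (phi x)) by exact: cmeasurable_comp mf _.
have Ifp : cintegrable_on mu (fun x => f (phi x)).
  apply: L1norm_lty => //; move/cintegrable_L1norm : If.
  rewrite /L1norm -(cphi (fun x => (Normc.normc (f x))%:E)).
  - rewrite muleC -lte_pdivlMr// => /lt_le_trans; apply.
    by rewrite mulyr gtr0_sg ?invr_gt0// mul1e.
  - exact/measurable_EFinP/cmeasurable_normc.
  - by move=> x; rewrite lee_fin normc_ge0.
split=> //.
have main (h : T -> R) : mu.-integrable setT (EFin \o h) ->
    mu.-integrable setT (EFin \o (h \o phi)) ->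
    c * \int[mu]_x h (phi x) = \int[mu]_x h x.
  move=> ih ihp; rewrite -RintegralZl//= /Rintegral.
  have mh := measurable_int _ ih.
  rewrite [in RHS]integralE.
  rewrite -(cphi (EFin \o h)^\+%E)//; last exact: measurable_funepos.
  rewrite -(cphi (EFin \o h)^\-%E)//; last exact: measurable_funeneg.
  have -> : (\int[mu]_x (EFin \o h)^\+ (phi x) =
             \int[mu]_x (EFin \o (h \o phi))^\+ x)%E.
    by apply: eq_integral => x _; rewrite !funeposE.
  have -> : (\int[mu]_x (EFin \o h)^\- (phi x) =
             \int[mu]_x (EFin \o (h \o phi))^\- x)%E.
    by apply: eq_integral => x _; rewrite !funenegE.
  rewrite -muleBr//; last first.
    exact/fin_num_adde_defr/(integrable_pos_fin_num measurableT ihp).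
  under eq_integral do rewrite EFinM.
  by rewrite integralZl// [X in (_ * X)%E]integralE.
case: If Ifp => f1 f2 [g1 g2]; apply: complex_ext.
  by rewrite cReM /= mul0r subr0; exact: (main (fun x => complex.Re (f x)) f1 g1).
by rewrite cImM /= mul0r addr0; exact: (main (fun x => complex.Im (f x)) f2 g2).
Qed.

End change_of_variables.

(** * Borel sets and measurable maps on R^n *)

Section borel_rV.
Context {R : realType} {n : nat}.
Implicit Types x y : 'rV[R]_n.

Lemma measurable_rV_entry (i : 'I_n) : measurable_fun setT (fun x : 'rV[R]_n => x ord0 i).
Proof. exact: (@measurable_rV_coord R n i). Qed.

Lemma measurable_ball_rV x (e : R) : measurable (ball x e).
Proof.
(* A ball of nonpositive radius is empty, whereas the box below is the whole space when [n = 0]. *)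
have [e0|e0] := ltP 0 e; last first.
  rewrite (_ : ball x e = set0)//; apply/seteqP; split => // y [] /=.
  by rewrite ltNge e0.
rewrite (_ : ball x e =
    \bigcap_(i in [set: 'I_n]) ((fun y => y ord0 i) @^-1` ball (x ord0 i) e)).
  apply: fin_bigcap_measurable => // i _.
  by rewrite -[X in measurable X]setTI; apply: measurable_rV_entry => //; exact: measurable_ball.
apply/seteqP; split => y; first by move=> [_ h] i _; exact: h.
by move=> h; split => // i j; rewrite (ord1 i); exact: h.
Qed.

(** Links the topology to the sigma-algebra generated by the coordinates: an open set is the union
    of the balls with rational centre and radius [1/(k+1)] that it contains, and these are countably
    many. *)
Lemma open_measurable_rV (U : set 'rV[R]_n) : open U -> measurable U.
Proof.
move=> oU.
pose center (p : 'rV[rat]_n * nat) : 'rV[R]_n := map_mx ratr p.1.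
pose B p := ball (center p) (p.2.+1%:R^-1 : R).
rewrite (_ : U = \bigcup_p (if pselect (B p `<=` U) then B p else set0)).
  apply: countable_bigcupT_measurable => // p.
  by case: pselect => h; [exact: measurable_ball_rV|exact: measurable0].
apply/seteqP; split => x; last by move=> [p _]; case: pselect => // h; exact: h.
move=> Ux; have /nbhs_ballP[e /= e0 eU] : nbhs x U by exact: open_nbhs_nbhs.
have e20 : 0 < e / 2 by rewrite divr_gt0.
(* With radius below [e / 2], a ball whose centre is that close to [x] contains [x] and stays inside
   [ball x e]. *)
have [k /andP[_ ke]] : {k : nat | (0 : R) < k.+1%:R^-1 < e / 2}.
  exists (Num.truncn (e / 2)^-1); rewrite invr_gt0 ltr0Sn /= invf_plt ?posrE//.
  exact: truncnS_gt.
have k0 : (0 : R) < k.+1%:R^-1 by rewrite invr_gt0.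
have /choice[q qP] (i : 'I_n) : exists q : rat,
    `|ratr q - x ord0 i| < (k.+1%:R^-1 : R).
  have [|q] := @rat_in_itvoo R (x ord0 i - k.+1%:R^-1) (x ord0 i + k.+1%:R^-1).
    by rewrite ltrD2l gtrN.
  by rewrite in_itv /= => /andP[h1 h2]; exists q; rewrite ltr_distl h1.
exists (\row_i q i, k) => //.
have BU : B (\row_i q i, k) `<=` U.
  apply: subset_trans eU => y [_ yP]; split => // i j.
  have := yP i j; rewrite (ord1 i) !mxE /= /ball /= => h.
  have := qP j; rewrite distrC => h'.
  rewrite [e]splitr (le_lt_trans (ler_distD (ratr (q j)) _ _))//.
  by apply: ltrD; [exact: lt_trans h' ke|exact: lt_trans h ke].
case: pselect => // h; split => // i j; rewrite (ord1 i) !mxE /=; exact: qP.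
Qed.

Lemma continuous_measurable_rV (f : 'rV[R]_n -> R) :
  continuous f -> measurable_fun setT f.
Proof.
move=> /continuousP cf; apply: (measurability _ (RGenOInfty.measurableE R)).
move=> _ [_ [a ->] <-]; rewrite setTI; apply: open_measurable_rV.
by apply: cf; exact: rray_open.
Qed.

Lemma measurable_rVD (a : 'rV[R]_n) (r : R) :
  measurable_fun setT (fun x : 'rV[R]_n => a + r *: x).
Proof.
apply/measurable_fun_rVP => i; rewrite /comp /rV_coord.
under eq_fun do rewrite !mxE.
by apply: measurable_funD => //; apply: measurable_funM => //; exact: measurable_rV_entry.
Qed.

Lemma measurable_rVB : measurable_fun setT (fun p : 'rV[R]_n * 'rV[R]_n => p.1 - p.2).
Proof.
apply/measurable_fun_rVP => i; rewrite /comp /rV_coord.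
under eq_fun do rewrite !mxE.
apply: measurable_funB.
  by apply: (@measurableT_comp _ _ _ _ _ _ (fun x : 'rV[R]_n => x ord0 i)) => //;
    exact: measurable_rV_entry.
by apply: (@measurableT_comp _ _ _ _ _ _ (fun x : 'rV[R]_n => x ord0 i)) => //;
  exact: measurable_rV_entry.
Qed.

End borel_rV.

(** * Affine substitutions and product functions on R^n *)

Section integral_rV.
Context {R : realType}.
Local Notation leb := (@lebesgue_measure R).
Local Notation Leb := (@lebesgue_rV R).

(** The image of Lebesgue measure under [x -> a + r x], multiplied by [r], gives every half-open
    interval its length, so it is Lebesgue measure by uniqueness. *)
Lemma ge0_integral_affine (a r : R) (F : R -> \bar R) : 0 < r ->
  measurable_fun setT F -> (forall x, 0 <= F x)%E ->
  (r%:E * \int[leb]_x F (a + r * x)%R)%E = (\int[leb]_x F x)%E.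
Proof.
move=> r0 mF F0; pose phi (x : measurableTypeR R) : measurableTypeR R := a + r * x.
have mphi : measurable_fun setT phi.
  by apply: measurable_funD => //; exact: measurable_funM.
have r0' := ltW r0.
rewrite -[RHS](@eq_measure_integral _ _ _ _ leb (mscale (NngNum r0') (pushforward leb phi))).
  rewrite ge0_integral_mscale//.
  by rewrite (ge0_integral_pushforward mphi)//=.
move=> A mA _; apply/esym/lebesgue_measure_unique => // _ [[u v] _ <-].
rewrite lebesgue_measure_itv /= /mscale /= /pushforward /=.
have -> : phi @^-1` `]u, v]%classic = `](u - a) / r, (v - a) / r]%classic; last first.
  rewrite lebesgue_measure_itv /= !lte_fin ltr_pM2r ?invr_gt0// ltrD2r.
  case: ifPn => _; last by rewrite mule0.
  by rewrite -!EFinD -EFinM; congr EFin; field; rewrite gt_eqF.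
apply/seteqP; split => x /=; rewrite !in_itv /phi /= ltr_pdivrMr// ler_pdivlMr//.
  by rewrite ltrBlDl lerBrDl mulrC.
by rewrite ltrBlDl lerBrDl mulrC.
Qed.

Lemma ge0_integral_rVS n (F : 'rV[R]_n.+1 -> \bar R) :
  measurable_fun setT F -> (forall x, 0 <= F x)%E ->
  (\int[Leb n.+1]_x F x)%E = (\int[leb]_t \int[Leb n]_y F (rV_cons (t, y)))%E.
Proof.
move=> mF F0; rewrite /=.
rewrite (ge0_integral_pushforward (@measurable_rV_cons R n))//.
rewrite preimage_setT fubini_tonelli1//; last by move=> p; exact: F0.
exact: measurableT_comp mF (@measurable_rV_cons R n).
Qed.

Lemma rV_consD n (a : 'rV[R]_n.+1) (r t : R) (y : 'rV[R]_n) :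
  a + r *: rV_cons (t, y) =
  rV_cons (a ord0 ord0 + r * t, (\row_i a ord0 (lift ord0 i)) + r *: y).
Proof.
suff H i : (a + r *: rV_cons (t, y)) ord0 i = rV_cons
    (a ord0 ord0 + r * t, (\row_i a ord0 (lift ord0 i)) + r *: y) ord0 i.
  by apply/rowP => i; exact: H.
case: (unliftP ord0 i) => [j|] ->.
  by rewrite [RHS]rV_consS [LHS]mxE [X in _ + X]mxE [X in _ * X]rV_consS !mxE.
by rewrite [RHS]rV_cons0 [LHS]mxE [X in _ + X]mxE [X in _ * X]rV_cons0.
Qed.

(** Tonelli peels off one coordinate at a time, and each contributes one factor [r] through the
    one-dimensional case. *)
Lemma ge0_integral_rV_affine n (a : 'rV[R]_n) (r : R) (F : 'rV[R]_n -> \bar R) :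
  0 < r -> measurable_fun setT F -> (forall x, 0 <= F x)%E ->
  ((r ^+ n)%:E * \int[Leb n]_x F (a + r *: x)%R)%E = (\int[Leb n]_x F x)%E.
Proof.
move=> r0; elim: n a F => [|n IH] a F mF F0.
  rewrite expr0 mul1e; apply: eq_integral => x _; congr F.
  by rewrite [LHS]thinmx0 [RHS]thinmx0.
have maff : measurable_fun setT (fun x : 'rV[R]_n.+1 => F (a + r *: x)).
  exact: measurableT_comp mF (measurable_rVD _ _).
have mFc t : measurable_fun setT (fun y : 'rV[R]_n => F (rV_cons (t, y))).
  apply: measurableT_comp mF _; apply: measurableT_comp (@measurable_rV_cons R n) _.
  exact: pair1_measurable.
rewrite !ge0_integral_rVS//.
pose G t := (\int[Leb n]_y F (rV_cons (t, y)))%E.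
have mG : measurable_fun setT G.
  apply: (measurable_fun_fubini_tonelli_F (fun p => F (rV_cons p))) => //.
  exact: measurableT_comp mF (@measurable_rV_cons R n).
have G0 t : (0 <= G t)%E by exact: integral_ge0.
rewrite -(ge0_integral_affine (a ord0 ord0) r0 mG G0) exprS EFinM -muleA.
congr (_ * _)%E; rewrite -ge0_integralZl//; first last.
- by rewrite lee_fin exprn_ge0// ltW.
- by move=> t _; exact: integral_ge0.
- apply: (measurable_fun_fubini_tonelli_F (fun p => F (a + r *: rV_cons p))) => //.
  exact: measurableT_comp maff (@measurable_rV_cons R n).
apply: eq_integral => t _; rewrite /G.
rewrite -(IH (\row_i a ord0 (lift ord0 i)) (fun y => F (rV_cons (a ord0 ord0 + r * t, y))))//.
by congr (_ * _)%E; apply: eq_integral => y _; rewrite rV_consD.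
Qed.

Lemma cint_rV_affine n (a : 'rV[R]_n) (r : R) (f : 'rV[R]_n -> R[i]) : 0 < r ->
  cintegrable_on (Leb n) f ->
  cintegrable_on (Leb n) (fun x : 'rV[R]_n => f (a + r *: x)) /\
  ((r ^+ n)%:C)%C * cint (Leb n) (fun x : 'rV[R]_n => f (a + r *: x)) = cint (Leb n) f.
Proof.
move=> r0; apply: (@cint_change_of_variables _ _ _ (Leb n) (fun x : 'rV[R]_n => a + r *: x)).
- by rewrite exprn_gt0.
- exact: measurable_rVD.
- by move=> F mF F0; exact: ge0_integral_rV_affine.
Qed.

Lemma cint_R_affine (a r : R) (f : R -> R[i]) : 0 < r ->
  cintegrable_on leb f ->
  cintegrable_on leb (fun x : R => f (a + r * x)) /\
  (r%:C)%C * cint leb (fun x : R => f (a + r * x)) = cint leb f.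
Proof.
move=> r0; apply: (@cint_change_of_variables _ _ _ leb (fun x : R => a + r * x)) => //.
- by apply: measurable_funD => //; exact: measurable_funM.
- by move=> F mF F0; exact: ge0_integral_affine.
Qed.

Lemma cint_rVS n (f : 'rV[R]_n.+1 -> R[i]) : cintegrable_on (Leb n.+1) f ->
  cint (Leb n.+1) f = cint leb (fun t => cint (Leb n) (fun y => f (rV_cons (t, y)))).
Proof.
move=> If; have mc := @measurable_rV_cons R n.
have mf := cintegrable_measurable If.
have mfc : cmeasurable (fun p : measurableTypeR R * 'rV[R]_n => f (rV_cons p)) by exact: cmeasurable_comp mf mc.
have Ifc : cintegrable_on (leb \x Leb n)%E (fun p => f (rV_cons p)).
  apply: cintegrable12 => //; move/cintegrable_L1norm : If.
  rewrite /L1norm ge0_integral_rVS//.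
  - exact/measurable_EFinP/cmeasurable_normc.
  - by move=> x; rewrite lee_fin normc_ge0.
rewrite -(cint_prod1 Ifc); case: Ifc mf => i1 i2 [m1 m2].
apply: complex_ext => /=; congr fine.
  by rewrite (integral_pushforward mc)// ?preimage_setT//; exact/measurable_EFinP.
by rewrite (integral_pushforward mc)// ?preimage_setT//; exact/measurable_EFinP.
Qed.

Lemma prod_rV_cons n (h : 'I_n.+1 -> R -> R[i]) t y :
  \prod_(i < n.+1) h i (rV_cons (t, y) ord0 i) =
  h ord0 t * \prod_(i < n) h (lift ord0 i) (y ord0 i).
Proof.
by rewrite big_ord_recl rV_cons0; congr (_ * _); apply: eq_bigr => i _; rewrite rV_consS.
Qed.

Lemma cint_prod_rV n (h : 'I_n -> R -> R[i]) :
  (forall i, cintegrable_on leb (h i)) ->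
  cintegrable_on (Leb n) (fun x => \prod_(i < n) h i (x ord0 i)) /\
  cint (Leb n) (fun x => \prod_(i < n) h i (x ord0 i)) = \prod_(i < n) cint leb (h i).
Proof.
elim: n h => [|n IH] h Ih.
  (* In dimension 0 the measure is a point mass, so an integral is the value at 0, here the empty
     product. *)
  under eq_fun do rewrite big_ord0; rewrite big_ord0.
  have E (F : 'rV[R]_0 -> \bar R) : (\int[Leb 0]_x F x = F 0%R)%E.
    rewrite (_ : F = cst (F 0)) ?integral_cst//= ?diracT ?mule1//.
    by apply/funext => x; congr F; exact: thinmx0.
  split; last by apply: complex_ext; rewrite /= /Rintegral E.
  by split; apply/integrableP; split => //; rewrite E ltry.
have [Ip Ep] := IH (fun i => h (lift ord0 i)) (fun i => Ih (lift ord0 i)).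
have mprod : cmeasurable (fun x : 'rV[R]_n.+1 => \prod_(i < n.+1) h i (x ord0 i)).
  rewrite (_ : (fun x => _) = (fun x : 'rV[R]_n.+1 => h ord0 (x ord0 ord0) *
      \prod_(i < n) h (lift ord0 i) ((\row_j x ord0 (lift ord0 j)) ord0 i))).
    apply: cmeasurableM.
      apply: (cmeasurable_comp (cintegrable_measurable (Ih ord0))).
      exact: measurable_rV_entry.
    apply: (cmeasurable_comp (cintegrable_measurable Ip)).
    apply/measurable_fun_rVP => i; rewrite /comp /rV_coord.
    by under eq_fun do rewrite mxE; exact: measurable_rV_entry.
  apply/funext => x; rewrite big_ord_recl; congr (_ * _).
  by apply: eq_bigr => i _; rewrite mxE.
have If : cintegrable_on (Leb n.+1) (fun x => \prod_(i < n.+1) h i (x ord0 i)).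
  apply: L1norm_lty => //; rewrite /L1norm ge0_integral_rVS//; first last.
  - by move=> x; rewrite lee_fin normc_ge0.
  - exact/measurable_EFinP/cmeasurable_normc.
  under eq_integral.
    move=> t _; under eq_integral do rewrite prod_rV_cons Normc.normcM EFinM.
    rewrite ge0_integralZl//; first last.
    - by rewrite lee_fin normc_ge0.
    - by move=> x _; rewrite lee_fin normc_ge0.
    - exact/measurable_EFinP/cmeasurable_normc/(cintegrable_measurable Ip).
    over.
  rewrite ge0_integralZr//=; first last.
  - by apply: integral_ge0 => x _; rewrite lee_fin normc_ge0.
  - by move=> x _; rewrite lee_fin normc_ge0.
  - exact/measurable_EFinP/cmeasurable_normc/(cintegrable_measurable (Ih ord0)).
  apply: lte_mul_pinfty.
  - by apply: integral_ge0 => x _; rewrite lee_fin normc_ge0.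
  - rewrite ge0_fin_numE ?(cintegrable_L1norm (Ih ord0))//.
    by apply: integral_ge0 => x _; rewrite lee_fin normc_ge0.
  - exact: cintegrable_L1norm Ip.
split=> //; rewrite cint_rVS// big_ord_recl -Ep [RHS]mulrC -cintZ//.
apply: eq_cint => t; rewrite mulrC -cintZ//.
by apply: eq_cint => y; rewrite prod_rV_cons.
Qed.

End integral_rV.

(** * Gaussians and their Fourier transforms *)

Section complex_derivative.
Context {R : realType}.
Local Open Scope complex_scope.
Implicit Types (f g : R -> R[i]) (t : R).

Definition is_cderive f t (l : R[i]) :=
  is_derive t 1 (fun s => complex.Re (f s)) (complex.Re l) /\
  is_derive t 1 (fun s => complex.Im (f s)) (complex.Im l).

Lemma is_cderive_eq f t l l' : is_cderive f t l -> l = l' -> is_cderive f t l'.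
Proof. by move=> ? <-. Qed.

Lemma is_cderive_unique f t l l' : is_cderive f t l -> is_cderive f t l' -> l = l'.
Proof.
move=> [[_ a] [_ b]] [[_ a'] [_ b']].
by apply: complex_ext; rewrite -?a -?a' -?b -?b'.
Qed.

Lemma is_cderive_cst z t : is_cderive (fun=> z) t 0.
Proof. by split; exact: is_derive_cst. Qed.

Lemma is_cderiveD f g t l m : is_cderive f t l -> is_cderive g t m ->
  is_cderive (fun s => f s + g s) t (l + m).
Proof.
move=> [f1 f2] [g1 g2]; split.
  by under eq_fun do rewrite cReD; rewrite cReD; exact: is_deriveD.
by under eq_fun do rewrite cImD; rewrite cImD; exact: is_deriveD.
Qed.

Lemma is_cderiveM f g t l m : is_cderive f t l -> is_cderive g t m ->
  is_cderive (fun s => f s * g s) t (f t * m + l * g t).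
Proof.
move=> [f1 f2] [g1 g2]; split.
  under eq_fun do rewrite cReM; rewrite cReD !cReM.
  have := is_deriveB (is_deriveM f1 g1) (is_deriveM f2 g2).
  move=> /is_derive_eq; apply.
  by rewrite /GRing.scale /=; ring.
under eq_fun do rewrite cImM; rewrite cImD !cImM.
have := is_deriveD (is_deriveM f1 g2) (is_deriveM f2 g1).
move=> /is_derive_eq; apply.
by rewrite /GRing.scale /=; ring.
Qed.

Lemma is_cderiveZ z f t l : is_cderive f t l -> is_cderive (fun s => z * f s) t (z * l).
Proof.
move=> /(is_cderiveM (is_cderive_cst z t))/is_cderive_eq; apply.
by rewrite mul0r addr0.
Qed.

Lemma is_cderive_real (h : R -> R) t l : is_derive t 1 h l ->
  is_cderive (fun s => (h s)%:C) t l%:C.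
Proof. by move=> dh; split=> //=; exact: is_derive_cst. Qed.

Lemma is_cderive_cis (h : R -> R) t l : is_derive t 1 h l ->
  is_cderive (fun s => cis (h s)) t ((0 +i* l) * cis (h t)).
Proof.
move=> dh; split.
  apply: (@is_derive_eq _ _ _ (cos \o h)).
  by rewrite cReM /=; ring.
apply: (@is_derive_eq _ _ _ (sin \o h)).
by rewrite cImM /=; ring.
Qed.

Lemma is_cderive_shift f (x t : R) l :
  is_cderive f (x + t) l -> is_cderive (fun s => f (x + s)) t l.
Proof.
have main (h : R -> R) (m : R) : is_derive (x + t) 1 h m ->
    is_derive t 1 (fun s => h (x + s)) m.
  move=> dh; apply: (@is_derive_eq _ _ _ (h \o (fun s => x + s))).
  by rewrite /GRing.scale /=; ring.
by move=> [f1 f2]; split; apply: main.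
Qed.

End complex_derivative.

Section complex_derivative_under_integral.
Context {R : realType} d {T : measurableType d} (mu : {measure set T -> \bar R}).

(** Domination is asked for [t] within distance 1 of [a], because a gaussian or a Schwartz function
    has a common integrable majorant for its translates only under bounded shifts. *)
Lemma is_cderive_cint (f f' : R -> T -> R[i]) (a : R) (G : T -> R) :
  (forall t, a - 1 < t < a + 1 -> cintegrable_on mu (f t)) ->
  (forall t x, a - 1 < t < a + 1 -> is_cderive (f ^~ x) t (f' t x)) ->
  (forall t x, a - 1 < t < a + 1 -> Normc.normc (f' t x) <= G x) ->
  mu.-integrable setT (EFin \o G) ->
  is_cderive (fun t => cint mu (f t)) a (cint mu (f' a)).
Proof.
have aa : a - 1 < a < a + 1 by rewrite ltrBlDr ltrDl ltr01.
have main (h h' : R -> T -> R) :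
    (forall t, a - 1 < t < a + 1 -> mu.-integrable setT (EFin \o h t)) ->
    (forall t x, a - 1 < t < a + 1 -> is_derive t 1 (h ^~ x) (h' t x)) ->
    (forall t x, a - 1 < t < a + 1 -> `|h' t x| <= G x) ->
    mu.-integrable setT (EFin \o G) ->
    is_derive a 1 (fun t => \int[mu]_x h t x) (\int[mu]_x h' a x).
  move=> Ih dh hG IG.
  have hE t x : a - 1 < t < a + 1 -> partial1of2 h t x = h' t x.
    by move=> at1; rewrite partial1of2E; case: (dh t x at1).
  have I1 t : `]a - 1, a + 1[%classic t -> a - 1 < t < a + 1 by rewrite /= in_itv.
  have aI : `]a - 1, a + 1[%classic a by rewrite /= in_itv.
  have dd t x : `]a - 1, a + 1[%classic t -> [set: T] x -> derivable (h ^~ x) t 1.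
    by move=> /I1 /(dh t x) [].
  have bd t x : `]a - 1, a + 1[%classic t -> [set: T] x -> `|partial1of2 h t x| <= G x.
    by move=> /I1 t1 _; rewrite hE//; exact: hG.
  have G0 x : 0 <= G x by rewrite (le_trans _ (hG a x aa)).
  have ii t : `]a - 1, a + 1[%classic t -> mu.-integrable setT (EFin \o h t).
    by move=> /I1; exact: Ih.
  split.
    exact: (derivable_under_integral measurableT aI ii dd G0 IG bd).
  rewrite -derive1E (differentiation_under_integral measurableT aI ii dd G0 IG bd).
  by apply: eq_Rintegral => x _; rewrite hE.
move=> If df fG IG; split.
  apply: (main (fun t x => complex.Re (f t x)) (fun t x => complex.Re (f' t x))) IG.
  - by move=> t /If[].
  - by move=> t x /(df t x)[].
  - by move=> t x /(fG t x); apply: le_trans; exact: ler_Re_normc.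
apply: (main (fun t x => complex.Im (f t x)) (fun t x => complex.Im (f' t x))) IG.
- by move=> t /If[].
- by move=> t x /(df t x)[].
- by move=> t x /(fG t x); apply: le_trans; exact: ler_Im_normc.
Qed.

End complex_derivative_under_integral.

(** * Fourier transform of the gaussian in dimension one *)

Section gaussian_dim1.
Context {R : realType}.
Local Open Scope complex_scope.
Local Notation leb := (@lebesgue_measure R).
Implicit Types x t xi : R.

(** The majorant for gaussians that are shifted by less than 1 or multiplied by a linear factor.
    Halving the variable reduces it to the standard gaussian. *)
Lemma integrable_gauss_half :
  leb.-integrable setT (EFin \o (fun x => expR (- x ^+ 2 / 4))).
Proof.
have mg : measurable_fun [set: R] (fun x : R => expR (- x ^+ 2 / 4)).
  by apply: measurableT_comp => //; apply: measurable_funM => //; exact: measurableT_comp.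
apply/integrableP; split; first exact/measurable_EFinP.
have /integrableP[_] := @integrableT_gauss R.
rewrite -(@ge0_integral_affine R 0 (2^-1) (fun x => `|(gauss_fun x)%:E|)%E) ?invr_gt0//.
- rewrite muleC -lte_pdivlMr ?invr_gt0// invrK => /lt_le_trans /(_ (leey _)).
  apply: le_lt_trans; apply: ge0_le_integral => //.
  - exact/measurableT_comp/measurable_EFinP.
  - apply/measurableT_comp => //; apply/measurable_EFinP.
    apply: measurableT_comp; first exact: measurable_gauss_fun.
    by apply: measurable_funD => //; exact: measurable_funM.
  - by move=> x _ /=; rewrite lee_fin /gauss_fun add0r exprMn (_ : - _ / 4 = - (2^-1 ^+ 2 * x ^+ 2)) ?lexx//; field.
- by apply/measurableT_comp => //; apply/measurable_EFinP; exact: measurable_gauss_fun.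
Qed.

Lemma ler_sqr_expR x : `|x| <= expR (x ^+ 2 / 4) * 1.
Proof.
rewrite mulr1 (le_trans _ (expR_ge1Dx _))//.
rewrite -subr_ge0 -(real_normK (num_real x)).
have -> : 1 + `|x| ^+ 2 / 4 - `|x| = (1 - `|x| / 2) ^+ 2 by field.
exact: sqr_ge0.
Qed.

Let mgauss : measurable_fun [set: R] (@gauss_fun R).
Proof. exact: measurable_gauss_fun. Qed.

Let cgauss_cis xi : @cmeasurable _ (measurableTypeR R) R (fun x : R => (gauss_fun x)%:C * cis (x * xi)).
Proof.
apply: cmeasurableM; first exact: cmeasurable_real.
by apply: cmeasurable_cis; exact: measurable_funM.
Qed.

Lemma cintegrable_gauss_cis xi :
  cintegrable_on leb (fun x : R => (gauss_fun x)%:C * cis (x * xi)).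
Proof.
apply: (@le_cintegrable _ (measurableTypeR R) R leb) (@integrableT_gauss R) => // x.
by rewrite Normc.normcM normc_cis mulr1 normc_real ger0_norm ?gauss_fun_ge0.
Qed.

Let is_derive_gauss x : is_derive x 1 (@gauss_fun R) (- 2 * x * gauss_fun x).
Proof.
apply: (@is_derive_eq _ _ _ (expR \o (fun x => - x ^+ 2))).
by rewrite /gauss_fun /GRing.scale /=; ring.
Qed.

Let normc_lin x (u v : R) : Normc.normc (u +i* v) <= `|u| + `|v|.
Proof. exact: (le_trans (ler_normc_abs _)). Qed.

(** From [(x + t)^2 = x^2/2 + (x + 2t)^2/2 - t^2] and [t^2 < 1]. *)
Let gauss_shift_bound t x : - 1 < t < 1 -> gauss_fun (x + t) <= expR 1 * expR (- x ^+ 2 / 2).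
Proof.
move=> /andP[t1 t2]; rewrite -expRD ler_expR.
by have := sqr_ge0 (x + 2 * t); have := sqr_ge0 t; nra.
Qed.

Let poly_gauss_bound x (c : R) : 0 <= c ->
  (2 * `|x| + c) * expR (- x ^+ 2 / 2) <= (2 + c) * expR (- x ^+ 2 / 4).
Proof.
(* One half of the exponent absorbs the linear factor, and the other half remains as the
   majorant. *)
move=> c0; have -> : - x ^+ 2 / 2 = - x ^+ 2 / 4 + - x ^+ 2 / 4 by field.
rewrite expRD mulrA ler_wpM2r ?expR_ge0//.
have e1 : expR (x ^+ 2 / 4) * expR (- x ^+ 2 / 4) = 1.
  by rewrite -expRD mulNr subrr expR0.
have e2 : expR (- x ^+ 2 / 4) <= 1.
  by rewrite -expR0 ler_expR mulNr oppr_le0 divr_ge0 ?sqr_ge0.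
have e3 : `|x| * expR (- x ^+ 2 / 4) <= 1.
  by rewrite -[leRHS]e1 ler_wpM2r ?expR_ge0// -[leRHS]mulr1 ler_sqr_expR.
by rewrite mulrDl -mulrA lerD ?ler_piMr// ler_piMr.
Qed.

Let F xi := cint leb (fun x : R => (gauss_fun x)%:C * cis (x * xi)).

Let dF xi : is_cderive F xi
  (cint leb (fun x : R => (gauss_fun x)%:C * ((0 +i* x) * cis (x * xi)))).
Proof.
apply: (@is_cderive_cint _ _ _ leb
  (fun xi x => (gauss_fun x)%:C * cis (x * xi))
  (fun xi x => (gauss_fun x)%:C * ((0 +i* x) * cis (x * xi))) xi
  (fun x => 2 * expR (- x ^+ 2 / 4))).
- by move=> t _; exact: cintegrable_gauss_cis.
- move=> t x _; apply: is_cderiveZ; apply: is_cderive_cis.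
  by apply: is_derive_eq; rewrite /GRing.scale /=; ring.
- move=> t x _; rewrite !Normc.normcM normc_cis mulr1 normc_real ger0_norm ?gauss_fun_ge0//.
  have := @poly_gauss_bound x 0 (lexx _); rewrite !addr0; apply: le_trans.
  rewrite mulrC ler_pM ?normc_ge0 ?gauss_fun_ge0//.
    by rewrite (le_trans (normc_lin _ _ _))// normr0 add0r ler_peMl// ler1n.
  by rewrite ler_expR; have := sqr_ge0 x; lra.
- exact: (integrableZl measurableT 2 integrable_gauss_half).
Qed.

(* Translation invariance: [cint (gauss (x + t) cis ((x + t) xi))] does not depend
   on [t], so its derivative vanishes. *)
Let parts xi :
  cint leb (fun x : R => (gauss_fun x)%:C * (((- 2 * x) +i* xi) * cis (x * xi))) = 0.
Proof.
pose g x := (gauss_fun x)%:C * cis (x * xi).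
pose g' x := (gauss_fun x)%:C * (((- 2 * x) +i* xi) * cis (x * xi)).
have dg x : is_cderive g x (g' x).
  apply: is_cderive_eq.
    apply: is_cderiveM; first exact: is_cderive_real (is_derive_gauss x).
    by apply: (@is_cderive_cis _ ( *%R^~ xi)); apply: is_derive_eq.
  rewrite /g' /GRing.scale /=.
  by apply: complex_ext; rewrite ?cReD ?cImD ?cReM ?cImM /= ?cReM ?cImM /=; ring.
have Ig t : cintegrable_on leb (fun x => g (x + t)).
  have [+ _] := @cint_R_affine R t 1 g ltr01 (cintegrable_gauss_cis xi).
  by under eq_fun do rewrite mul1r addrC.
have Eg t : cint leb (fun x => g (x + t)) = F xi.
  have [_] := @cint_R_affine R t 1 g ltr01 (cintegrable_gauss_cis xi).
  by under eq_fun do rewrite mul1r addrC; rewrite mul1r.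
have /is_cderive_unique : is_cderive (fun t => cint leb (fun x => g (x + t))) 0
    (cint leb (fun x => g' (x + 0))).
  apply: (@is_cderive_cint _ _ _ leb (fun t x => g (x + t)) (fun t x => g' (x + t)) 0
    (fun x => expR 1 * ((2 + (2 + `|xi|)) * expR (- x ^+ 2 / 4)))).
  - by [].
  - by move=> t x _; exact: is_cderive_shift.
  - move=> t x; rewrite sub0r add0r => t1.
    rewrite /g' !Normc.normcM normc_cis mulr1 normc_real ger0_norm ?gauss_fun_ge0//.
    rewrite mulrC (@le_trans _ _ ((2 * `|x| + (2 + `|xi|)) * (expR 1 * expR (- x ^+ 2 / 2))))//.
      rewrite ler_pM ?normc_ge0 ?gauss_fun_ge0 ?gauss_shift_bound//.
      rewrite (le_trans (normc_lin _ _ _))// addrA lerD2r normrM normrN normr_nat.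
      have -> : 2 * `|x| + 2 = 2 * (`|x| + 1) by ring.
      rewrite ler_pM2l// (le_trans (ler_normD _ _))// lerD2l.
      by rewrite ltW// ltr_norml.
    rewrite mulrCA ler_wpM2l ?expR_ge0//.
    by apply: poly_gauss_bound; rewrite addr_ge0.
  - have := integrableZl measurableT (expR 1 * (2 + (2 + `|xi|))) integrable_gauss_half.
    by apply: eq_integrable => // x _; rewrite /= -EFinM mulrA.
move=> g'0; transitivity (cint leb (fun x => g' (x + 0))).
  by apply: eq_cint => x; rewrite addr0.
apply: g'0.
by under eq_fun do rewrite Eg; exact: is_cderive_cst.
Qed.

Let dF_integrable xi :
  cintegrable_on leb (fun x : R => (gauss_fun x)%:C * ((0 +i* x) * cis (x * xi))).
Proof.
apply: (@le_cintegrable _ (measurableTypeR R) R leb _ (fun x => 2 * expR (- x ^+ 2 / 4))).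
- apply: cmeasurableM; first exact: cmeasurable_real.
  apply: cmeasurableM; first by split=> //=; exact: measurable_cst.
  by apply: cmeasurable_cis; exact: measurable_funM.
- move=> x; rewrite !Normc.normcM normc_cis mulr1 normc_real ger0_norm ?gauss_fun_ge0//.
  have := @poly_gauss_bound x 0 (lexx _); rewrite !addr0; apply: le_trans.
  rewrite mulrC ler_pM ?normc_ge0 ?gauss_fun_ge0//.
    by rewrite (le_trans (normc_lin _ _ _))// normr0 add0r ler_peMl// ler1n.
  by rewrite ler_expR; have := sqr_ge0 x; lra.
- exact: (integrableZl measurableT 2 integrable_gauss_half).
Qed.

(** Combining [dF] with [parts] gives the linear equation [F' = - (y/2) F]. Hence [exp(y^2/4) F(y)]
    is constant, and its value at 0 is the Gauss integral. *)
Lemma cint_gauss_cis xi :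
  F xi = (Num.sqrt pi * expR (- xi ^+ 2 / 4))%:C.
Proof.
have F' y : is_cderive F y ((- (y / 2))%:C * F y).
  apply: is_cderive_eq (dF y) _.
  have Ig := cintegrable_gauss_cis y; have Ig' := dF_integrable y.
  have := parts y.
  (* Since [-2x = 2i (i x)], the identity [parts] reads [2i F' + i y F = 0]. *)
  rewrite (_ : (fun x => _) = (fun x => (0 +i* 2) * ((gauss_fun x)%:C * ((0 +i* x) * cis (x * y)))
     + (0 +i* y) * ((gauss_fun x)%:C * cis (x * y)))); last first.
    by apply/funext => x; apply: complex_ext;
      rewrite ?cReD ?cImD ?cReM ?cImM /= ?cReM ?cImM /= ?cReM ?cImM /=; ring.
  rewrite cintD ?cintZ//; [|exact: cintegrableZ|exact: cintegrableZ].
  rewrite -/(F y); move: (cint leb _) (F y) => u v uv0.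
  have -> : u = (0 -i* 2^-1) * ((0 +i* 2) * u).
    by case: u {uv0} => a b; apply: complex_ext; rewrite ?cReM ?cImM /=; field.
  rewrite (_ : (0 +i* 2) * u = - ((0 +i* y) * v)); last by apply/eqP; rewrite -addr_eq0 uv0.
  by case: v {uv0} => a b; apply: complex_ext; rewrite ?cReM ?cImM ?cReN ?cImN ?cReM ?cImM /=; field.
pose H y := (expR (y ^+ 2 / 4))%:C * F y.
have dH y : is_cderive H y 0.
  apply: is_cderive_eq.
    apply: is_cderiveM (F' y).
    apply: (@is_cderive_real _ (expR \o (fun y => y ^+ 2 / 4))).
  by rewrite /GRing.scale /=; apply: complex_ext; rewrite ?cReD ?cImD ?cReM ?cImM /=; field.
have H0 : H xi = H 0.
  by apply: complex_ext;
    [apply: (@is_derive_0_is_cst _ (fun y => complex.Re (H y)))|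
     apply: (@is_derive_0_is_cst _ (fun y => complex.Im (H y)))] => y; case: (dH y).
have F0 : H 0 = (Num.sqrt pi)%:C.
  rewrite /H /F expr0n mul0r expR0 mul1r.
  under eq_fun do rewrite mulr0 cis0 mulr1.
  apply: complex_ext; rewrite /= /Rintegral; first by rewrite integralT_gauss.
  by rewrite integral0.
rewrite -[LHS]mul1r (_ : 1 = (expR (- xi ^+ 2 / 4))%:C * (expR (xi ^+ 2 / 4))%:C).
  by rewrite -mulrA -/(H xi) H0 F0; apply: complex_ext; rewrite ?cReM ?cImM /=; ring.
by rewrite -rmorphM -expRD mulNr addNr expR0.
Qed.

End gaussian_dim1.

Section dotp.
Context {R : realType} {n : nat}.
Implicit Types (x y z : 'rV[R]_n) (r : R).

Lemma dotpC x y : dotp x y = dotp y x.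
Proof. by apply: eq_bigr => i _; rewrite mulrC. Qed.

Lemma dotpDl x y z : dotp (x + y) z = dotp x z + dotp y z.
Proof. by rewrite -big_split; apply: eq_bigr => i _; rewrite mxE mulrDl. Qed.

Lemma dotpZl r x y : dotp (r *: x) y = r * dotp x y.
Proof. by rewrite /dotp mulr_sumr; apply: eq_bigr => i _; rewrite mxE mulrA. Qed.

Lemma dotpNl x y : dotp (- x) y = - dotp x y.
Proof. by rewrite -scaleN1r dotpZl mulN1r. Qed.

Lemma dotpDr x y z : dotp z (x + y) = dotp z x + dotp z y.
Proof. by rewrite dotpC dotpDl !(dotpC z). Qed.

Lemma dotpZr r x y : dotp x (r *: y) = r * dotp x y.
Proof. by rewrite dotpC dotpZl dotpC. Qed.

Lemma dotpNr x y : dotp x (- y) = - dotp x y.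
Proof. by rewrite dotpC dotpNl dotpC. Qed.

Lemma dotp0l x : dotp 0 x = 0.
Proof. by rewrite -(scale0r 0) dotpZl mul0r. Qed.

Lemma dotp_ge0 x : 0 <= dotp x x.
Proof. by apply: sumr_ge0 => i _; rewrite -expr2 sqr_ge0. Qed.

Lemma dotp_delta (j : 'I_n) x : dotp (delta_mx ord0 j) x = x ord0 j.
Proof.
rewrite /dotp (bigD1 j)//= mxE !eqxx mul1r big1 ?addr0// => i ij.
by rewrite mxE (negbTE ij) andbF mul0r.
Qed.

Lemma sqr_entry_le_dotp (j : 'I_n) x : x ord0 j ^+ 2 <= dotp x x.
Proof.
rewrite /dotp (bigD1 j)//= -expr2 lerDl.
by apply: sumr_ge0 => i _; rewrite -expr2 sqr_ge0.
Qed.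

Lemma measurable_dotp2 :
  measurable_fun setT (fun p : 'rV[R]_n * 'rV[R]_n => dotp p.1 p.2).
Proof.
apply: measurable_sum => i; apply: measurable_funM.
  by apply: (@measurableT_comp _ _ _ _ _ _ (fun x : 'rV[R]_n => x ord0 i)) => //;
    exact: measurable_rV_entry.
by apply: (@measurableT_comp _ _ _ _ _ _ (fun x : 'rV[R]_n => x ord0 i)) => //;
  exact: measurable_rV_entry.
Qed.

Lemma measurable_dotpl y : measurable_fun setT (fun x => dotp x y).
Proof.
by apply: measurable_sum => i; apply: measurable_funM => //; exact: measurable_rV_entry.
Qed.

Lemma measurable_dotpr y : measurable_fun setT (fun x => dotp y x).
Proof. by under eq_fun do rewrite dotpC; exact: measurable_dotpl. Qed.

Lemma measurable_dotp : measurable_fun setT (fun x => dotp x x).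
Proof. by apply: measurable_sum => i; apply: measurable_funM; exact: measurable_rV_entry. Qed.

Lemma continuous_dotpl y : continuous (fun x => dotp x y).
Proof.
move=> x; have FF := nbhs_filter x.
apply: cvg_big => [|i _]; first exact: add_continuous.
by apply: cvgM; [exact: coord_continuous|exact: cvg_cst].
Qed.

Lemma continuous_dotp : continuous (fun x => dotp x x).
Proof.
move=> x; have FF := nbhs_filter x.
apply: cvg_big => [|i _]; first exact: add_continuous.
by apply: cvgM; exact: coord_continuous.
Qed.

End dotp.

(** * Modulated gaussians on R^n and the approximate identity they produce *)

Section gaussian.
Context {R : realType} {n : nat}.
Local Open Scope complex_scope.
Local Notation Leb := (@lebesgue_rV R n).
Local Notation Rn := 'rV[R]_n.
Implicit Types (x y z xi eta : Rn) (e r : R).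

Definition gaussn x : R := expR (- dotp x x).

Lemma gaussn_ge0 x : 0 <= gaussn x. Proof. exact: expR_ge0. Qed.

Lemma gaussn_le1 x : gaussn x <= 1.
Proof. by rewrite -expR0 ler_expR oppr_le0 dotp_ge0. Qed.

Lemma gaussnN x : gaussn (- x) = gaussn x.
Proof. by rewrite /gaussn dotpNl dotpNr opprK. Qed.

Lemma normc_gaussn x : Normc.normc (gaussn x)%:C = gaussn x.
Proof. by rewrite normc_real ger0_norm ?gaussn_ge0. Qed.

Lemma measurable_gaussn : measurable_fun setT gaussn.
Proof.
apply: measurableT_comp => //; apply: measurableT_comp => //; exact: measurable_dotp.
Qed.

Lemma gaussn_cisE x xi :
  \prod_(i < n) ((gauss_fun (x ord0 i))%:C * cis (x ord0 i * xi ord0 i)) =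
  (gaussn x)%:C * cis (dotp x xi).
Proof.
rewrite big_split /=; congr (_ * _).
  rewrite -rmorph_prod -expR_sum /gaussn; congr (expR _)%:C.
  by rewrite -sumrN; apply: eq_bigr => i _; rewrite expr2.
by rewrite /dotp (big_morph _ cisD cis0).
Qed.

Lemma cintegrable_gaussn_cis xi :
  cintegrable_on Leb (fun x => (gaussn x)%:C * cis (dotp x xi)).
Proof.
under eq_fun do rewrite -gaussn_cisE.
have [|I _] := @cint_prod_rV R n (fun i t => (gauss_fun t)%:C * cis (t * xi ord0 i)).
  by move=> i; exact: cintegrable_gauss_cis.
exact: I.
Qed.

Lemma cint_gaussn_cis xi : cint Leb (fun x => (gaussn x)%:C * cis (dotp x xi)) =
  (Num.sqrt pi ^+ n * gaussn (2^-1 *: xi))%:C.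
Proof.
under eq_fun do rewrite -gaussn_cisE.
have [|_ ->] := @cint_prod_rV R n (fun i t => (gauss_fun t)%:C * cis (t * xi ord0 i)).
  by move=> i; exact: cintegrable_gauss_cis.
under eq_bigr do rewrite cint_gauss_cis.
rewrite -rmorph_prod big_split /= prodr_const card_ord; congr (_ * _)%:C.
rewrite -expR_sum /gaussn; congr expR; rewrite dotpZl dotpZr mulrA.
by rewrite /dotp mulr_sumr -sumrN; apply: eq_bigr => i _; field.
Qed.

Lemma integrable_gaussn : Leb.-integrable setT (EFin \o gaussn).
Proof.
have [+ _] := cintegrable_gaussn_cis 0.
apply: eq_integrable => // x _.
by rewrite dotpC dotp0l cis0 mulr1.
Qed.

Lemma cintegrable_gaussn : cintegrable_on Leb (fun x => (gaussn x)%:C).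
Proof.
have := cintegrable_gaussn_cis 0.
by under eq_fun do rewrite dotpC dotp0l cis0 mulr1.
Qed.

(** A plane wave of frequency [x] damped by a wide gaussian. As [e] tends to 0 its Fourier transform
    tends to [(2 pi)^n] times the point mass at [x]. *)
Definition gauss_wave x e xi : R[i] := (gaussn (e *: xi))%:C * cis (dotp x xi).

Lemma fourier_gauss_wave x e y : 0 < e ->
  fourier_int (gauss_wave x e) y =
  ((Num.sqrt pi / e) ^+ n * gaussn ((2 * e)^-1 *: (y - x)))%:C.
Proof.
move=> e0.
(* Chosen so that [dotp (e z) eta = dotp z (x - y)]: rescaling by [e] then reduces the integral to
   the unit gaussian. *)
pose eta := e^-1 *: (x - y).
have [_ +] := @cint_rV_affine R n 0 e _ e0 (cintegrable_gaussn_cis eta).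
rewrite cint_gaussn_cis.
have -> : cint Leb (fun z : Rn => (gaussn (0 + e *: z))%:C * cis (dotp (0 + e *: z) eta)) =
    fourier_int (gauss_wave x e) y.
  apply: eq_cint => z; rewrite add0r /gauss_wave -cisN mulrCA -cisD; congr (_ * cis _).
  rewrite /eta dotpZl dotpZr mulrA divff ?gt_eqF// mul1r dotpDr dotpNr addrC.
  by rewrite (dotpC z x).
move=> H; rewrite -[LHS]mul1r (_ : 1 = ((e ^+ n)^-1)%:C * (e ^+ n)%:C); last first.
  by rewrite -rmorphM mulVf// expf_neq0// gt_eqF.
rewrite -mulrA H -rmorphM; congr (_%:C).
rewrite expr_div_n mulrA [_^-1 * _]mulrC; congr (_ * _).
rewrite /eta scalerA -invfM -gaussnN -scalerN opprB; congr (gaussn (_ *: _)).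
Qed.

(** The kernel is an even function of [y - x]. This symmetry lets the centre and the variable trade
    places after Fubini. *)
Lemma gauss_wave_fourierC x e y : 0 < e ->
  fourier_int (gauss_wave x e) y = fourier_int (gauss_wave y e) x.
Proof.
by move=> e0; rewrite (fourier_gauss_wave x y e0) (fourier_gauss_wave y x e0) -[in LHS]gaussnN -scalerN opprB.
Qed.

Lemma cintegrable_gaussn_affine x r : 0 < r ->
  cintegrable_on Leb (fun y => (gaussn (r *: (y - x)))%:C).
Proof.
move=> r0; have [+ _] := @cint_rV_affine R n (- (r *: x)) r _ r0 cintegrable_gaussn.
by under eq_fun do rewrite addrC -scalerBr.
Qed.

Lemma cintegrable_fourier_gauss_wave x e : 0 < e ->
  cintegrable_on Leb (fourier_int (gauss_wave x e)).
Proof.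
move=> e0; rewrite (_ : fourier_int _ = fun y => ((Num.sqrt pi / e) ^+ n)%:C *
    (gaussn ((2 * e)^-1 *: (y - x)))%:C); last first.
  by apply/funext => y; rewrite fourier_gauss_wave// rmorphM.
by apply: cintegrableZ; apply: cintegrable_gaussn_affine; rewrite invr_gt0 mulr_gt0.
Qed.

(* After the substitution [y = x + 2 e z] the kernel becomes the fixed gaussian
   [(2 sqrt pi)^n gaussn z], whose mass is [(2 pi)^n]. *)
Lemma cint_fourier_gauss_wave (h : Rn -> R[i]) (M : R) x e : 0 < e ->
  cmeasurable h -> (forall y, Normc.normc (h y) <= M) ->
  cint Leb (fun y => h y * fourier_int (gauss_wave x e) y) =
  cint Leb (fun z => h (x + (2 * e) *: z) * ((2 * Num.sqrt pi) ^+ n * gaussn z)%:C).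
Proof.
move=> e0 mh hM.
have Ih := cintegrable_bndl mh hM (cintegrable_fourier_gauss_wave x e0).
have e20 : 0 < 2 * e by rewrite mulr_gt0.
have [I2 <-] := @cint_rV_affine R n x (2 * e) _ e20 Ih.
rewrite -cintZ//; apply: eq_cint => z.
rewrite mulrCA; congr (_ * _); rewrite fourier_gauss_wave// -rmorphM; congr (_%:C).
rewrite [x + _]addrC addrK scalerA mulVf ?gt_eqF// scale1r mulrA; congr (_ * _).
by rewrite -exprMn; congr (_ ^+ _); field; rewrite gt_eqF.
Qed.

(** After the substitution only the argument of [h] depends on [k], so continuity at [x] and
    domination by [M] times a fixed gaussian give the limit. The constant arises from
    [2 sqrt pi * sqrt pi = 2 pi] in each coordinate. *)
Lemma gauss_wave_cvg (h : Rn -> R[i]) (M : R) x :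
  cmeasurable h -> ccontinuous h -> (forall y, Normc.normc (h y) <= M) ->
  ccvg (fun k => cint Leb (fun y => h y * fourier_int (gauss_wave x k.+1%:R^-1) y))
       (((2 * pi) ^+ n)%:C * h x).
Proof.
move=> mh ch hM.
have k0 k : 0 < k.+1%:R^-1 :> R by rewrite invr_gt0.
under eq_fun do rewrite (cint_fourier_gauss_wave x (k0 _) mh hM).
have -> : ((2 * pi) ^+ n)%:C * h x =
    cint Leb (fun z => h x * ((2 * Num.sqrt pi) ^+ n * gaussn z)%:C).
  under eq_fun do rewrite rmorphM mulrA.
  rewrite cintZ; last exact: cintegrable_gaussn.
  have := cint_gaussn_cis 0; under eq_fun do rewrite dotpC dotp0l cis0 mulr1.
  move=> ->; rewrite scaler0 /gaussn dotp0l oppr0 expR0 mulr1 -mulrA -rmorphM mulrC.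
  congr (_ * (_%:C)); rewrite -exprMn -mulrA -expr2 sqr_sqrtr//; exact: pi_ge0.
apply: (@cdominated_cvg _ _ _ Leb _ _ (fun z => M * ((2 * Num.sqrt pi) ^+ n * gaussn z))).
- move=> k; apply: cmeasurableM; first by apply: cmeasurable_comp mh _; exact: measurable_rVD.
  by apply: cmeasurable_real; apply: measurable_funM => //; exact: measurable_gaussn.
- apply: cmeasurableM; first exact: cmeasurable_cst.
  by apply: cmeasurable_real; apply: measurable_funM => //; exact: measurable_gaussn.
- apply: aeW => z; apply: ccvgM; last exact: ccvg_cst.
  have xz : (x + (2 * k.+1%:R^-1) *: z : Rn) @[k --> \oo] --> x.
    rewrite -[X in _ --> X]addr0; apply: cvgD; first exact: cvg_cst.
    rewrite -[X in _ --> X](scale0r z); apply: cvgZr_tmp.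
    by rewrite -(mulr0 2); apply: cvgM; [exact: cvg_cst|exact: cvg_harmonic].
  by case: ch => c1 c2; split; [exact: (cvg_comp _ _ xz (c1 x))|exact: (cvg_comp _ _ xz (c2 x))].
- have := integrableZl measurableT (M * (2 * Num.sqrt pi) ^+ n) integrable_gaussn.
  by apply: eq_integrable => // z _; rewrite /= -EFinM mulrA.
- move=> k z; rewrite Normc.normcM normc_real ger0_norm ?ler_wpM2r//.
    by rewrite mulr_ge0 ?gaussn_ge0// exprn_ge0// mulr_ge0// sqrtr_ge0.
  by rewrite mulr_ge0 ?gaussn_ge0// exprn_ge0// mulr_ge0// sqrtr_ge0.
Qed.

End gaussian.

(** * Schwartz functions *)

Section japanese_bracket.
Context {R : realType} {n : nat}.
Implicit Types x y : 'rV[R]_n.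

Lemma japanese_sqr x : japanese x ^+ 2 = 1 + dotp x x.
Proof. by rewrite /japanese sqr_sqrtr// addr_ge0// dotp_ge0. Qed.

Lemma japanese_ge0 x : 0 <= japanese x.
Proof. exact: sqrtr_ge0. Qed.

Lemma japanese_ge1 x : 1 <= japanese x.
Proof.
rewrite -(ler_pXn2r (n := 2)) ?nnegrE ?japanese_ge0// japanese_sqr expr1n lerDl.
exact: dotp_ge0.
Qed.

Lemma japanese_gt0 x : 0 < japanese x.
Proof. exact: lt_le_trans (japanese_ge1 x). Qed.

Lemma measurable_japanese : measurable_fun setT (@japanese R n).
Proof.
apply: (@measurableT_comp _ _ _ _ _ _ (@Num.sqrt R)).
  by apply: continuous_measurable_fun; exact: sqrt_continuous.
by apply: measurable_funD => //; exact: measurable_dotp.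
Qed.

Lemma dotpD_le x y : dotp (x + y) (x + y) <= 2 * dotp x x + 2 * dotp y y.
Proof.
have := dotp_ge0 (x - y); rewrite !dotpDl !dotpDr !dotpNl !dotpNr (dotpC y x).
by lra.
Qed.

(** The squares keep it polynomial: with [a = |x|^2] and [b = |y|^2], it follows from
    [1 + 2a + 2b <= 2 (1 + a) (1 + b)]. Raised to the power [s / 2], the constant 2 becomes
    [2^(s/2)]. *)
Lemma peetre x y :
  japanese (x + y) ^+ 2 <= 2 * (japanese x ^+ 2 * japanese y ^+ 2).
Proof.
rewrite !japanese_sqr (le_trans (_ : _ <= 1 + (2 * dotp x x + 2 * dotp y y)))//.
  by rewrite lerD2l dotpD_le.
by have := mulr_ge0 (dotp_ge0 x) (dotp_ge0 y); lra.
Qed.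

Lemma entry_le_japanese (j : 'I_n) x : `|x ord0 j| <= japanese x.
Proof.
rewrite -(ler_pXn2r (n := 2)) ?nnegrE ?japanese_ge0// japanese_sqr.
by rewrite real_normK ?num_real// (le_trans (sqr_entry_le_dotp j x))// lerDr.
Qed.

End japanese_bracket.

Section partial_derivatives.
Context {R : realType} {n : nat}.
Local Notation Rn := 'rV[R]_n.
Implicit Types (f g : Rn -> R[i]) (x : Rn) (j : 'I_n).

(** Differentiation along whole lines parallel to an axis, so that the one-variable rules for
    [is_cderive] apply without change. *)
Definition is_pderiv j f f' := forall x (t : R),
  is_cderive (fun s => f (x + s *: delta_mx ord0 j)) t (f' (x + t *: delta_mx ord0 j)).

Lemma is_derive_line (h : Rn -> R) x v (t l : R) :
  is_derive (x + t *: v) v h l <-> is_derive t (1 : R) (fun s => h (x + s *: v)) l.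
Proof.
have E : (fun s : R => s^-1 *: ((h \o shift (x + t *: v)) (s *: v) - h (x + t *: v))) =
    (fun s : R => s^-1 *: (((fun s => h (x + s *: v)) \o shift t) (s *: 1) - h (x + t *: v))).
  apply/funext => s /=; congr (_ *: (h _ - _)).
  by rewrite scalerDl [s *: 1]mulr1 addrCA.
by split=> -[df dE]; split; move: df dE; rewrite /derivable /derive /= E.
Qed.

Lemma is_pderivP j f f' :
  is_pderiv j f f' <-> pderivable j f /\ pderiv j f = f'.
Proof.
split=> [H|[H <-] x t].
  have {}H x : is_derive x (delta_mx ord0 j) (fun y => complex.Re (f y)) (complex.Re (f' x)) /\
      is_derive x (delta_mx ord0 j) (fun y => complex.Im (f y)) (complex.Im (f' x)).
    have [] := H x 0.
    move=> /(is_derive_line (fun y => complex.Re (f y))) h1.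
    move=> /(is_derive_line (fun y => complex.Im (f y))) h2.
    by move: h1 h2; rewrite scale0r addr0.
  split; first by move=> x; case: (H x) => -[? _] [].
  apply/funext => x; case: (H x) => -[_ h1] [_ h2].
  by apply: complex_ext; rewrite /pderiv /= ?h1 ?h2.
have [h1 h2] := H (x + t *: delta_mx ord0 j).
split.
  by apply/(is_derive_line (fun y => complex.Re (f y))); split.
by apply/(is_derive_line (fun y => complex.Im (f y))); split.
Qed.

Lemma is_pderivD j f g f' g' : is_pderiv j f f' -> is_pderiv j g g' ->
  is_pderiv j (fun x => f x + g x) (fun x => f' x + g' x).
Proof. by move=> df dg x t; exact: is_cderiveD (df x t) (dg x t). Qed.

Lemma is_pderivZ j z f f' : is_pderiv j f f' ->
  is_pderiv j (fun x => z * f x) (fun x => z * f' x).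
Proof. by move=> df x t; exact: is_cderiveZ (df x t). Qed.

Lemma is_pderivM j f g f' g' : is_pderiv j f f' -> is_pderiv j g g' ->
  is_pderiv j (fun x => f x * g x) (fun x => f x * g' x + f' x * g x).
Proof. by move=> df dg x t; exact: is_cderiveM (df x t) (dg x t). Qed.

Lemma pderivs_rcons l j f : pderivs (rcons l j) f = pderivs l (pderiv j f).
Proof. by rewrite /pderivs foldr_rcons. Qed.

Lemma Ck_pderiv k j f : Ck k.+1 f -> Ck k (pderiv j f).
Proof.
by move=> H l lk; rewrite -pderivs_rcons; have := H (rcons l j); rewrite size_rcons !ltnS; exact.
Qed.

Lemma schwartz_pderiv j f : schwartz f -> schwartz (pderiv j f).
Proof.
move=> [fC fM]; split; first by move=> k; exact: Ck_pderiv.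
by move=> l k; rewrite -pderivs_rcons.
Qed.

Lemma schwartz_is_pderiv j f : schwartz f -> is_pderiv j f (pderiv j f).
Proof.
by move=> [/(_ 1 [::] isT) [_ /(_ isT j) H] _]; apply/is_pderivP; split.
Qed.

Lemma schwartz_continuous f : schwartz f -> ccontinuous f.
Proof. by move=> [/(_ 0 [::] isT)[]]. Qed.

Lemma ccontinuous_cmeasurable f : ccontinuous f -> cmeasurable f.
Proof. by move=> [f1 f2]; split; exact: continuous_measurable_rV. Qed.

Lemma schwartz_measurable f : schwartz f -> cmeasurable f.
Proof. by move=> /schwartz_continuous/ccontinuous_cmeasurable. Qed.

Lemma schwartz_decay f k : schwartz f ->
  exists M : R, forall x, japanese x ^+ k * Normc.normc (f x) <= M.
Proof. by move=> [_ /(_ [::] k)]. Qed.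

End partial_derivatives.

Section ccontinuous.
Context {R : realType} {n : nat}.
Local Notation Rn := 'rV[R]_n.
Local Open Scope complex_scope.
Implicit Types (f g : Rn -> R[i]).

Lemma ccontinuousD f g : ccontinuous f -> ccontinuous g ->
  ccontinuous (fun x => f x + g x).
Proof.
move=> [f1 f2] [g1 g2]; split=> x; have FF := nbhs_filter x.
  by under eq_fun do rewrite cReD; exact: cvgD (f1 x) (g1 x).
by under eq_fun do rewrite cImD; exact: cvgD (f2 x) (g2 x).
Qed.

Lemma ccontinuousM f g : ccontinuous f -> ccontinuous g ->
  ccontinuous (fun x => f x * g x).
Proof.
move=> [f1 f2] [g1 g2]; split=> x; have FF := nbhs_filter x.
  under eq_fun do rewrite cReM.
  exact: cvgB (cvgM (f1 x) (g1 x)) (cvgM (f2 x) (g2 x)).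
under eq_fun do rewrite cImM.
exact: cvgD (cvgM (f1 x) (g2 x)) (cvgM (f2 x) (g1 x)).
Qed.

Lemma ccontinuous_cst z : ccontinuous (fun _ : Rn => z).
Proof. by split=> x; have FF := nbhs_filter x; exact: cvg_cst. Qed.

Lemma ccontinuous_real (h : Rn -> R) : continuous h -> ccontinuous (fun x => (h x)%:C).
Proof. by move=> ch; split=> // x; have FF := nbhs_filter x; exact: cvg_cst. Qed.

Lemma ccontinuous_cis (h : Rn -> R) : continuous h -> ccontinuous (fun x => cis (h x)).
Proof.
move=> ch; split=> x; apply: continuous_comp; [exact: ch|exact: continuous_cos|
  exact: ch|exact: continuous_sin].
Qed.

End ccontinuous.

(** * Polynomials times a modulated gaussian are Schwartz functions *)

Section gaussian_schwartz.
Context {R : realType} {n : nat}.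
Local Notation Rn := 'rV[R]_n.
Local Open Scope complex_scope.
Variables (a c : Rn) (e : R).
Hypothesis e_gt0 : 0 < e.

(** Polynomials times one fixed modulated gaussian, generated so as to be stable under partial
    derivatives. The two parameters [a] and [c] cover both [gauss_wave], which is modulated, and its
    Fourier transform, which is translated. *)
Inductive polygauss : (Rn -> R[i]) -> Prop :=
| polygauss_base :
    polygauss (fun x => (gaussn (e *: (x - c)))%:C * cis (dotp a x))
| polygaussD f g : polygauss f -> polygauss g -> polygauss (fun x => f x + g x)
| polygaussZ z f : polygauss f -> polygauss (fun x => z * f x)
| polygaussX (i : 'I_n) f : polygauss f -> polygauss (fun x => (x ord0 i)%:C * f x).

Lemma continuous_gaussn_affine : continuous (fun x : Rn => gaussn (e *: (x - c))).
Proof.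
move=> x; have FF := nbhs_filter x.
have cd : {for x, continuous (fun x : Rn => dotp (e *: (x - c)) (e *: (x - c)))}.
  apply: (@continuous_comp _ _ _ (fun x : Rn => e *: (x - c)) (fun y : Rn => dotp y y));
    last exact: continuous_dotp.
  by apply: cvgZl_tmp; apply: cvgB; [exact: cvg_id|exact: cvg_cst].
apply: (@continuous_comp _ _ _ (fun x : Rn => - dotp (e *: (x - c)) (e *: (x - c))) expR);
  last exact: continuous_expR.
exact: cvgN cd.
Qed.

Lemma polygauss_continuous f : polygauss f -> ccontinuous f.
Proof.
elim=> [|||i] *; [|exact: ccontinuousD|apply: ccontinuousM => //; exact: ccontinuous_cst|].
  apply: ccontinuousM; first exact/ccontinuous_real/continuous_gaussn_affine.
  apply: ccontinuous_cis; rewrite (_ : dotp a = (fun x => dotp x a)); first exact: continuous_dotpl.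
  by apply/funext => x; rewrite dotpC.
by apply: ccontinuousM => //; apply: ccontinuous_real; exact: coord_continuous.
Qed.

Lemma polygauss_pderiv j f : polygauss f -> exists2 f', polygauss f' & is_pderiv j f f'.
Proof.
elim=> [|{}f g _ [f' pf' df] _ [g' pg' dg]|z {}f _ [f' pf' df]|i {}f pf [f' pf' df]].
- pose E (x : Rn) := (gaussn (e *: (x - c)))%:C * cis (dotp a x).
  (* The logarithmic derivative is [- 2 e^2 (x_j - c_j) + i a_j], split into its linear and constant
     parts to fit the constructors. *)
  exists (fun x : Rn => (- 2 * e ^+ 2)%:C * ((x ord0 j)%:C * E x) +
      ((2 * e ^+ 2 * c ord0 j) +i* a ord0 j) * E x).
    by apply: polygaussD; apply: polygaussZ; [apply: polygaussX|]; exact: polygauss_base.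
  move=> x t; set dj := delta_mx _ _.
  pose q (s : R) := - (e ^+ 2 * (dotp (x - c) (x - c) + 2 * s * (x - c) ord0 j + s ^+ 2)).
  have gE s : gaussn (e *: (x + s *: dj - c)) = expR (q s).
    rewrite /gaussn /q dotpZl dotpZr mulrA -expr2; congr (expR (- (_ * _))).
    rewrite addrAC !dotpDl !dotpDr !dotpZr !dotpZl /dj !(dotpC _ (delta_mx _ _)) !dotp_delta.
    by rewrite !mxE !eqxx /=; ring.
  have dE s : dotp a (x + s *: dj) = dotp a x + s * a ord0 j.
    by rewrite dotpDr dotpZr dotpC (dotpC a) dotp_delta (dotpC x).
  rewrite /E; under eq_fun do rewrite gE dE; rewrite gE dE.
  have dq : is_derive t (1 : R) q (- (e ^+ 2 * (2 * (x - c) ord0 j + 2 * t))).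
    rewrite /q; apply: is_derive_eq; rewrite /GRing.scale /=; ring.
  apply: is_cderive_eq.
    apply: is_cderiveM; first exact: (@is_cderive_real _ (expR \o q)).
    apply: (@is_cderive_cis _ (fun s => dotp a x + s * a ord0 j)).
  rewrite /GRing.scale /= !mxE !eqxx /=.
  case: (cis _) (expR _) => u v G; apply: complex_ext => /=; ring.
- by exists (fun x => f' x + g' x); [exact: polygaussD|exact: is_pderivD].
- by exists (fun x => z * f' x); [exact: polygaussZ|exact: is_pderivZ].
- exists (fun x : Rn => (x ord0 i)%:C * f' x + ((i == j)%:R)%:C * f x).
    by apply: polygaussD; [exact: polygaussX|exact: polygaussZ].
  apply: (@is_pderivM _ _ _ (fun x : Rn => (x ord0 i)%:C) f (fun=> ((i == j)%:R)%:C)) => //.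
  move=> x t; apply: is_cderive_real.
  rewrite (_ : (fun s => _) = (fun s => x ord0 i + s * (i == j)%:R)); last first.
    by apply/funext => s; rewrite !mxE eqxx.
  by apply: is_derive_eq; rewrite /GRing.scale /=; ring.
Qed.

(** With [y = (1 + s)/(k + 1)], the inequality [y <= exp y] gives [(1 + s)^k <= (k + 1)^k exp(y)^k],
    while [exp(y)^(k + 1) = exp(1 + s)]. *)
Lemma pow_expR_bounded k : exists M : R, forall s : R, 0 <= s ->
  (1 + s) ^+ k * expR (- s) <= M.
Proof.
exists (k.+1%:R ^+ k * expR 1) => s s0.
rewrite expRN ler_pdivrMr ?expR_gt0// -mulrA -expRD.
have -> : expR (1 + s) = expR ((1 + s) / k.+1%:R) ^+ k.+1.
  by rewrite -expRM_natl; congr expR; rewrite mulrC divfK.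
have h1 : (1 + s) / k.+1%:R <= expR ((1 + s) / k.+1%:R).
  by rewrite (le_trans _ (expR_ge1Dx _))// lerDr.
have h2 : 1 <= expR ((1 + s) / k.+1%:R).
  by rewrite (le_trans _ (expR_ge1Dx _))// lerDl divr_ge0// addr_ge0.
rewrite (@le_trans _ _ (k.+1%:R ^+ k * expR ((1 + s) / k.+1%:R) ^+ k))//.
  rewrite -exprMn lerXn2r ?nnegrE ?addr_ge0 ?mulr_ge0 ?expR_ge0//.
  by rewrite mulrC -ler_pdivrMr.
by rewrite ler_wpM2l ?exprn_ge0// exprS ler_peMl// exprn_ge0// expR_ge0.
Qed.

Lemma polygauss_decay f k : polygauss f ->
  exists M : R, forall x, japanese x ^+ k * Normc.normc (f x) <= M.
Proof.
move=> pf; elim: pf k => [|{}f g _ IHf _ IHg|z {}f _ IHf|i {}f pf IHf] k.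
- have [M MP] := pow_expR_bounded k.
  (* Chosen so that [japanese x ^+ 2 <= C (1 + s)] with [s = e^2 |x - c|^2], by
     [|x|^2 <= 2 |x - c|^2 + 2 |c|^2]. *)
  pose C := 1 + 2 * dotp c c + 2 * e ^- 2.
  have C0 : 0 <= C by rewrite !addr_ge0 ?mulr_ge0 ?dotp_ge0 ?invr_ge0 ?exprn_ge0// ltW.
  exists (C ^+ k * M) => x; rewrite Normc.normcM normc_cis mulr1 normc_gaussn.
  pose s := dotp (e *: (x - c)) (e *: (x - c)).
  have s0 : 0 <= s by exact: dotp_ge0.
  have s1 : 0 <= C * (1 + s) by rewrite mulr_ge0// addr_ge0.
  rewrite (@le_trans _ _ (C ^+ k * ((1 + s) ^+ k * expR (- s))))//; last first.
    by rewrite ler_wpM2l ?exprn_ge0//; exact: MP.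
  rewrite mulrA -exprMn; apply: ler_pM => //.
  - by rewrite exprn_ge0// japanese_ge0.
  - exact: gaussn_ge0.
  - rewrite lerXn2r// ?nnegrE ?japanese_ge0//.
    rewrite (@le_trans _ _ (japanese x ^+ 2))//.
      by rewrite expr2; apply: ler_peMl; [exact: japanese_ge0|exact: japanese_ge1].
    have := dotpD_le (x - c) c; rewrite subrK.
    have -> : dotp (x - c) (x - c) = e ^- 2 * s.
      by rewrite /s dotpZl dotpZr mulrA -expr2 mulrA mulVf ?mul1r// expf_neq0// gt_eqF.
    have e20 : 0 <= e ^- 2 by rewrite invr_ge0 exprn_ge0// ltW.
    have := mulr_ge0 (dotp_ge0 c) s0; have := dotp_ge0 c; have := mulr_ge0 e20 s0.
    by rewrite japanese_sqr /C; lra.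
- have [M MP] := IHf k; have [N NP] := IHg k; exists (M + N) => x.
  rewrite (le_trans (ler_wpM2l _ (ler_normcD _ _)))// ?exprn_ge0 ?japanese_ge0//.
  by rewrite mulrDr lerD.
- have [M MP] := IHf k; exists (Normc.normc z * M) => x.
  by rewrite Normc.normcM mulrCA ler_wpM2l// normc_ge0.
(* A coordinate factor costs one more power of [japanese], hence the induction hypothesis at
   [k.+1]. *)
- have [M MP] := IHf k.+1; exists M => x; rewrite (le_trans _ (MP x))//.
  rewrite Normc.normcM normc_real mulrA ler_wpM2r ?normc_ge0// exprSr.
  by rewrite ler_wpM2l ?exprn_ge0 ?japanese_ge0// entry_le_japanese.
Qed.

Lemma polygauss_pderivs l f : polygauss f -> polygauss (pderivs l f).
Proof.
elim: l => [//|j l IH] /IH /(polygauss_pderiv j) [f' pf' /is_pderivP[_ E]].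
by rewrite /= -/(pderivs l f) E.
Qed.

Lemma polygauss_schwartz f : polygauss f -> schwartz f.
Proof.
move=> pf; split; last by move=> l k; exact/polygauss_decay/polygauss_pderivs.
move=> k l _; have pl := polygauss_pderivs l pf.
split; first exact: polygauss_continuous.
by move=> _ j; have [f' _ /is_pderivP[]] := polygauss_pderiv j pl.
Qed.

End gaussian_schwartz.

Lemma schwartz_gauss_wave (R : realType) n (x : 'rV[R]_n) e :
  0 < e -> schwartz (gauss_wave x e).
Proof.
move=> e0; apply: (polygauss_schwartz e0 (a := x) (c := 0)).
by have := polygauss_base x 0 e; under eq_fun do rewrite subr0.
Qed.

Lemma schwartz_fourier_gauss_wave (R : realType) n (x : 'rV[R]_n) e :
  0 < e -> schwartz (fourier_int (gauss_wave x e)).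
Proof.
move=> e0; have r0 : 0 < (2 * e)^-1 by rewrite invr_gt0 mulr_gt0.
apply: (polygauss_schwartz r0 (a := 0) (c := x)).
have := polygaussZ (((Num.sqrt pi / e) ^+ n)%:C)%C (polygauss_base 0 x (2 * e)^-1).
congr (polygauss _ _ _ _); apply/funext => y.
by rewrite fourier_gauss_wave// dotp0l cis0 mulr1 rmorphM.
Qed.

(** * Fourier transform of Schwartz functions *)

Section cauchy_weight.
Context {R : realType} {n : nat}.
Local Open Scope complex_scope.
Local Notation Leb := (@lebesgue_rV R n).
Local Notation Rn := 'rV[R]_n.
Implicit Types x xi : Rn.

(** A tensor-product majorant of [japanese ^- (2 n)]: its integral factors into one-dimensional
    integrals of [1/(1 + t^2)], so decay of order [2 n] implies integrability. *)
Definition cauchy_weight x : R := \prod_(i < n) (1 + x ord0 i ^+ 2)^-1.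

Lemma cauchy_weight_gt0 x : 0 < cauchy_weight x.
Proof. by apply: prodr_gt0 => i _; rewrite invr_gt0 ltr_pwDl// sqr_ge0. Qed.

Lemma cauchy_weight_ge0 x : 0 <= cauchy_weight x.
Proof. exact/ltW/cauchy_weight_gt0. Qed.

Lemma integrable_cauchy :
  (@lebesgue_measure R).-integrable setT (fun t : R => ((1 + t ^+ 2)^-1)%:E).
Proof.
have mc : measurable_fun [set: R] (fun t : R => (1 + t ^+ 2)^-1).
  by apply: continuous_measurable_fun; exact: (@continuous_oneDsqrV R).
apply/integrableP; split; first exact/measurable_EFinP.
under eq_integral do rewrite gee0_abs ?lee_fin ?invr_ge0 ?addr_ge0 ?sqr_ge0//.
rewrite ge0_symfun_integralT//.
- rewrite (_ : [set x | _] = `[0, +oo[%classic); last first.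
    by apply/seteqP; split => x/=; rewrite in_itv/= andbT.
  have -> : (\int[lebesgue_measure]_(x in `[0%R, +oo[) ((1 + x ^+ 2)^-1)%:E = (pi / 2)%:E)%E.
    exact: integral0y_oneDsqr.
  by rewrite -EFinM ltry.
- by move=> t; rewrite invr_ge0 addr_ge0 ?sqr_ge0.
- exact: continuous_oneDsqrV.
- by move=> t /=; rewrite sqrrN.
Qed.

Lemma cintegrable_cauchy_weight : cintegrable_on Leb (fun x => (cauchy_weight x)%:C).
Proof.
rewrite (_ : (fun x => _) = (fun x : Rn => \prod_(i < n) ((1 + x ord0 i ^+ 2)^-1)%:C)).
  have [|I _] := @cint_prod_rV R n (fun i t => ((1 + t ^+ 2)^-1)%:C); last exact: I.
  move=> i; split => /=; first exact: integrable_cauchy.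
  exact: integrable0.
by apply/funext => x; rewrite /cauchy_weight rmorph_prod.
Qed.

Lemma integrable_cauchy_weight : Leb.-integrable setT (EFin \o cauchy_weight).
Proof. by case: cintegrable_cauchy_weight. Qed.

Lemma japanese_cauchy_weight x : 1 <= japanese x ^+ (2 * n) * cauchy_weight x.
Proof.
rewrite exprM japanese_sqr -[n in _ ^+ n]card_ord -prodr_const -big_split /=.
rewrite -[leLHS](@big1_eq R 1 *%R 'I_n (index_enum 'I_n) (mem 'I_n)); apply: ler_prod => i _.
rewrite ler01 /= ler_pdivlMr ?mul1r ?ltr_pwDl ?sqr_ge0//.
by rewrite lerD2l sqr_entry_le_dotp.
Qed.

Lemma decay_cauchy_weight (f : Rn -> R[i]) (M : R) x :
  japanese x ^+ (2 * n) * Normc.normc (f x) <= M -> Normc.normc (f x) <= M * cauchy_weight x.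
Proof.
move=> fM; rewrite (@le_trans _ _ (japanese x ^+ (2 * n) * Normc.normc (f x) * cauchy_weight x))//.
  rewrite mulrAC -[leLHS]mul1r ler_wpM2r ?normc_ge0//; exact: japanese_cauchy_weight.
by rewrite ler_wpM2r// cauchy_weight_ge0.
Qed.

End cauchy_weight.

Section fourier_L1.
Context {R : realType} {n : nat}.
Local Open Scope complex_scope.
Local Notation Leb := (@lebesgue_rV R n).
Local Notation Rn := 'rV[R]_n.
Implicit Types (f g phi : Rn -> R[i]) (x xi : Rn).

Lemma cis_dotpN x xi :
  cos (dotp x xi) -i* sin (dotp x xi) = cis (- dotp x xi) :> R[i].
Proof. by rewrite cisN. Qed.

Lemma fourier_intE f xi : fourier_int f xi = cint Leb (fun x => cis (- dotp x xi) * f x).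
Proof. by apply: eq_cint => x; rewrite cis_dotpN. Qed.

Lemma cmeasurable_cis_dotpr xi : cmeasurable (fun x : Rn => cis (dotp xi x)).
Proof. by apply: cmeasurable_cis; exact: measurable_dotpr. Qed.

Lemma cintegrable_cisM (h : Rn -> R) f : measurable_fun setT h ->
  cintegrable_on Leb f -> cintegrable_on Leb (fun x => cis (h x) * f x).
Proof.
move=> mh; apply: (@cintegrable_bndl _ _ _ Leb _ _ 1); first exact: cmeasurable_cis.
by move=> x; rewrite normc_cis.
Qed.

Lemma L1norm_fineK f : cintegrable_on Leb f -> L1norm Leb f = (fine (L1norm Leb f))%:E.
Proof.
move=> If; rewrite fineK// ge0_fin_numE ?cintegrable_L1norm//.
by apply: integral_ge0 => x _; rewrite lee_fin normc_ge0.
Qed.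

Lemma normc_cint_cisM (h : Rn -> R) f : measurable_fun setT h -> cintegrable_on Leb f ->
  Normc.normc (cint Leb (fun x => cis (h x) * f x)) <= fine (L1norm Leb f).
Proof.
move=> mh If; apply: normc_cint_le; first exact/(cintegrable_measurable (cintegrable_cisM mh If)).
rewrite -L1norm_fineK// /L1norm le_eqVlt; apply/orP; left; apply/eqP.
by apply: eq_integral => x _; rewrite Normc.normcM normc_cis mul1r.
Qed.

Lemma normc_fourier_int f xi : cintegrable_on Leb f ->
  Normc.normc (fourier_int f xi) <= fine (L1norm Leb f).
Proof.
move=> If; rewrite fourier_intE; apply: normc_cint_cisM => //.
by apply: measurableT_comp => //; exact: measurable_dotpl.
Qed.

Lemma cintegrable_tensor d1 d2 (T1 : measurableType d1) (T2 : measurableType d2)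
    (m1 : {sigma_finite_measure set T1 -> \bar R})
    (m2 : {sigma_finite_measure set T2 -> \bar R})
    (f : T1 -> R[i]) (g : T2 -> R[i]) (K : T1 * T2 -> R[i]) (M : R) :
  cintegrable_on m1 f -> cintegrable_on m2 g -> cmeasurable K ->
  (forall p, Normc.normc (K p) <= M) ->
  cintegrable_on (m1 \x m2)%E (fun p => f p.1 * g p.2 * K p).
Proof.
move=> If Ig mK KM.
have mf := cintegrable_measurable If; have mg := cintegrable_measurable Ig.
have mfg : cmeasurable (fun p : T1 * T2 => f p.1 * g p.2).
  by apply: cmeasurableM; [exact: cmeasurable_comp mf _|exact: cmeasurable_comp mg _].
suff Ifg : cintegrable_on (m1 \x m2)%E (fun p => f p.1 * g p.2).
  have := cintegrable_bndl mK KM Ifg.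
  by under eq_fun do rewrite mulrC.
have mnf := cmeasurable_normc mf; have mng := cmeasurable_normc mg.
apply: cintegrable12 => //=.
under eq_integral.
  move=> x _; under eq_integral do rewrite Normc.normcM EFinM.
  rewrite ge0_integralZl//; first last.
  - by rewrite lee_fin normc_ge0.
  - by move=> y _; rewrite lee_fin normc_ge0.
  - exact/measurable_EFinP.
  over.
rewrite ge0_integralZr//=; first last.
- by apply: integral_ge0 => x _; rewrite lee_fin normc_ge0.
- by move=> x _; rewrite lee_fin normc_ge0.
- exact/measurable_EFinP.
apply: lte_mul_pinfty.
- by apply: integral_ge0 => x _; rewrite lee_fin normc_ge0.
- rewrite ge0_fin_numE ?(cintegrable_L1norm If)//.
  by apply: integral_ge0 => x _; rewrite lee_fin normc_ge0.
- exact: cintegrable_L1norm Ig.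
Qed.

Lemma cmeasurable_cis_dotp2 :
  cmeasurable (fun p : Rn * Rn => cis (- dotp p.1 p.2)).
Proof. by apply: cmeasurable_cis; apply: measurableT_comp => //; exact: measurable_dotp2. Qed.

Lemma fourier_int_measurable f : cmeasurable f -> cmeasurable (fourier_int f).
Proof.
move=> mf.
rewrite (_ : fourier_int f = fun xi => cint Leb (fun x => cis (- dotp x xi) * f x)); last first.
  by apply/funext => xi; rewrite fourier_intE.
apply: (@cmeasurable_fubini1 _ _ _ _ R Leb (fun p : Rn * Rn => cis (- dotp p.2 p.1) * f p.2)).
apply: cmeasurableM; last exact: cmeasurable_comp mf _.
apply: (cmeasurable_comp cmeasurable_cis_dotp2 (h := fun p => (p.2, p.1))).
exact: measurable_swap.
Qed.

Lemma fourier_multiplication f g : cintegrable_on Leb f -> cintegrable_on Leb g ->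
  cint Leb (fun x => f x * fourier_int g x) = cint Leb (fun x => fourier_int f x * g x).
Proof.
move=> If Ig.
pose F (p : Rn * Rn) := f p.1 * g p.2 * cis (- dotp p.1 p.2).
have IF : cintegrable_on (Leb \x Leb)%E F.
  by apply: (@cintegrable_tensor _ _ _ _ _ _ _ _ _ 1) => // [|p]; [exact: cmeasurable_cis_dotp2|rewrite normc_cis].
have := cFubini IF.
have -> : (fun x => cint Leb (fun y => F (x, y))) = (fun x => f x * fourier_int g x).
  apply/funext => x; rewrite fourier_intE -cintZ; last first.
    by apply: cintegrable_cisM => //; apply: measurableT_comp => //; exact: measurable_dotpl.
  by apply: eq_cint => y; rewrite /F /= (dotpC x); ring.
move=> ->; apply: eq_cint => y; rewrite fourier_intE mulrC -cintZ; last first.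
  by apply: cintegrable_cisM => //; apply: measurableT_comp => //; exact: measurable_dotpl.
by apply: eq_cint => x; rewrite /F /=; ring.
Qed.

End fourier_L1.

Section schwartz_fourier.
Context {R : realType} {n : nat}.
Local Open Scope complex_scope.
Local Notation Leb := (@lebesgue_rV R n).
Local Notation Rn := 'rV[R]_n.
Implicit Types (f g phi : Rn -> R[i]) (x xi : Rn).

Lemma schwartz_integrable phi : schwartz phi -> cintegrable_on Leb phi.
Proof.
move=> Sphi; have [M MP] := schwartz_decay (2 * n) Sphi.
apply: (@le_cintegrable _ _ _ Leb _ (fun x => M * cauchy_weight x)).
- exact: schwartz_measurable.
- by move=> x; exact: decay_cauchy_weight.
- exact: (integrableZl measurableT M integrable_cauchy_weight).
Qed.

(** Peetre's inequality for [x = (x + d) - d], where the squared bracket of [d] is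
    [1 + t^2 <= 2]. *)
Lemma dotp_shift_le x (j : 'I_n) (t : R) : -1 < t < 1 ->
  japanese x ^+ 2 <= 4 * japanese (x + t *: delta_mx ord0 j) ^+ 2.
Proof.
move=> /andP[t1 t2]; set d := t *: _.
have {1}-> : x = (x + d) + - d by rewrite addrK.
rewrite (le_trans (peetre _ _))// mulrCA mulrC ler_wpM2r ?exprn_ge0 ?japanese_ge0//.
rewrite japanese_sqr dotpNl dotpNr opprK /d dotpZl dotpZr dotp_delta mxE !eqxx /=.
by nra.
Qed.

Lemma shift_decay f (M : R) (j : 'I_n) (t : R) x : -1 < t < 1 ->
  (forall y, japanese y ^+ (2 * n) * Normc.normc (f y) <= M) ->
  Normc.normc (f (x + t *: delta_mx ord0 j)) <= 4 ^+ n * M * cauchy_weight x.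
Proof.
move=> t1 fM; apply: (@decay_cauchy_weight R n (fun x => f (x + t *: delta_mx ord0 j))).
rewrite exprM (@le_trans _ _ ((4 * japanese (x + t *: delta_mx ord0 j) ^+ 2) ^+ n *
    Normc.normc (f (x + t *: delta_mx ord0 j))))//.
  rewrite ler_wpM2r ?normc_ge0// lerXn2r ?nnegrE ?mulr_ge0 ?exprn_ge0 ?japanese_ge0//.
  exact: dotp_shift_le.
by rewrite exprMn -exprM -mulrA ler_wpM2l ?exprn_ge0.
Qed.

(* Differentiate at [t = 0] the translation identity
   [fourier_int (phi (. + t e_j)) xi = cis (t xi_j) * fourier_int phi xi]. *)
Lemma fourier_int_pderiv phi (j : 'I_n) xi : schwartz phi ->
  fourier_int (pderiv j phi) xi = (0 +i* xi ord0 j) * fourier_int phi xi.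
Proof.
move=> Sphi; have Sd := schwartz_pderiv j Sphi; have dphi := schwartz_is_pderiv j Sphi.
have Iphi := schwartz_integrable Sphi.
pose dj : Rn := delta_mx ord0 j.
have mN : measurable_fun setT (fun x : Rn => - dotp x xi).
  by apply: measurableT_comp => //; exact: measurable_dotpl.
have Ish t : cintegrable_on Leb (fun x : Rn => phi (x + t *: dj)).
  have [+ _] := @cint_rV_affine R n (t *: dj) 1 phi ltr01 Iphi.
  by under eq_fun do rewrite scale1r addrC.
pose A t := cint Leb (fun x : Rn => cis (- dotp x xi) * phi (x + t *: dj)).
have AE t : A t = cis (t * xi ord0 j) * fourier_int phi xi.
  have [_] := @cint_rV_affine R n (t *: dj) 1 _ ltr01 (cintegrable_cisM mN Iphi).
  rewrite expr1n mul1r fourier_intE => <-; rewrite -cintZ; last first.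
    have [+ _] := @cint_rV_affine R n (t *: dj) 1 _ ltr01 (cintegrable_cisM mN Iphi).
    by [].
  apply: eq_cint => x; rewrite scale1r [t *: dj + x]addrC mulrA -cisD; congr (cis _ * _).
  by rewrite dotpDl dotpZl dotp_delta; ring.
have [M MP] := schwartz_decay (2 * n) Sd.
have dA : is_cderive A 0 (fourier_int (pderiv j phi) xi).
  apply: is_cderive_eq.
    apply: (@is_cderive_cint _ _ _ Leb (fun t (x : Rn) => cis (- dotp x xi) * phi (x + t *: dj))
      (fun t (x : Rn) => cis (- dotp x xi) * pderiv j phi (x + t *: dj)) 0
      (fun x => 4 ^+ n * M * cauchy_weight x)).
    - by move=> t _; exact: cintegrable_cisM.
    - by move=> t x _; apply: is_cderiveZ; exact: dphi.
    - move=> t x; rewrite sub0r add0r => t1.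
      by rewrite Normc.normcM normc_cis mul1r; exact: shift_decay.
    - exact: (integrableZl measurableT (4 ^+ n * M) integrable_cauchy_weight).
  by rewrite fourier_intE; apply: eq_cint => x; rewrite scale0r addr0.
apply: is_cderive_unique dA _.
rewrite (_ : A = (fun t => cis (t * xi ord0 j) * fourier_int phi xi)); last exact/funext.
apply: is_cderive_eq.
  apply: is_cderiveM; last exact: is_cderive_cst.
  by apply: (@is_cderive_cis _ ( *%R^~ (xi ord0 j))); apply: is_derive_eq.
rewrite /GRing.scale /= mul0r cis0 mulr1 mul0r mulr0 !add0r mulr1.
by congr ((_ +i* _) * _).
Qed.

(** Each factor [1 + xi_j^2] of the reciprocal weight is paid for by two derivatives in direction
    [j]. The bound is proved for all Schwartz functions at once, so that the induction over
    coordinates can be applied to those derivatives. *)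
Lemma fourier_int_decay phi : schwartz phi ->
  exists M : R, forall xi, Normc.normc (fourier_int phi xi) <= M * cauchy_weight xi.
Proof.
move=> Sphi.
suff H (l : seq 'I_n) : forall psi, schwartz psi -> exists M : R, forall xi,
    (\prod_(i <- l) (1 + xi ord0 i ^+ 2)) * Normc.normc (fourier_int psi xi) <= M.
  have [M MP] := H (index_enum 'I_n) _ Sphi; exists M => xi.
  rewrite /cauchy_weight prodfV ler_pdivlMr 1?mulrC//.
  by apply: prodr_gt0 => i _; rewrite ltr_pwDl// sqr_ge0.
elim: l => [|j l IH] psi Spsi.
  exists (fine (L1norm Leb psi)) => xi; rewrite big_nil mul1r.
  exact/normc_fourier_int/schwartz_integrable.
have Sd := schwartz_pderiv j Spsi; have Sdd := schwartz_pderiv j Sd.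
have [M MP] := IH _ Spsi; have [N NP] := IH _ Sdd.
exists (M + N) => xi; rewrite big_cons mulrAC mulrDl mul1r mulrDl mulrC lerD//.
have := NP xi; rewrite !fourier_int_pderiv// !Normc.normcM.
have -> : Normc.normc (0 +i* xi ord0 j) = `|xi ord0 j|.
  by rewrite cnormcE /= expr0n add0r sqrtr_sqr.
by rewrite mulrA -expr2 real_normK ?num_real// mulrC.
Qed.

Lemma fourier_int_integrable phi : schwartz phi -> cintegrable_on Leb (fourier_int phi).
Proof.
move=> Sphi; have [M MP] := fourier_int_decay Sphi.
apply: (@le_cintegrable _ _ _ Leb _ (fun x => M * cauchy_weight x)) => //.
  exact/fourier_int_measurable/schwartz_measurable.
exact: (integrableZl measurableT M integrable_cauchy_weight).
Qed.

Lemma schwartz_bounded phi : schwartz phi -> exists M : R, forall x, Normc.normc (phi x) <= M.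
Proof.
by move=> /(schwartz_decay 0)[M MP]; exists M => x; rewrite -[leLHS]mul1r; exact: MP.
Qed.

Lemma gauss_wave_le x (e : R) xi : Normc.normc (gauss_wave x e xi) <= 1.
Proof. by rewrite Normc.normcM normc_cis mulr1 normc_gaussn gaussn_le1. Qed.

Lemma gauss_wave_cvg1 x xi : ccvg (fun k => gauss_wave x k.+1%:R^-1 xi) (cis (dotp x xi)).
Proof.
rewrite -[X in ccvg _ X]mul1r; apply: ccvgM; last exact: ccvg_cst.
apply: (@ccvg_real R (fun k => gaussn (k.+1%:R^-1 *: xi)) 1).
have h : - (k.+1%:R^-1 * (k.+1%:R^-1 * dotp xi xi)) @[k --> \oo] --> (0 : R).
  rewrite -oppr0 -[X in - X](mul0r (0 * dotp xi xi)); apply: cvgN.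
  apply: cvgM; first exact: cvg_harmonic.
  by apply: cvgM; [exact: cvg_harmonic|exact: cvg_cst].
have := cvg_comp _ _ h (@continuous_expR R 0).
rewrite expR0; apply: cvg_trans; apply: near_eq_cvg; apply: nearW => k /=.
by rewrite /gaussn dotpZl dotpZr.
Qed.

Lemma cmeasurable_gauss_wave x (e : R) : cmeasurable (gauss_wave x e).
Proof.
apply: cmeasurableM; last exact: cmeasurable_cis_dotpr.
apply: cmeasurable_real; apply: measurableT_comp; first exact: measurable_gaussn.
have := @measurable_rVD R n 0 e.
by rewrite (_ : (fun x => 0 + _) = *:%R e)//; apply/funext => y; rewrite add0r.
Qed.

(** Damp the integral with [gauss_wave] and compute the limit twice: by dominated convergence, and,
    after [fourier_multiplication] has moved the transform onto the wave, by the approximate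
    identity. *)
Lemma fourier_inversion phi x : schwartz phi ->
  cint Leb (fun xi => cis (dotp x xi) * fourier_int phi xi) = ((2 * pi) ^+ n)%:C * phi x.
Proof.
move=> Sphi; have Iphi := schwartz_integrable Sphi.
have Ift := fourier_int_integrable Sphi.
have [M MP] := schwartz_bounded Sphi.
have e0 k : 0 < k.+1%:R^-1 :> R by rewrite invr_gt0.
apply: (@ccvg_unique _ (fun k => cint Leb (fun xi => gauss_wave x k.+1%:R^-1 xi * fourier_int phi xi))).
  apply: (@cdominated_cvg _ _ _ Leb _ _ (fun xi => Normc.normc (fourier_int phi xi))).
  - move=> k; apply: cmeasurableM; first exact: cmeasurable_gauss_wave.
    exact: cintegrable_measurable Ift.
  - apply: cmeasurableM; first exact: cmeasurable_cis_dotpr.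
    exact: cintegrable_measurable Ift.
  - by apply: aeW => xi; apply: ccvgM; [exact: gauss_wave_cvg1|exact: ccvg_cst].
  - exact: cintegrable_normc.
  - move=> k xi; rewrite Normc.normcM ler_piMl ?normc_ge0//; exact: gauss_wave_le.
have E k : cint Leb (fun xi => gauss_wave x k.+1%:R^-1 xi * fourier_int phi xi) =
    cint Leb (fun y => phi y * fourier_int (gauss_wave x k.+1%:R^-1) y).
  rewrite fourier_multiplication//; last exact/schwartz_integrable/schwartz_gauss_wave.
  by apply: eq_cint => y; rewrite mulrC.
rewrite (funext E).
exact: gauss_wave_cvg x (schwartz_measurable Sphi) (schwartz_continuous Sphi) MP.
Qed.

End schwartz_fourier.

(** * Fourier inversion and uniqueness *)

Section measure_of_density.
Context d (T : measurableType d) (R : realType) (mu : {measure set T -> \bar R}).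
Variable f : T -> \bar R.
Hypotheses (mf : measurable_fun setT f) (f0 : forall x, (0 <= f x)%E).

Definition density_measure (A : set T) : \bar R := (\int[mu]_(x in A) f x)%E.

Let density0 : density_measure set0 = 0%E.
Proof. exact: integral_set0. Qed.

Let density_ge0 A : (0 <= density_measure A)%E.
Proof. exact: integral_ge0. Qed.

Let density_sigma_additive : semi_sigma_additive density_measure.
Proof. exact: semi_sigma_additive_nng_induced. Qed.

HB.instance Definition _ := isMeasure.Build _ _ _ density_measure
  density0 density_ge0 density_sigma_additive.

Definition density : {measure set T -> \bar R} := density_measure.

End measure_of_density.

(** * An L^1 function orthogonal to bounded continuous functions vanishes almost everywhere *)

Section vanishing_L1.
Context {R : realType} {n : nat}.
Local Notation Leb := (@lebesgue_rV R n).
Local Notation Rn := 'rV[R]_n.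

(** These sets form a pi-system generating the sigma-algebra, and their indicators are limits of
    continuous functions with values in [0, 1]. *)
Let cozero : set (set Rn) :=
  [set A | exists psi : Rn -> R,
    [/\ continuous psi, (forall x, 0 <= psi x) & A = [set x | 0 < psi x]]].

Let cozero_measurable A : cozero A -> measurable A.
Proof.
move=> [psi [cpsi _ ->]].
rewrite (_ : [set x | _] = psi @^-1` `]0, +oo[%classic); last first.
  by apply/seteqP; split => x /=; rewrite in_itv/= andbT.
rewrite -[X in measurable X]setTI; apply: continuous_measurable_rV => //.
Qed.

Let cozeroT : cozero setT.
Proof.
exists (fun=> 1); split => //; last by apply/seteqP; split => x //= _; exact: ltr01.
by move=> x; have FF := nbhs_filter x; exact: cvg_cst.
Qed.

Let cozeroI : setI_closed cozero.
Proof.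
move=> A B [f [cf f0 ->]] [g [cg g0 ->]]; exists (fun x => f x * g x); split.
- by move=> x; have FF := nbhs_filter x; exact: cvgM (cf x) (cg x).
- by move=> x; rewrite mulr_ge0.
- apply/seteqP; split => x /=; first by move=> [? ?]; rewrite mulr_gt0.
  by move=> fg; split; rewrite lt_neqAle ?f0 ?g0 andbT eq_sym;
    apply/eqP => h; move: fg; rewrite h ?mul0r ?mulr0 ltxx.
Qed.

Let cozeroE : @measurable _ Rn = <<s cozero >>.
Proof.
apply/seteqP; split; last first.
  by apply: smallest_sub; [exact: sigma_algebra_measurable|move=> A; exact: cozero_measurable].
apply: smallest_sub; first exact: smallest_sigma_algebra.
rewrite -bigcup_seq => A [i _ [B mB <-]]; rewrite setTI.
have : measurable_fun [set: g_sigma_algebraType cozero]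
    (@rV_coord R n i : g_sigma_algebraType cozero -> R).
  apply: (measurability _ (RGenOInfty.measurableE R)) => _ [_ [a ->] <-].
  rewrite setTI; apply: sub_sigma_algebra.
  (* Twice the positive part of [x_i - a], positive exactly on the half-space [x_i > a]. *)
  exists (fun x : Rn => `|x ord0 i - a| + (x ord0 i - a)); split.
  - move=> x; have FF := nbhs_filter x.
    have h : (x' ord0 i - a) @[x' --> x] --> x ord0 i - a.
      by apply: cvgB; [exact: coord_continuous|exact: cvg_cst].
    by apply: cvgD => //; exact: cvg_norm.
  - by move=> x; rewrite -lerBlDr sub0r -normrN ler_norm.
  - apply/seteqP; split => x /=; rewrite /rV_coord in_itv /= andbT.
      by rewrite -subr_gt0 => h; rewrite gtr0_norm// addr_gt0.
    by have [|//] := leP (x ord0 i) a; rewrite -subr_le0 => h; rewrite ler0_norm// addNr ltxx.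
by move=> /(_ measurableT _ mB); rewrite setTI.
Qed.

(** The hypothesis passes to indicators of [cozero] sets in the limit. The measures with densities
    [g^+] and [g^-] then agree on a generating pi-system, hence on all measurable sets, so [g] has
    integral 0 over each of them. *)
Lemma L1_eq0 (g : Rn -> R) : Leb.-integrable setT (EFin \o g) ->
  (forall h : Rn -> R, continuous h -> (forall x, 0 <= h x <= 1) ->
    \int[Leb]_x (g x * h x) = 0) ->
  \forall x \ae Leb, g x = 0.
Proof.
move=> Ig gh0.
have mg : measurable_fun setT g by have /measurable_EFinP := measurable_int _ Ig.
have ge0 A : measurable A -> Leb.-integrable A (EFin \o g).
  by move=> mA; apply: integrableS Ig.
have coz A : cozero A -> (\int[Leb]_(x in A) (g x)%:E = 0)%E.
  move=> cA; have mA := cozero_measurable cA; case: cA => psi [cpsi psi0 AE].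
  (* Vanishes where [psi] does and tends to 1 elsewhere, since [exp(- k psi)] is a geometric
     sequence in [k]. *)
  pose h (k : nat) x := 1 - expR (- (k%:R * psi x)).
  have h01 k x : 0 <= h k x <= 1.
    rewrite subr_ge0 -expR0 ler_expR oppr_le0 mulr_ge0//=.
    by rewrite expR0 lerBlDr lerDl expR_ge0.
  have ch k : continuous (h k).
    move=> x; have FF := nbhs_filter x.
    apply: cvgB; first exact: cvg_cst.
    apply: (@continuous_comp _ _ _ (fun x => - (k%:R * psi x)) expR);
      last exact: continuous_expR.
    by apply: cvgN; apply: cvgM; [exact: cvg_cst|exact: cpsi].
  have mh k := continuous_measurable_rV (ch k).
  have [||||| _ _] := @dominated_convergence _ _ _ Leb _ measurableT
    (fun k x => (g x * h k x)%:E) (fun x => (g x * \1_A x)%:E) (fun x => `|(g x)%:E|)%E.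
  - by move=> k; apply/measurable_EFinP; exact: measurable_funM.
  - by apply/measurable_EFinP; apply: measurable_funM => //; exact: measurable_indic.
  - apply: aeW => x _; apply: cvg_EFin; first exact: nearW.
    apply: cvgM; first exact: cvg_cst.
    rewrite indicE; case: (boolP (x \in A)) => [|xA]; last first.
      have psix : psi x = 0.
        apply/eqP; rewrite eq_le psi0 andbT leNgt; apply/negP => p0.
        by move: xA; rewrite AE notin_setE; apply.
      by rewrite /h; under eq_fun do rewrite psix mulr0 oppr0 expR0 subrr; exact: cvg_cst.
    rewrite AE inE /= => psix; rewrite -[X in _ --> X]subr0.
    apply: cvgB; first exact: cvg_cst.
    under eq_fun do rewrite -mulrN expRM_natl.
    by apply: cvg_expr; rewrite ger0_norm ?expR_ge0// -expR0 ltr_expR oppr_lt0.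
  - by apply: integrable_abse.
  - apply: aeW => x k _; rewrite lee_fin normrM ler_piMr// ger0_norm; by case/andP: (h01 k x).
  move=> cv; have Igh k : Leb.-integrable setT (EFin \o (fun x => g x * h k x)).
    apply: le_integrable Ig => //; first by apply/measurable_EFinP; exact: measurable_funM.
    move=> x _; rewrite lee_fin normrM ler_piMr// ger0_norm; by case/andP: (h01 k x).
  have z k : (\int[Leb]_x (g x * h k x)%:E = 0)%E.
    have fz := integrable_fin_num measurableT (Igh k).
    rewrite -(fineK fz); exact: (congr1 EFin (gh0 (h k) (ch k) (h01 k))).
  move: cv; rewrite (funext z) => cv.
  have := cvg_unique _ cv (cvg_cst 0%E) => /(_ (@ereal_hausdorff R)) <-.
  by rewrite [LHS]integral_mkcond epatch_indic; apply: eq_integral => x _; rewrite EFinM.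
have mgp := measurable_funepos (measurable_int _ Ig).
have mgn := measurable_funeneg (measurable_int _ Ig).
pose nup := density Leb mgp (fun x => funepos_ge0 (EFin \o g) x).
pose nun := density Leb mgn (fun x => funeneg_ge0 (EFin \o g) x).
have nuE A : measurable A -> nup A = nun A.
  apply: (measure_unique cozero (fun=> setT)) => //.
  - by rewrite bigcup_const//; exists 0%N.
  - move=> B cB; have mB := cozero_measurable cB.
    have := coz B cB; rewrite integralE => /eqP; rewrite sube_eq ?add0e => [/eqP//| |].
      exact: (integrable_pos_fin_num mB (ge0 B mB)).
    exact: fin_num_adde_defr.
  - move=> _; exact: (integral_funepos_lt_pinfty measurableT Ig).
have := @integral_ae_eq _ _ _ Leb _ measurableT (cst 0%E) (EFin \o g) Ig.
move=> /(_ (measurable_cst _)) []; last first.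
- move=> N [mN N0 sN]; exists N; split => // x /= gx; apply: sN => /= /(_ I) []; exact: gx.
- move=> B _ mB; rewrite integral0 integralE; move: (nuE B mB).
  rewrite /nup /nun /= /density_measure => ->; rewrite subee//.
  exact: (integrable_neg_fin_num mB (ge0 B mB)).
Qed.

End vanishing_L1.

(** * The inverse Fourier integral of an L^1 function *)

Section inverse_fourier.
Context {R : realType} {n : nat}.
Local Open Scope complex_scope.
Local Notation Leb := (@lebesgue_rV R n).
Local Notation Rn := 'rV[R]_n.
Implicit Types (f g h phi : Rn -> R[i]) (x xi : Rn).

Definition inv2pi : R := (2 * pi) ^- n.

Lemma inv2pi_gt0 : 0 < inv2pi.
Proof. by rewrite invr_gt0 exprn_gt0// mulr_gt0// pi_gt0. Qed.

Lemma inv2piE : inv2pi%:C * ((2 * pi) ^+ n)%:C = 1.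
Proof. by rewrite -rmorphM /inv2pi mulVf// expf_neq0// gt_eqF// mulr_gt0// pi_gt0. Qed.

Definition inv_fourier g x : R[i] :=
  inv2pi%:C * cint Leb (fun xi => cis (dotp x xi) * g xi).

Lemma cintegrable_cis_dotpr x g : cintegrable_on Leb g ->
  cintegrable_on Leb (fun xi => cis (dotp x xi) * g xi).
Proof. by apply: cintegrable_cisM; exact: measurable_dotpr. Qed.

Lemma normc_inv_fourier g x : cintegrable_on Leb g ->
  Normc.normc (inv_fourier g x) <= inv2pi * fine (L1norm Leb g).
Proof.
move=> Ig; rewrite Normc.normcM normc_real ger0_norm ?(ltW inv2pi_gt0)//.
rewrite ler_wpM2l ?(ltW inv2pi_gt0)//; apply: normc_cint_cisM => //.
exact: measurable_dotpr.
Qed.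

(** A sequential criterion, to match dominated convergence, which is about sequences. *)
Lemma continuous_rV_seq (F : Rn -> R) x :
  (forall u : nat -> Rn, u @ \oo --> x -> F (u k) @[k --> \oo] --> F x) ->
  {for x, continuous F}.
Proof.
move=> H; apply: contrapT => nc.
have FF := nbhs_filter x.
have [e /= e0 He] : exists2 e : R, 0 < e &
    ~ (\forall y \near x, `|F x - F y| < e).
  apply: contrapT => Hn; apply: nc; apply/cvgrPdist_lt => e e0.
  by apply: contrapT => h; apply: Hn; exists e.
have /choice[u uP] (k : nat) : exists y, ball x (k.+1%:R^-1 : R) y /\ e <= `|F x - F y|.
  apply: contrapT => Hn; apply: He; apply/nbhs_ballP.
  exists k.+1%:R^-1 => /=; first by rewrite invr_gt0.
  by move=> y xy; rewrite ltNge; apply/negP => ey; apply: Hn; exists y.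
have ux : u @ \oo --> x.
  apply/cvg_ballP => d d0.
  have /cvgrPdist_lt/(_ d d0) := @cvg_harmonic R.
  apply: filterS => k; rewrite sub0r normrN /= ger0_norm ?invr_ge0// => kd.
  by case: (uP k) => + _; apply: le_ball; exact: ltW.
have /cvgrPdist_lt/(_ e e0)[N _ /(_ N (leqnn N))] := H u ux.
by rewrite ltNge; case: (uP N) => _ ->.
Qed.

Lemma inv_fourier_continuous g : cintegrable_on Leb g -> ccontinuous (inv_fourier g).
Proof.
move=> Ig.
suff H x (u : nat -> Rn) : u @ \oo --> x ->
    ccvg (fun k => inv_fourier g (u k)) (inv_fourier g x).
  by split=> x; apply: continuous_rV_seq => u /H [].
move=> ux; apply: ccvgM; first exact: ccvg_cst.
apply: (@cdominated_cvg _ _ _ Leb _ _ (fun xi => Normc.normc (g xi))).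
- by move=> k; exact: cintegrable_measurable (cintegrable_cis_dotpr (u k) Ig).
- exact: cintegrable_measurable (cintegrable_cis_dotpr x Ig).
- apply: aeW => xi; apply: ccvgM; last exact: ccvg_cst.
  have uxi : dotp (u k) xi @[k --> \oo] --> dotp x xi.
    exact: (cvg_comp _ _ ux (@continuous_dotpl _ _ xi x)).
  by split; [exact: (cvg_comp _ _ uxi (@continuous_cos R _))|
             exact: (cvg_comp _ _ uxi (@continuous_sin R _))].
- exact: cintegrable_normc.
- by move=> k xi; rewrite Normc.normcM normc_cis mul1r.
Qed.

Lemma inv_fourier_Cb0 g : cintegrable_on Leb g -> Cb0 (inv_fourier g).
Proof.
move=> Ig; split; first exact: inv_fourier_continuous.
by eexists => x; exact: normc_inv_fourier.
Qed.

(** Fubini moves the inverse integral from [g] to the transform of the test function, where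
    [fourier_inversion] applies. *)
Lemma has_fourier_inv g : cintegrable_on Leb g -> has_fourier (inv_fourier g) g.
Proof.
move=> Ig; split=> // phi Sphi.
have Ift := fourier_int_integrable Sphi.
pose F (p : Rn * Rn) := fourier_int phi p.1 * g p.2 * cis (dotp p.1 p.2).
have IF : cintegrable_on (Leb \x Leb)%E F.
  apply: (@cintegrable_tensor _ _ _ _ _ _ _ _ _ _ 1) => // [|p]; last by rewrite normc_cis.
  by apply: cmeasurable_cis; exact: measurable_dotp2.
have := congr1 ( *%R inv2pi%:C) (cFubini IF).
have -> : (fun y => cint Leb (fun x => F (x, y))) =
    (fun y => ((2 * pi) ^+ n)%:C * (g y * phi y)).
  apply/funext => y; rewrite mulrCA -fourier_inversion// -cintZ; last first.
    exact: cintegrable_cis_dotpr.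
  by apply: eq_cint => x; rewrite /F /= (dotpC x); ring.
have [M MP] := schwartz_bounded Sphi.
rewrite cintZ; last first.
  under eq_fun do rewrite mulrC.
  exact: cintegrable_bndl (schwartz_measurable Sphi) MP Ig.
rewrite mulrA inv2piE mul1r => E.
rewrite -[RHS]E /fourier_dist /tdist.
transitivity (cint Leb (fun x => inv2pi%:C * cint Leb (fun y => F (x, y)))).
  apply: eq_cint => x; rewrite /inv_fourier mulrAC -mulrA; congr (_ * _).
  transitivity (fourier_int phi x * cint Leb (fun y => cis (dotp x y) * g y)).
    by rewrite mulrC.
  rewrite -cintZ; last exact: cintegrable_cis_dotpr.
  by apply: eq_cint => y; rewrite /F /=; ring.
apply: cintZ.
have mI : cmeasurable (fun x => cint Leb (fun y => F (x, y))).
  by apply: cmeasurable_fubini1; exact: cintegrable_measurable IF.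
apply: (@le_cintegrable _ _ _ Leb _
  (fun x => fine (L1norm Leb g) * Normc.normc (fourier_int phi x))) => //.
  move=> x.
  rewrite (_ : cint _ _ = fourier_int phi x * cint Leb (fun y => cis (dotp x y) * g y)).
    rewrite Normc.normcM mulrC ler_wpM2r ?normc_ge0//; apply: normc_cint_cisM => //.
    exact: measurable_dotpr.
  rewrite -cintZ; last exact: cintegrable_cis_dotpr.
  by apply: eq_cint => y; rewrite /F /=; ring.
exact: (integrableZl measurableT (fine (L1norm Leb g)) (cintegrable_normc Ift)).
Qed.

Lemma Cb0_measurable f : Cb0 f -> cmeasurable f.
Proof. by case=> /ccontinuous_cmeasurable. Qed.

(** The transforms of [gauss_wave x] recover the value at [x] of a bounded continuous function from
    its pairings with Schwartz functions. *)
Lemma has_fourier_inj f1 f2 g : Cb0 f1 -> Cb0 f2 ->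
  has_fourier f1 g -> has_fourier f2 g -> f1 = f2.
Proof.
move=> C1 C2 [_ H1] [_ H2]; apply/funext => x.
have [c1 [M1 b1]] := C1; have [c2 [M2 b2]] := C2.
have l1 := gauss_wave_cvg x (Cb0_measurable C1) c1 b1.
have l2 := gauss_wave_cvg x (Cb0_measurable C2) c2 b2.
have E k : cint Leb (fun y => f1 y * fourier_int (gauss_wave x k.+1%:R^-1) y) =
    cint Leb (fun y => f2 y * fourier_int (gauss_wave x k.+1%:R^-1) y).
  have e0 : 0 < k.+1%:R^-1 :> R by rewrite invr_gt0.
  have S := schwartz_gauss_wave x e0.
  by have := H1 _ S; rewrite -(H2 _ S).
rewrite (funext E) in l1; have := ccvg_unique l1 l2.
by move=> /(congr1 ( *%R inv2pi%:C)); rewrite !mulrA inv2piE !mul1r.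
Qed.

Lemma has_fourierE f g : Cb0 f -> has_fourier f g -> f = inv_fourier g.
Proof.
move=> Cf fg; have [Ig _] := fg.
exact: has_fourier_inj Cf (inv_fourier_Cb0 Ig) fg (has_fourier_inv Ig).
Qed.

(** The bound is uniform in [x] and [e], which supplies the dominating function in
    [vanishing_pairing]. *)
Lemma cint_fourier_gauss_wave_le h (M : R) x (e : R) : 0 < e -> cmeasurable h ->
  (forall y, Normc.normc (h y) <= M) ->
  Normc.normc (cint Leb (fun y => h y * fourier_int (gauss_wave x e) y)) <=
  M * ((2 * Num.sqrt pi) ^+ n * fine (L1norm Leb (fun z : Rn => (gaussn z)%:C))).
Proof.
move=> e0 mh hM; have M0 : 0 <= M by rewrite (le_trans _ (hM 0))// normc_ge0.
have c0 : 0 <= (2 * Num.sqrt pi) ^+ n :> R by rewrite exprn_ge0// mulr_ge0// sqrtr_ge0.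
rewrite (cint_fourier_gauss_wave x e0 mh hM).
apply: normc_cint_le.
  apply: cmeasurableM; first by apply: cmeasurable_comp mh _; exact: measurable_rVD.
  by apply: cmeasurable_real; apply: measurable_funM => //; exact: measurable_gaussn.
rewrite mulrA EFinM -L1norm_fineK; last exact: cintegrable_gaussn.
rewrite /L1norm -ge0_integralZl//; first last.
- by rewrite lee_fin mulr_ge0.
- by move=> z _; rewrite lee_fin normc_ge0.
- by apply/measurable_EFinP; apply: cmeasurable_normc; apply: cmeasurable_real;
    exact: measurable_gaussn.
apply: ge0_le_integral => //.
- by move=> z _; rewrite lee_fin normc_ge0.
- apply/measurable_EFinP/cmeasurable_normc.
  apply: cmeasurableM; first by apply: cmeasurable_comp mh _; exact: measurable_rVD.
  by apply: cmeasurable_real; apply: measurable_funM => //; exact: measurable_gaussn.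
- apply/measurable_EFinP; apply: measurable_funM => //; apply: cmeasurable_normc.
  by apply: cmeasurable_real; exact: measurable_gaussn.
- move=> z _; rewrite lee_fin Normc.normcM rmorphM Normc.normcM normc_gaussn.
  by rewrite normc_real (ger0_norm c0) mulrA !ler_wpM2r ?gaussn_ge0.
Qed.

(* Testing against translated gaussians gives [cint (g * (h * gauss)) = 0], hence
   [cint (g * h) = 0] in the limit. *)
Lemma vanishing_pairing g h (M : R) : cintegrable_on Leb g -> cintegrable_on Leb h ->
  (forall phi, schwartz phi -> cint Leb (fun x => g x * phi x) = 0) ->
  ccontinuous h -> (forall y, Normc.normc (h y) <= M) ->
  cint Leb (fun x => g x * h x) = 0.
Proof.
move=> Ig Ih g0 ch hM; have mh := ccontinuous_cmeasurable ch.
have mg := cintegrable_measurable Ig.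
have e0 k : 0 < k.+1%:R^-1 :> R by rewrite invr_gt0.
pose C := (2 * Num.sqrt pi) ^+ n * fine (L1norm Leb (fun z : Rn => (gaussn z)%:C)).
pose K k (x y : Rn) := fourier_int (gauss_wave x k.+1%:R^-1) y.
have KM k x y : Normc.normc (K k x y) <= (Num.sqrt pi / k.+1%:R^-1) ^+ n.
  have c0 : 0 <= (Num.sqrt pi / k.+1%:R^-1) ^+ n :> R.
    by rewrite exprn_ge0// divr_ge0 ?sqrtr_ge0.
  rewrite /K fourier_gauss_wave// normc_real ger0_norm ?mulr_ge0 ?gaussn_ge0//.
  by rewrite ler_piMr// gaussn_le1.
have mK k : cmeasurable (fun p : Rn * Rn => K k p.1 p.2).
  rewrite (_ : (fun p => _) = (fun p : Rn * Rn =>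
      ((Num.sqrt pi / k.+1%:R^-1) ^+ n * gaussn ((2 * k.+1%:R^-1)^-1 *: (p.2 - p.1)))%:C)).
    apply: cmeasurable_real; apply: measurable_funM => //.
    apply: measurableT_comp; first exact: measurable_gaussn.
    have m1 := @measurable_rVD R n 0 (2 * k.+1%:R^-1)^-1.
    have m2 := measurableT_comp (@measurable_rVB R n) (@measurable_swap _ _ Rn Rn).
    have := measurableT_comp m1 m2.
    by under eq_fun do rewrite /= add0r.
  by apply/funext => p; rewrite /K fourier_gauss_wave.
have H k : cint Leb (fun x => g x * cint Leb (fun y => h y * K k x y)) = 0.
  pose F (p : Rn * Rn) := g p.1 * h p.2 * K k p.1 p.2.
  have IF : cintegrable_on (Leb \x Leb)%E F.
    exact: (cintegrable_tensor Ig Ih (mK k) (fun p => KM k p.1 p.2)).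
  transitivity (cint Leb (fun x => cint Leb (fun y => F (x, y)))).
    apply: eq_cint => x; rewrite -cintZ.
      by apply: eq_cint => y; rewrite /F /= mulrA.
    exact: (cintegrable_bndl mh hM (cintegrable_fourier_gauss_wave x (e0 k))).
  rewrite (cFubini IF); transitivity (cint Leb (fun _ : Rn => 0 : R[i])); last first.
    by apply: complex_ext; rewrite /= /Rintegral integral0.
  apply: eq_cint => y.
  transitivity (h y * cint Leb (fun x => g x * K k y x)).
    rewrite -cintZ.
      by apply: eq_cint => x; rewrite /F /= {1}/K gauss_wave_fourierC// -/(K k y x); ring.
    under eq_fun do rewrite mulrC.
    exact: (cintegrable_bndl (cmeasurable_pair1 y (mK k)) (KM k y) Ig).
  by rewrite g0 ?mulr0//; exact: schwartz_fourier_gauss_wave.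
have l1 : ccvg (fun k => cint Leb (fun x => g x * cint Leb (fun y => h y * K k x y)))
    (cint Leb (fun x => g x * (((2 * pi) ^+ n)%:C * h x))).
  apply: (@cdominated_cvg _ _ _ Leb _ _ (fun x => M * C * Normc.normc (g x))).
  - move=> k; apply: cmeasurableM => //.
    apply: (@cmeasurable_fubini1 _ _ _ _ R Leb (fun p : Rn * Rn => h p.2 * K k p.1 p.2)).
    by apply: cmeasurableM; [exact: cmeasurable_comp mh _|exact: mK].
  - by apply: cmeasurableM => //; apply: cmeasurableM => //; exact: cmeasurable_cst.
  - apply: aeW => x; apply: ccvgM; first exact: ccvg_cst.
    exact: gauss_wave_cvg mh ch hM.
  - exact: (integrableZl measurableT (M * C) (cintegrable_normc Ig)).
  - move=> k x; rewrite Normc.normcM mulrC ler_wpM2r ?normc_ge0//.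
    exact: cint_fourier_gauss_wave_le.
rewrite (funext H) in l1; have := ccvg_unique l1 (ccvg_cst 0).
have -> : cint Leb (fun x => g x * (((2 * pi) ^+ n)%:C * h x)) =
    ((2 * pi) ^+ n)%:C * cint Leb (fun x => g x * h x).
  rewrite -cintZ; last first.
    under eq_fun do rewrite mulrC.
    exact: cintegrable_bndl mh hM Ig.
  by apply: eq_cint => x; ring.
by move=> /(congr1 ( *%R inv2pi%:C)); rewrite mulrA inv2piE mul1r mulr0.
Qed.

(** [L1_eq0] tests against bounded continuous functions, but [vanishing_pairing] also wants them
    integrable. Applying [L1_eq0] to [g] times a gaussian reconciles the two, and the gaussian never
    vanishes, so it can be divided out. *)
Lemma vanishing_tdist g : cintegrable_on Leb g ->
  (forall phi, schwartz phi -> cint Leb (fun x => g x * phi x) = 0) ->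
  \forall x \ae Leb, g x = 0.
Proof.
move=> Ig g0.
have [I1 I2] : cintegrable_on Leb (fun x => g x * (gaussn x)%:C).
  under eq_fun do rewrite mulrC.
  apply: (@cintegrable_bndl _ _ _ Leb _ _ 1) => //.
    by apply: cmeasurable_real; exact: measurable_gaussn.
  by move=> x; rewrite normc_gaussn gaussn_le1.
have H (h : Rn -> R) : continuous h -> (forall x, 0 <= h x <= 1) ->
    cint Leb (fun x => g x * (gaussn x)%:C * (h x)%:C) = 0.
  move=> ch h01.
  have hM x : Normc.normc (h x)%:C <= 1.
    by rewrite normc_real ger0_norm; case/andP: (h01 x).
  under eq_fun do rewrite -mulrA.
  apply: (@vanishing_pairing g (fun x => (gaussn x)%:C * (h x)%:C) 1) => //.
  - under eq_fun do rewrite mulrC.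
    apply: cintegrable_bndl hM cintegrable_gaussn.
    exact/ccontinuous_cmeasurable/ccontinuous_real.
  - apply: ccontinuousM; last exact: ccontinuous_real.
    apply: ccontinuous_real => x.
    have := @continuous_gaussn_affine R n 0 1 x.
    by under eq_fun do rewrite subr0 scale1r.
  - move=> y; rewrite Normc.normcM normc_gaussn mulr_ile1 ?gaussn_ge0 ?normc_ge0//.
    exact: gaussn_le1.
have g00 x : gaussn x != 0 by rewrite gt_eqF// expR_gt0.
have e1 : \forall x \ae Leb, complex.Re (g x * (gaussn x)%:C) = 0.
  apply: (L1_eq0 I1) => h ch h01.
  have /(congr1 (@complex.Re R)) /= := H h ch h01.
  by under eq_Rintegral do rewrite cReM [complex.Im (_ %:C)]/= mulr0 subr0.
have e2 : \forall x \ae Leb, complex.Im (g x * (gaussn x)%:C) = 0.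
  apply: (L1_eq0 I2) => h ch h01.
  have /(congr1 (@complex.Im R)) /= := H h ch h01.
  by under eq_Rintegral do rewrite cImM [complex.Im (_ %:C)]/= mulr0 add0r.
apply: filterS2 e1 e2 => x; rewrite cReM cImM /= !mulr0 subr0 add0r => a b.
by apply: complex_ext; apply/eqP; [move/eqP: a|move/eqP: b]; rewrite mulf_eq0 (negbTE (g00 x)) orbF.
Qed.

Lemma has_fourier_unique f g1 g2 : has_fourier f g1 -> has_fourier f g2 ->
  \forall x \ae Leb, g1 x = g2 x.
Proof.
move=> [I1 H1] [I2 H2].
have Ib phi g : schwartz phi -> cintegrable_on Leb g ->
    cintegrable_on Leb (fun x => g x * phi x).
  move=> Sphi Ig; have [M MP] := schwartz_bounded Sphi.
  under eq_fun do rewrite mulrC.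
  exact: cintegrable_bndl (schwartz_measurable Sphi) MP Ig.
have : \forall x \ae Leb, g1 x - g2 x = 0.
  apply: vanishing_tdist; first exact: cintegrableB.
  move=> phi Sphi; under eq_fun do rewrite mulrBl.
  rewrite cintB; [|exact: Ib|exact: Ib].
  by apply/eqP; rewrite subr_eq0; apply/eqP; exact: etrans (esym (H1 _ Sphi)) (H2 _ Sphi).
by apply: filterS => x /eqP; rewrite subr_eq0 => /eqP.
Qed.

Lemma fourierP f g : has_fourier f g -> has_fourier f (fourier f).
Proof. by move=> fg; apply: (@xgetPex _ (fun=> 0) [set g | has_fourier f g]); exists g. Qed.

Lemma fourier_inv_fourier g : cintegrable_on Leb g ->
  \forall x \ae Leb, fourier (inv_fourier g) x = g x.
Proof.
move=> Ig; have H := has_fourier_inv Ig.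
exact: has_fourier_unique (fourierP H) H.
Qed.

End inverse_fourier.

(** * Weighted L^1 spaces and convolution *)

Section weighted_L1.
Context {R : realType} {n : nat}.
Local Open Scope complex_scope.
Local Notation Leb := (@lebesgue_rV R n).
Local Notation Rn := 'rV[R]_n.
Implicit Types (f g h : Rn -> R[i]) (x xi : Rn) (s : R).

(** The norm of L^1 with weight [J^s], kept extended-real so that Tonelli estimates come before any
    finiteness. *)
Definition wnorm s g : \bar R :=
  (\int[Leb]_xi (japanese xi `^ s * Normc.normc (g xi))%:E)%E.

Lemma measurable_japanese_powR s : measurable_fun setT (fun xi : Rn => japanese xi `^ s).
Proof. exact: measurableT_comp (@measurable_powR R s) (@measurable_japanese R n). Qed.

Lemma measurable_weight s g : cmeasurable g ->
  measurable_fun setT (fun xi => japanese xi `^ s * Normc.normc (g xi)).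
Proof.
move=> mg; apply: measurable_funM; first exact: measurable_japanese_powR.
exact: cmeasurable_normc.
Qed.

Lemma emeasurable_weight s g : cmeasurable g ->
  measurable_fun setT (fun xi => (japanese xi `^ s * Normc.normc (g xi))%:E).
Proof. by move=> mg; apply/measurable_EFinP; exact: measurable_weight. Qed.

Lemma weight_ge0 s g xi : 0 <= japanese xi `^ s * Normc.normc (g xi).
Proof. by rewrite mulr_ge0 ?powR_ge0 ?normc_ge0. Qed.

Lemma wnorm_ge0 s g : (0 <= wnorm s g)%E.
Proof. by apply: integral_ge0 => x _; rewrite lee_fin weight_ge0. Qed.

Lemma japanese_powR_ge1 s xi : 0 <= s -> 1 <= japanese xi `^ s.
Proof. by move=> s0; rewrite -(powRr0 (japanese xi)) ler_powR// japanese_ge1. Qed.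

Lemma japanese_powRD s t xi : japanese xi `^ (s + t) = japanese xi `^ s * japanese xi `^ t.
Proof. by rewrite powRD//; apply/implyP => _; rewrite gt_eqF ?japanese_gt0. Qed.

Lemma wnorm0 g : wnorm 0 g = L1norm Leb g.
Proof. by apply: eq_integral => x _; rewrite powRr0 mul1r. Qed.

Lemma le_wnorm s t g : s <= t -> cmeasurable g -> (wnorm s g <= wnorm t g)%E.
Proof.
move=> st mg; apply: ge0_le_integral => //.
- by move=> x _; rewrite lee_fin weight_ge0.
- exact: emeasurable_weight.
- exact: emeasurable_weight.
- by move=> x _; rewrite lee_fin ler_wpM2r ?normc_ge0// ler_powR// japanese_ge1.
Qed.

Lemma wnorm_integrable s g : cmeasurable g -> (wnorm s g < +oo)%E ->
  Leb.-integrable setT (fun xi => (japanese xi `^ s * Normc.normc (g xi))%:E).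
Proof.
move=> mg goo; apply/integrableP; split; first exact: emeasurable_weight.
by under eq_integral do rewrite gee0_abs ?lee_fin ?weight_ge0//.
Qed.

Lemma integrable_wnorm s g :
  Leb.-integrable setT (fun xi => (japanese xi `^ s * Normc.normc (g xi))%:E) ->
  (wnorm s g < +oo)%E.
Proof.
move=> /integrableP[_].
by under eq_integral do rewrite gee0_abs ?lee_fin ?weight_ge0//.
Qed.

Lemma wnorm_cintegrable s g : 0 <= s -> cmeasurable g -> (wnorm s g < +oo)%E ->
  cintegrable_on Leb g.
Proof.
move=> s0 mg goo; apply: L1norm_lty => //.
by rewrite -wnorm0 (le_lt_trans (le_wnorm s0 mg)).
Qed.

Lemma ae_eq_wnorm s g h : cmeasurable g -> cmeasurable h ->
  (\forall x \ae Leb, g x = h x) -> wnorm s g = wnorm s h.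
Proof.
move=> mg mh gh; apply: ae_eq_integral => //.
- exact: emeasurable_weight.
- exact: emeasurable_weight.
- by apply: filterS gh => x ->.
Qed.

Lemma wnormZ s z g : cmeasurable g ->
  wnorm s (fun x => z * g x) = ((Normc.normc z)%:E * wnorm s g)%E.
Proof.
move=> mg; rewrite /wnorm -ge0_integralZl//.
- by apply: eq_integral => x _; rewrite Normc.normcM mulrCA EFinM.
- exact: emeasurable_weight.
- by move=> x _; rewrite lee_fin weight_ge0.
- by rewrite lee_fin normc_ge0.
Qed.

(** The Fourier side of [(1 - Delta)^(s/2)]; negative [s] gives Bessel potentials. *)
Definition bessel s g xi : R[i] := (japanese xi `^ s)%:C * g xi.

Lemma cmeasurable_bessel s g : cmeasurable g -> cmeasurable (bessel s g).
Proof.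
move=> mg; apply: cmeasurableM => //; apply: cmeasurable_real.
exact: measurable_japanese_powR.
Qed.

Lemma wnorm_bessel s t g : wnorm s (bessel t g) = wnorm (s + t) g.
Proof.
apply: eq_integral => x _; rewrite Normc.normcM normc_real ger0_norm ?powR_ge0//.
by rewrite mulrA -japanese_powRD.
Qed.

End weighted_L1.

(** * Derivatives and the Laplacian on the Fourier side *)

Section derivatives_inverse_fourier.
Context {R : realType} {n : nat}.
Local Open Scope complex_scope.
Local Notation Leb := (@lebesgue_rV R n).
Local Notation Rn := 'rV[R]_n.
Implicit Types (f g h : Rn -> R[i]) (x xi : Rn) (s : R).

Definition fderiv (j : 'I_n) g xi : R[i] := (0 +i* xi ord0 j) * g xi.

Lemma cmeasurable_fderiv j g : cmeasurable g -> cmeasurable (fderiv j g).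
Proof.
move=> mg; apply: cmeasurableM => //; split; first exact: measurable_cst.
exact: measurable_rV_entry.
Qed.

Lemma normc_fderiv j g xi : Normc.normc (fderiv j g xi) = `|xi ord0 j| * Normc.normc (g xi).
Proof. by rewrite Normc.normcM; congr (_ * _); rewrite cnormcE /= expr0n add0r sqrtr_sqr. Qed.

Lemma wnorm_fderiv s j g : cmeasurable g -> (wnorm s (fderiv j g) <= wnorm (s + 1) g)%E.
Proof.
move=> mg; apply: ge0_le_integral => //.
- by move=> x _; rewrite lee_fin weight_ge0.
- by apply: emeasurable_weight; exact: cmeasurable_fderiv.
- exact: emeasurable_weight.
- move=> x _; rewrite lee_fin normc_fderiv mulrA ler_wpM2r ?normc_ge0//.
  rewrite japanese_powRD ler_wpM2l ?powR_ge0//.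
  by rewrite powRr1 ?japanese_ge0 ?entry_le_japanese.
Qed.

Lemma is_pderiv_inv_fourier (j : 'I_n) g : cmeasurable g -> (wnorm 1 g < +oo)%E ->
  is_pderiv j (inv_fourier g) (inv_fourier (fderiv j g)).
Proof.
move=> mg goo x t; set d : Rn := delta_mx ord0 j.
have Ig := wnorm_cintegrable ler01 mg goo.
have dE s xi : dotp (x + s *: d) xi = dotp x xi + s * xi ord0 j.
  by rewrite dotpDl dotpZl dotp_delta.
apply: is_cderiveZ.
apply: (@is_cderive_cint _ _ _ Leb
  (fun s (xi : Rn) => cis (dotp (x + s *: d) xi) * g xi)
  (fun s (xi : Rn) => cis (dotp (x + s *: d) xi) * fderiv j g xi) t
  (fun xi => japanese xi `^ 1 * Normc.normc (g xi))).
- by move=> s _; exact: cintegrable_cis_dotpr.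
- move=> s xi _; apply: is_cderive_eq.
    apply: is_cderiveM; last exact: is_cderive_cst.
    under eq_fun do rewrite dE.
    by apply: (@is_cderive_cis _ (fun s => dotp x xi + s * xi ord0 j)).
  rewrite /= -dE mulr0 add0r /fderiv /GRing.scale /= mulr0 !add0r mulr1.
  by rewrite mul1r mulrA [cis _ * _]mulrC.
- move=> s xi _; rewrite Normc.normcM normc_cis mul1r normc_fderiv powRr1 ?japanese_ge0//.
  by rewrite ler_wpM2r ?normc_ge0// entry_le_japanese.
- exact: wnorm_integrable.
Qed.

(** Each derivative consumes one power of the weight. The integer [m] is the supply left after [l];
    it varies in the induction, since the outermost derivative draws on what the inner ones
    leave. *)
Lemma pderivs_inv_fourier (l : seq 'I_n) (m : nat) g : cmeasurable g ->
  (wnorm (size l + m)%:R g < +oo)%E ->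
  let g' := foldr fderiv g l in
  [/\ cmeasurable g', (wnorm m%:R g' < +oo)%E &
      pderivs l (inv_fourier g) = inv_fourier g'].
Proof.
move=> mg; elim: l m => [//|j l IH] m goo /=.
have [|mg' g'oo E] := IH m.+1; first by rewrite addnS.
split; first exact: cmeasurable_fderiv.
  by apply: le_lt_trans (wnorm_fderiv m%:R j mg') _; rewrite natr1; exact: g'oo.
rewrite -/(pderivs l _) E.
suff /is_pderivP[] : is_pderiv j (inv_fourier (foldr fderiv g l))
  (inv_fourier (fderiv j (foldr fderiv g l))) by [].
apply: (is_pderiv_inv_fourier j mg').
by apply: le_lt_trans (le_wnorm _ mg') g'oo; rewrite ler1n.
Qed.

Lemma inv_fourier_Ck (k : nat) g : cmeasurable g -> (wnorm k%:R g < +oo)%E ->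
  Ck k (inv_fourier g).
Proof.
move=> mg goo l lk.
have goo' m : (size l + m <= k)%N -> (wnorm (size l + m)%:R g < +oo)%E.
  by move=> lm; rewrite (le_lt_trans (le_wnorm _ mg) goo)// ler_nat.
split.
  have [|mg' g'oo ->] := pderivs_inv_fourier (l := l) (m := 0) mg.
    by apply: goo'; rewrite addn0.
  by apply: inv_fourier_continuous; exact: wnorm_cintegrable g'oo.
move=> lk1 j; have [|mg' g'oo ->] := pderivs_inv_fourier (l := l) (m := 1) mg.
  by apply: goo'; rewrite addn1.
by have /is_pderivP[] := is_pderiv_inv_fourier j mg' g'oo.
Qed.

Lemma inv_fourierB g h : cintegrable_on Leb g -> cintegrable_on Leb h ->
  inv_fourier (fun xi => g xi - h xi) = (fun x => inv_fourier g x - inv_fourier h x).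
Proof.
move=> Ig Ih; apply/funext => x; rewrite /inv_fourier -mulrBr -cintB.
- by congr (_ * _); apply: eq_cint => xi; rewrite mulrBr.
- exact: cintegrable_cis_dotpr.
- exact: cintegrable_cis_dotpr.
Qed.

Lemma inv_fourier_laplacian g : cmeasurable g -> (wnorm 2 g < +oo)%E ->
  (fun x => inv_fourier g x - laplacian (inv_fourier g) x) = inv_fourier (bessel 2 g).
Proof.
move=> mg goo.
have Ig := wnorm_cintegrable (ler0n R 2) mg goo.
have H j : [/\ cmeasurable (fderiv j (fderiv j g)), (wnorm 0 (fderiv j (fderiv j g)) < +oo)%E &
    pderivs [:: j; j] (inv_fourier g) = inv_fourier (fderiv j (fderiv j g))].
  exact: (pderivs_inv_fourier (l := [:: j; j]) (m := 0) mg).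
have Ij j : cintegrable_on Leb (fderiv j (fderiv j g)).
  by case: (H j) => m w _; exact: wnorm_cintegrable w.
(* The sum over coordinates is built one index at a time, together with integrability of the partial
   symbol, which [inv_fourierB] requires. *)
suff : forall l : seq 'I_n,
    cintegrable_on Leb (fun xi => g xi - \sum_(j <- l) fderiv j (fderiv j g) xi) /\
    (fun x => inv_fourier g x - \sum_(j <- l) pderivs [:: j; j] (inv_fourier g) x) =
    inv_fourier (fun xi => g xi - \sum_(j <- l) fderiv j (fderiv j g) xi).
  move=> /(_ (index_enum 'I_n)) [_ ->]; congr inv_fourier; apply/funext => xi.
  rewrite /bessel (powR_mulrn 2 (japanese_ge0 xi)) japanese_sqr.
  have -> : \sum_(j <- index_enum 'I_n) fderiv j (fderiv j g) xi =
      - (dotp xi xi)%:C * g xi.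
    rewrite /dotp rmorph_sum -sumrN mulr_suml; apply: eq_bigr => j _.
    rewrite /fderiv mulrA; congr (_ * _).
    by apply: complex_ext; rewrite ?cReM ?cImM ?cReN ?cImN /=; ring.
  by rewrite rmorphD /=; ring.
elim=> [|j l [IHI IHE]].
  split; first by under eq_fun do rewrite big_nil subr0.
  by under eq_fun do rewrite big_nil subr0; under [in RHS]eq_fun do rewrite big_nil subr0.
have E (a b c : R[i]) : a - (b + c) = a - c - b by rewrite opprD addrA addrAC.
under eq_fun do rewrite big_cons E.
under [in X in _ /\ X]eq_fun do rewrite big_cons E.
split; first exact: cintegrableB.
rewrite inv_fourierB// -IHE; apply/funext => x.
by case: (H j) => _ _ ->.
Qed.

End derivatives_inverse_fourier.

(** * Convolution in weighted L^1 and its inverse Fourier transform *)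

Section convolution.
Context {R : realType} {n : nat}.
Local Open Scope complex_scope.
Local Notation Leb := (@lebesgue_rV R n).
Local Notation Rn := 'rV[R]_n.
Implicit Types (f g h : Rn -> R[i]) (x xi eta : Rn) (s : R).

Definition convol g h xi : R[i] := cint Leb (fun eta => g (xi - eta) * h eta).

Lemma cmeasurable_convol_fun g h : cmeasurable g -> cmeasurable h ->
  cmeasurable (fun p : Rn * Rn => g (p.1 - p.2) * h p.2).
Proof.
move=> mg mh; apply: cmeasurableM; last exact: cmeasurable_comp mh _.
exact: cmeasurable_comp mg (@measurable_rVB R n).
Qed.

Lemma cmeasurable_convol g h : cmeasurable g -> cmeasurable h -> cmeasurable (convol g h).
Proof.
move=> mg mh.
exact: (@cmeasurable_fubini1 _ _ _ _ R Leb _ (cmeasurable_convol_fun mg mh)).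
Qed.

Lemma japanese_peetre s xi eta : 0 <= s ->
  japanese xi `^ s <= 2 `^ (s / 2) * (japanese (xi - eta) `^ s * japanese eta `^ s).
Proof.
move=> s0.
have sq z : japanese z `^ s = (japanese z ^+ 2) `^ (s / 2) :> R.
  by rewrite -powR_mulrn ?japanese_ge0// -powRrM; congr (_ `^ _); field.
have j0 (z : Rn) : 0 <= japanese z ^+ 2 by rewrite exprn_ge0// japanese_ge0.
rewrite !sq -!powRM// ?(mulr_ge0 (j0 _) (j0 _))//.
have s20 : 0 <= s / 2 by rewrite divr_ge0.
apply: (ge0_ler_powR s20); rewrite ?nnegrE ?(mulr_ge0 _ (mulr_ge0 (j0 _) (j0 _)))//.
by have := peetre (xi - eta) eta; rewrite subrK.
Qed.

(** Young's inequality with the modulus still inside the inner integral. In this form it bounds the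
    norm of [convol] and, at [s = 0], also gives the joint integrability that Fubini requires in
    [inv_fourier_convol]. *)
Lemma young_tonelli s g h : 0 <= s -> cmeasurable g -> cmeasurable h ->
  (\int[Leb]_xi \int[Leb]_eta
      (japanese xi `^ s * Normc.normc (g (xi - eta) * h eta))%:E <=
   (2 `^ (s / 2))%:E * (wnorm s g * wnorm s h))%E.
Proof.
move=> s0 mg mh.
pose G xi := japanese xi `^ s * Normc.normc (g xi).
pose H xi := japanese xi `^ s * Normc.normc (h xi).
have mG : measurable_fun setT G by exact: measurable_weight.
have mH : measurable_fun setT H by exact: measurable_weight.
have G0 xi : 0 <= G xi by exact: weight_ge0.
have H0 xi : 0 <= H xi by exact: weight_ge0.
have mGH : measurable_fun setT (fun p : Rn * Rn => G (p.1 - p.2) * H p.2).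
  apply: measurable_funM; first exact: measurableT_comp mG (@measurable_rVB R n).
  exact: measurableT_comp mH _.
have mF : measurable_fun setT (fun p : Rn * Rn =>
    japanese p.1 `^ s * Normc.normc (g (p.1 - p.2) * h p.2)).
  apply: measurable_funM; first exact: measurableT_comp (@measurable_japanese_powR R n s) _.
  exact/cmeasurable_normc/cmeasurable_convol_fun.
pose K (p : Rn * Rn) := 2 `^ (s / 2) * (G (p.1 - p.2) * H p.2).
have mK : measurable_fun setT K by exact: measurable_funM.
have K0 p : 0 <= K p by rewrite mulr_ge0 ?powR_ge0// mulr_ge0.
apply: (@le_trans _ _ (\int[Leb]_xi \int[Leb]_eta (K (xi, eta))%:E)%E).
  apply: ge0_le_integral => //.
  - by move=> x _; apply: integral_ge0 => y _; rewrite lee_fin mulr_ge0 ?powR_ge0 ?normc_ge0.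
  - apply: (measurable_fun_fubini_tonelli_F (fun p : Rn * Rn =>
      (japanese p.1 `^ s * Normc.normc (g (p.1 - p.2) * h p.2))%:E)).
      exact/measurable_EFinP.
    by move=> p; rewrite lee_fin mulr_ge0 ?powR_ge0 ?normc_ge0.
  - apply: (measurable_fun_fubini_tonelli_F (fun p : Rn * Rn => (K p)%:E)).
      exact/measurable_EFinP.
    by move=> p; rewrite lee_fin.
  - move=> xi _; apply: ge0_le_integral => //.
    + by move=> y _; rewrite lee_fin mulr_ge0 ?powR_ge0 ?normc_ge0.
    + by apply/measurable_EFinP; exact: (measurableT_comp mF (pair1_measurable xi)).
    + by apply/measurable_EFinP; exact: (measurableT_comp mK (pair1_measurable xi)).
    + move=> eta _; rewrite lee_fin /K /G /H /= Normc.normcM.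
      rewrite (le_trans (ler_wpM2r _ (japanese_peetre xi eta s0)))//.
        by rewrite mulr_ge0 ?normc_ge0.
      by rewrite le_eqVlt; apply/orP; left; apply/eqP; ring.
rewrite (fubini_tonelli (fun p : Rn * Rn => (K p)%:E)); first last.
- by move=> p; rewrite lee_fin.
- exact/measurable_EFinP.
under eq_integral.
  move=> eta _.
  (* By translation invariance, the integral of [G (xi - eta)] over [xi] does not depend on
     [eta]. *)
  have -> : (\int[Leb]_xi (K (xi, eta))%:E = (2 `^ (s / 2) * H eta)%:E * wnorm s g)%E.
    rewrite /wnorm -(@ge0_integral_rV_affine R n (- eta) 1 (fun xi => (G xi)%:E))//.
    + rewrite expr1n mul1e -ge0_integralZl//.
      * apply: eq_integral => xi _; rewrite /K /= scale1r [- eta + _]addrC -EFinM.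
        by congr EFin; ring.
      * apply/measurable_EFinP; exact: measurableT_comp mG (measurable_rVD _ _).
      * by move=> x _; rewrite lee_fin.
      * by rewrite lee_fin mulr_ge0 ?powR_ge0.
    + exact/measurable_EFinP.
  over.
rewrite ge0_integralZr//; first last.
- exact: wnorm_ge0.
- by move=> x _; rewrite lee_fin mulr_ge0 ?powR_ge0.
- by apply/measurable_EFinP; exact: measurable_funM.
under eq_integral do rewrite EFinM.
rewrite ge0_integralZl//; first last.
- by move=> x _; rewrite lee_fin.
- exact/measurable_EFinP.
have -> : (\int[Leb]_x (H x)%:E = wnorm s h)%E by [].
by rewrite -muleA [(wnorm s h * _)%E]muleC.
Qed.

Lemma wnorm_convol s g h : 0 <= s -> cmeasurable g -> cmeasurable h ->
  (wnorm s (convol g h) <= (2 `^ (s / 2))%:E * (wnorm s g * wnorm s h))%E.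
Proof.
move=> s0 mg mh; apply: le_trans (young_tonelli s0 mg mh).
have mc := cmeasurable_convol_fun mg mh.
have mF : measurable_fun setT (fun p : Rn * Rn =>
    japanese p.1 `^ s * Normc.normc (g (p.1 - p.2) * h p.2)).
  apply: measurable_funM; first exact: measurableT_comp (@measurable_japanese_powR R n s) _.
  exact: cmeasurable_normc.
apply: ge0_le_integral => //.
- by move=> x _; rewrite lee_fin weight_ge0.
- by apply: emeasurable_weight; exact: cmeasurable_convol.
- apply: (measurable_fun_fubini_tonelli_F (fun p : Rn * Rn =>
      (japanese p.1 `^ s * Normc.normc (g (p.1 - p.2) * h p.2))%:E)).
    exact/measurable_EFinP.
  by move=> p; rewrite lee_fin mulr_ge0 ?powR_ge0 ?normc_ge0.
- move=> xi _; under eq_integral do rewrite EFinM.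
  have mx := cmeasurable_pair1 xi mc.
  rewrite ge0_integralZl//; first last.
  + by rewrite lee_fin powR_ge0.
  + by move=> x _; rewrite lee_fin normc_ge0.
  + exact/measurable_EFinP/cmeasurable_normc.
  by rewrite EFinM lee_wpmul2l ?lee_fin ?powR_ge0//; exact: normc_cint mx.
Qed.

Local Notation c2pi := (@inv2pi R n).

(** Fubini with the plane wave split along [xi = (xi - eta) + eta]. The product on the right carries
    [c2pi] twice and an inverse integral only once, hence the factor in front of [convol]. *)
Lemma inv_fourier_convol g h x : cintegrable_on Leb g -> cintegrable_on Leb h ->
  inv_fourier (fun xi => c2pi%:C * convol g h xi) x = inv_fourier g x * inv_fourier h x.
Proof.
move=> Ig Ih; have mg := cintegrable_measurable Ig; have mh := cintegrable_measurable Ih.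
have mc := cmeasurable_convol_fun mg mh.
pose F (p : Rn * Rn) := cis (dotp x p.1) * (g (p.1 - p.2) * h p.2).
have mF : cmeasurable F.
  apply: cmeasurableM => //; apply: cmeasurable_cis.
  exact: measurableT_comp (measurable_dotpr x) _.
have L1 f : cintegrable_on Leb f -> (wnorm 0 f < +oo)%E.
  by rewrite wnorm0; exact: cintegrable_L1norm.
have woo : ((2 `^ (0 / 2))%:E * (wnorm 0 g * wnorm 0 h) < +oo :> \bar R)%E.
  have fin f : cintegrable_on Leb f -> wnorm 0 f \is a fin_num.
    by move=> /L1 ?; rewrite ge0_fin_numE// wnorm_ge0.
  by rewrite -ge0_fin_numE ?fin_numM ?fin// mule_ge0 ?mule_ge0 ?wnorm_ge0// lee_fin powR_ge0.
have IF : cintegrable_on (Leb \x Leb)%E F.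
  apply: cintegrable12 => //; apply: le_lt_trans woo.
  apply: le_trans (young_tonelli (lexx 0) mg mh).
  rewrite le_eqVlt; apply/orP; left; apply/eqP.
  apply: eq_integral => xi _; apply: eq_integral => eta _.
  by rewrite /F /= Normc.normcM normc_cis mul1r powRr0 mul1r.
have Ic : cintegrable_on Leb (convol g h).
  apply: (wnorm_cintegrable (lexx 0)); first exact: cmeasurable_convol.
  exact: le_lt_trans (wnorm_convol (lexx 0) mg mh) woo.
rewrite /inv_fourier.
transitivity (c2pi%:C * (c2pi%:C * cint Leb (fun xi => cis (dotp x xi) * convol g h xi))).
  rewrite -[in RHS]cintZ; last exact: cintegrable_cis_dotpr.
  by congr (_ * _); apply: eq_cint => xi; rewrite mulrCA.
rewrite -mulrACA -mulrA; congr (_ * (_ * _)).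
pose Igx := cintegrable_cis_dotpr x Ig; pose Ihx := cintegrable_cis_dotpr x Ih.
(* Only almost everywhere: the wave can be taken inside the inner integral where the section is
   integrable. *)
have E1 : {ae Leb, forall xi, cis (dotp x xi) * convol g h xi =
    cint Leb (fun eta => F (xi, eta))}.
  have := cintegrable_normc IF.
  move=> /ae_integrable1; apply: filterS => xi ixi.
  rewrite /convol -cintZ//; apply: integrable_normcP; first exact: cmeasurable_pair1 xi mc.
  apply: eq_integrable ixi => // eta _.
  by rewrite /F /= Normc.normcM normc_cis mul1r.
have ->: cint Leb (fun xi => cis (dotp x xi) * convol g h xi) =
    cint Leb (fun xi => cint Leb (fun eta => F (xi, eta))).
  apply: ae_eq_cint => //.
  - exact: cintegrable_measurable (cintegrable_cis_dotpr x Ic).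
  - exact: cmeasurable_fubini1.
rewrite (cFubini IF) -cintZ//.
apply: eq_cint => eta.
have [_] := @cint_rV_affine R n (- eta) 1 _ ltr01 Igx.
rewrite expr1n mul1r => Eg; rewrite -[in RHS]Eg mulrC -cintZ; last first.
  by have [+ _] := @cint_rV_affine R n (- eta) 1 _ ltr01 Igx.
apply: eq_cint => xi; rewrite /F /= scale1r [- eta + _]addrC.
rewrite -{1}(subrK eta xi) dotpDr cisD; ring.
Qed.

End convolution.

(** * Neumann series *)

(* Series of complex numbers are written as integrals against the counting
   measure, so that Fubini exchanges them with integrals. *)
HB.instance Definition _ (R : realType) :=
  @Measure_isSigmaFinite.Build _ _ _ (@counting nat R) (sigma_finite_counting R).

Section counting_integral.
Context {R : realType}.
Local Notation cnt := (@counting nat R).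

Lemma ge0_integral_counting_recl (a : nat -> \bar R) : (forall k, 0 <= a k)%E ->
  (\int[cnt]_k a k = a 0%N + \int[cnt]_k a k.+1)%E.
Proof.
move=> a0; rewrite !ge0_integral_count// (nneseries_split 0%N 1%N)// add0n big_nat1.
congr (_ + _)%E; rewrite -(nneseries_addn 1 a0).
by apply: eq_eseriesr => k _; rewrite addn1.
Qed.

(** Splits off the zeroth term of an absolutely convergent series, in order to telescope the Neumann
    series. *)
Lemma cint_counting_recl (F : nat -> R[i]) :
  cintegrable_on cnt F -> cint cnt F = F 0%N + cint cnt (fun k => F k.+1).
Proof.
have aux (P SP N SN : \bar R) : P \is a fin_num -> SP \is a fin_num ->
    N \is a fin_num -> SN \is a fin_num ->
    fine (P + SP - (N + SN))%E = fine P - fine N + fine (SP - SN)%E.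
  by move: P SP N SN => [P||] [SP||] [N||] [SN||]//= _ _ _ _; rewrite opprD addrACA.
have main (f : nat -> R) : cnt.-integrable setT (EFin \o f) ->
    \int[cnt]_k f k = f 0%N + \int[cnt]_k f k.+1.
  move=> If; rewrite /Rintegral [in LHS]integralE [in RHS]integralE.
  have Ip := integrable_pos_fin_num measurableT If.
  have In := integrable_neg_fin_num measurableT If.
  move: Ip In; rewrite (ge0_integral_counting_recl (fun k => funepos_ge0 (EFin \o f) k)).
  rewrite (ge0_integral_counting_recl (fun k => funeneg_ge0 (EFin \o f) k)).
  move=> Ip In; have /andP[p0 p1] := etrans (esym (fin_numD _ _)) Ip.
  have /andP[n0 n1] := etrans (esym (fin_numD _ _)) In.
  have -> : (\int[cnt]_k (EFin \o (fun k => f k.+1))^\+ k = \int[cnt]_k (EFin \o f)^\+ k.+1)%E.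
    by apply: eq_integral => k _; rewrite !funeposE.
  have -> : (\int[cnt]_k (EFin \o (fun k => f k.+1))^\- k = \int[cnt]_k (EFin \o f)^\- k.+1)%E.
    by apply: eq_integral => k _; rewrite !funenegE.
  have -> : f 0%N = fine ((EFin \o f)^\+ 0%N) - fine ((EFin \o f)^\- 0%N).
    by rewrite -fineB//; have := funeposneg (EFin \o f) => /(congr1 (fun g => fine (g 0%N))).
  exact: aux p0 p1 n0 n1.
by move=> [f1 f2]; apply: complex_ext; rewrite ?cReD ?cImD; [exact: main f1|exact: main f2].
Qed.

Lemma cmeasurable_family d (T : measurableType d) (w : nat -> T -> R[i]) :
  (forall k, cmeasurable (w k)) -> cmeasurable (fun p : T * nat => w p.2 p.1).
Proof.
have main (h : nat -> T -> R) : (forall k, measurable_fun setT (h k)) ->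
    measurable_fun setT (fun p : T * nat => h p.2 p.1).
  move=> mh _ Y mY; rewrite setTI.
  rewrite (_ : _ @^-1` Y = \bigcup_k ((h k @^-1` Y) `*` [set k])).
    apply: bigcupT_measurable => k; apply: measurableX => //.
    by rewrite -[X in measurable X]setTI; exact: mh.
  apply/seteqP; split=> [[x k] /= hY|[x k] [l _ [/= hY ->]]//].
  by exists k.
move=> mw; split.
  by apply: (main (fun k x => complex.Re (w k x))) => k; case: (mw k).
by apply: (main (fun k x => complex.Im (w k x))) => k; case: (mw k).
Qed.

Lemma tonelli_counting d (T : measurableType d) (mu : {measure set T -> \bar R})
    (h : nat -> T -> \bar R) :
  (forall k, measurable_fun setT (h k)) -> (forall k x, (0 <= h k x)%E) ->
  (\int[mu]_x \int[cnt]_k h k x = \int[cnt]_k \int[mu]_x h k x)%E.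
Proof.
move=> mh h0; rewrite [RHS]ge0_integral_count; last first.
  by move=> k; apply: integral_ge0 => x _.
rewrite -integral_nneseries//; apply: eq_integral => x _.
by rewrite ge0_integral_count.
Qed.

Lemma emeasurable_integral_counting d (T : measurableType d) (h : nat -> T -> \bar R) :
  (forall k, measurable_fun setT (h k)) -> (forall k x, (0 <= h k x)%E) ->
  measurable_fun setT (fun x => \int[cnt]_k h k x)%E.
Proof.
move=> mh h0; rewrite (_ : (fun x => _) = (fun x => \sum_(k <oo) h k x)%E).
  exact: ge0_emeasurable_sum.
by apply/funext => x; rewrite ge0_integral_count.
Qed.

Lemma cmeasurable_counting (F : nat -> R[i]) : cmeasurable F.
Proof. by split. Qed.

Section fubini.
Context d (T : measurableType d) (mu : {sigma_finite_measure set T -> \bar R}).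
Variable w : nat -> T -> R[i].
Hypothesis mw : forall k, cmeasurable (w k).
Let scnt : {sigma_finite_measure set nat -> \bar R} := cnt.

Lemma cmeasurable_cint_counting : cmeasurable (fun x => cint cnt (fun k => w k x)).
Proof. exact: (cmeasurable_fubini1 scnt (cmeasurable_family mw)). Qed.

Hypothesis woo : (\int[cnt]_k L1norm mu (w k) < +oo)%E.

Let integrable_family :
  cintegrable_on (mu \x scnt)%E (fun p : T * nat => w p.2 p.1).
Proof.
apply: cintegrable12; first exact: cmeasurable_family.
move: woo; rewrite -tonelli_counting//.
  by move=> k; apply/measurable_EFinP; exact: cmeasurable_normc.
by move=> k x; rewrite lee_fin normc_ge0.
Qed.

Lemma cintegrable_counting : cintegrable_on cnt (fun k => cint mu (w k)).
Proof.
apply: L1norm_lty; first exact: cmeasurable_counting.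
apply: le_lt_trans woo; apply: ge0_le_integral => //.
- by move=> k _; rewrite lee_fin normc_ge0.
- by move=> k _; exact: normc_cint.
Qed.

Lemma ae_cintegrable_counting :
  {ae mu, forall x, cintegrable_on cnt (fun k => w k x)}.
Proof.
have /cintegrable_normc/ae_integrable1 := integrable_family.
apply: filterS => x ix; apply: integrable_normcP; first exact: cmeasurable_counting.
exact: ix.
Qed.

Lemma cint_cint_counting :
  cint mu (fun x => cint cnt (fun k => w k x)) = cint cnt (fun k => cint mu (w k)).
Proof. exact: (cFubini integrable_family). Qed.

End fubini.

End counting_integral.

Section weighted_series.
Context {R : realType} {n : nat}.
Local Open Scope complex_scope.
Local Notation Leb := (@lebesgue_rV R n).
Local Notation Rn := 'rV[R]_n.
Local Notation cnt := (@counting nat R).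
Variables (s : R) (w : nat -> Rn -> R[i]).
Hypothesis mw : forall k, cmeasurable (w k).

Lemma wnorm_cint_counting :
  (wnorm s (fun xi => cint cnt (fun k => w k xi)) <= \int[cnt]_k wnorm s (w k))%E.
Proof.
have mh k := emeasurable_weight s (mw k).
have h0 k x : (0 <= (japanese x `^ s * Normc.normc (w k x))%:E)%E.
  by rewrite lee_fin weight_ge0.
rewrite -(tonelli_counting Leb mh h0); apply: ge0_le_integral => //.
- by move=> x _; rewrite lee_fin; exact: (weight_ge0 s (fun xi => cint cnt (w^~ xi))).
- by apply: emeasurable_weight; exact: cmeasurable_cint_counting.
- exact: emeasurable_integral_counting.
- move=> xi _; under eq_integral do rewrite EFinM.
  rewrite ge0_integralZl//; first last.
  + by rewrite lee_fin powR_ge0.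
  + by move=> x _; rewrite lee_fin normc_ge0.
  rewrite EFinM lee_wpmul2l ?lee_fin ?powR_ge0//.
  by apply: normc_cint; exact: cmeasurable_counting.
Qed.

Hypotheses (s0 : 0 <= s) (woo : (\int[cnt]_k wnorm s (w k) < +oo)%E).

Lemma L1norm_le_wnorm (m : Rn -> R[i]) k : cmeasurable m ->
  (forall xi, Normc.normc (m xi) <= 1) ->
  (L1norm Leb (fun xi => m xi * w k xi)%R <= wnorm s (w k))%E.
Proof.
move=> mm m1; apply: ge0_le_integral => //.
- by move=> x _; rewrite lee_fin normc_ge0.
- by apply/measurable_EFinP; apply: cmeasurable_normc; exact: cmeasurableM.
- exact: emeasurable_weight.
- move=> x _; rewrite lee_fin Normc.normcM ler_wpM2r ?normc_ge0//.
  by rewrite (le_trans (m1 x))// japanese_powR_ge1.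
Qed.

Lemma sum_L1norm_lty (m : Rn -> R[i]) : cmeasurable m ->
  (forall xi, Normc.normc (m xi) <= 1) ->
  (\int[cnt]_k L1norm Leb (fun xi => m xi * w k xi)%R < +oo)%E.
Proof.
move=> mm m1; apply: le_lt_trans woo; apply: ge0_le_integral => //.
- by move=> k _; apply: integral_ge0 => x _; rewrite lee_fin normc_ge0.
- by move=> k _; exact: L1norm_le_wnorm.
Qed.

(** The multiplier [m] will be a plane wave times a nonpositive power of [japanese], so that inverse
    Fourier integrals can be taken term by term. *)
Lemma cint_bounded_series (m : Rn -> R[i]) : cmeasurable m ->
  (forall xi, Normc.normc (m xi) <= 1) ->
  cintegrable_on cnt (fun k => cint Leb (fun xi => m xi * w k xi)) /\
  cint Leb (fun xi => m xi * cint cnt (fun k => w k xi)) =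
  cint cnt (fun k => cint Leb (fun xi => m xi * w k xi)).
Proof.
move=> mm m1; have mmw k : cmeasurable (fun xi => m xi * w k xi) by exact: cmeasurableM.
have moo := sum_L1norm_lty mm m1.
split; first exact: (cintegrable_counting mmw moo).
rewrite -(cint_cint_counting mmw moo); apply: ae_eq_cint.
- by apply: cmeasurableM => //; exact: cmeasurable_cint_counting.
- exact: cmeasurable_cint_counting.
(* The multiplier 1 gives absolute convergence of the series itself for almost every [xi], which
   allows [m] to be moved inside it. *)
- have mon : cmeasurable (fun _ : Rn => 1 : R[i]) by exact: cmeasurable_cst.
  have n1 (xi : Rn) : Normc.normc (1 : R[i]) <= 1 by rewrite Normc.normc1.
  have m1w k : cmeasurable (fun xi => 1 * w k xi) by exact: cmeasurableM.
  have := ae_cintegrable_counting m1w (sum_L1norm_lty mon n1).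
  apply: filterS => xi ixi; rewrite -cintZ//.
  by under eq_fun do rewrite -[w _ _]mul1r.
Qed.

End weighted_series.

(** * The Neumann series for the equation on the Fourier side *)

Section neumann_series.
Context {R : realType} {n : nat}.
Local Open Scope complex_scope.
Local Notation Leb := (@lebesgue_rV R n).
Local Notation Rn := 'rV[R]_n.
Local Notation cnt := (@counting nat R).
Local Notation c2pi := (@inv2pi R n).
Variables (s : R) (V f : Rn -> R[i]) (q : R).
Hypotheses (s0 : 0 <= s) (mV : cmeasurable V) (mf : cmeasurable f).
Hypotheses (Voo : (wnorm s V < +oo)%E) (foo : (wnorm s f < +oo)%E).
Hypothesis qE : q%:E = ((2 `^ (s / 2) * c2pi)%:E * wnorm s V)%E.
Hypothesis q1 : q < 1.

(** Throughout this section [V] and [f] stand for the Fourier transforms of the data. This is then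
    the Fourier side of [u -> - V u] with [u = (1 - Delta)^-1 w]. *)
Definition potential_op (w : Rn -> R[i]) xi : R[i] :=
  - c2pi%:C * convol V (bessel (-2) w) xi.

Lemma cmeasurable_potential_op w : cmeasurable w -> cmeasurable (potential_op w).
Proof.
move=> mw; apply: cmeasurableM; first exact: cmeasurable_cst.
by apply: cmeasurable_convol => //; exact: cmeasurable_bessel.
Qed.

Lemma q_ge0 : 0 <= q.
Proof.
by rewrite -lee_fin qE mule_ge0 ?wnorm_ge0// lee_fin mulr_ge0 ?powR_ge0// ltW// inv2pi_gt0.
Qed.

Lemma wnorm_potential_op w : cmeasurable w ->
  (wnorm s (potential_op w) <= q%:E * wnorm (s - 2) w)%E.
Proof.
move=> mw; have mb := cmeasurable_bessel (-2) mw.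
rewrite wnormZ; last exact: cmeasurable_convol.
rewrite normcN normc_real ger0_norm ?(ltW inv2pi_gt0)//.
rewrite (le_trans (lee_wpmul2l _ (wnorm_convol s0 mV mb)))//.
  by rewrite lee_fin (ltW inv2pi_gt0).
by rewrite wnorm_bessel qE EFinM !muleA [(c2pi%:E * _)%E]muleC.
Qed.

Fixpoint neumann k : Rn -> R[i] :=
  if k is m.+1 then potential_op (neumann m) else f.

Lemma cmeasurable_neumann k : cmeasurable (neumann k).
Proof. by elim: k => [//|k IH]; exact: cmeasurable_potential_op. Qed.

Lemma wnorm_neumann k : (wnorm s (neumann k) <= (q ^+ k)%:E * wnorm s f)%E.
Proof.
elim: k => [|k IH]; first by rewrite expr0 mul1e.
have mk := cmeasurable_neumann k.
apply: (le_trans (wnorm_potential_op mk)); rewrite exprS EFinM -muleA.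
apply: lee_wpmul2l; first by rewrite lee_fin q_ge0.
(* The operator sees only the weaker norm of order [s - 2], bounded here by that of order [s] so
   that the estimate iterates. *)
by apply: le_trans IH; apply: le_wnorm => //; rewrite gerBl.
Qed.

Lemma sum_wnorm_neumann :
  (\int[cnt]_k wnorm s (neumann k) <= ((1 - q)^-1)%:E * wnorm s f)%E.
Proof.
rewrite ge0_integral_count; last by move=> k; exact: wnorm_ge0.
apply: lime_le.
  by apply: is_cvg_nneseries => k _ _; exact: wnorm_ge0.
apply: nearW => m.
apply: (@le_trans _ _ (\sum_(0 <= k < m) (q ^+ k)%:E * wnorm s f)%E).
  by apply: lee_sum => k _; exact: wnorm_neumann.
rewrite -ge0_sume_distrl; last by move=> k _; rewrite lee_fin exprn_ge0// q_ge0.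
rewrite lee_wpmul2r ?wnorm_ge0// sumEFin lee_fin.
have q10 : 0 < 1 - q by rewrite subr_gt0.
rewrite -[leRHS]mulr1 ler_pdivlMl// big_mkord.
have -> : (1 - q) * \sum_(i < m) q ^+ i = 1 - q ^+ m.
  by rewrite -[1 - q]opprB mulNr -subrX1 opprB.
by rewrite gerBl exprn_ge0// q_ge0.
Qed.

(** The counting integral has a value at every [xi]; it is the genuine sum wherever the series
    converges absolutely, which is almost everywhere. *)
Definition neumann_sum xi : R[i] := cint cnt (fun k => neumann k xi).

Lemma cmeasurable_neumann_sum : cmeasurable neumann_sum.
Proof. exact: (cmeasurable_cint_counting cmeasurable_neumann). Qed.

Lemma fin_total : (((1 - q)^-1)%:E * wnorm s f < +oo)%E.
Proof.
have : wnorm s f \is a fin_num by rewrite ge0_fin_numE ?wnorm_ge0.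
by move=> ffin; rewrite -(fineK ffin) ltry.
Qed.

Lemma wnorm_neumann_sum : (wnorm s neumann_sum <= ((1 - q)^-1)%:E * wnorm s f)%E.
Proof.
apply: le_trans sum_wnorm_neumann; exact: (wnorm_cint_counting s cmeasurable_neumann).
Qed.

Lemma neumann_cintegrable k : cintegrable_on Leb (neumann k).
Proof.
apply: (wnorm_cintegrable s0 (cmeasurable_neumann k)).
apply: (le_lt_trans (wnorm_neumann k)).
rewrite -ge0_fin_numE ?fin_numM//.
  by rewrite ge0_fin_numE// wnorm_ge0.
by rewrite mule_ge0 ?wnorm_ge0// lee_fin exprn_ge0 ?q_ge0.
Qed.

(** The two terms of the equation are the cases [t = 0], which gives [(1 - Delta) u], and [t = 2],
    which gives [u]. *)
Lemma inv_fourier_bessel_neumann_sum t x : 0 <= t ->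
  cintegrable_on cnt (fun k => inv_fourier (bessel (- t) (neumann k)) x) /\
  inv_fourier (bessel (- t) neumann_sum) x =
  cint cnt (fun k => inv_fourier (bessel (- t) (neumann k)) x).
Proof.
move=> t0; pose m (xi : Rn) := cis (dotp x xi) * (japanese xi `^ (- t))%:C.
have mm : cmeasurable m.
  apply: cmeasurableM; first exact: cmeasurable_cis_dotpr.
  by apply: cmeasurable_real; exact: measurable_japanese_powR.
have m1 xi : Normc.normc (m xi) <= 1.
  rewrite Normc.normcM normc_cis mul1r normc_real ger0_norm ?powR_ge0//.
  by rewrite powRN invf_le1 ?japanese_powR_ge1// powR_gt0// japanese_gt0.
have [I E] := cint_bounded_series cmeasurable_neumann s0
  (le_lt_trans sum_wnorm_neumann fin_total) mm m1.
have A w : inv_fourier (bessel (- t) w) x = c2pi%:C * cint Leb (fun xi => m xi * w xi).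
  by congr (_ * _); apply: eq_cint => xi; rewrite /bessel /m mulrA.
split; first by under eq_fun do rewrite A; exact: cintegrableZ.
transitivity (c2pi%:C * cint cnt (fun k => cint Leb (fun xi => m xi * neumann k xi))).
  by rewrite (A neumann_sum) -E.
by rewrite -(cintZ _ I); apply: eq_cint => k; rewrite (A (neumann k)).
Qed.

Lemma bessel0 (w : Rn -> R[i]) : bessel (- 0) w = w.
Proof. by apply/funext => xi; rewrite /bessel oppr0 powRr0 mul1r. Qed.

Lemma inv_fourier_potential_op w : cintegrable_on Leb w -> (wnorm s w < +oo)%E ->
  inv_fourier (potential_op w) =
  (fun x => - (inv_fourier V x * inv_fourier (bessel (-2) w) x)).
Proof.
move=> Iw woo; have mw := cintegrable_measurable Iw.
have IV := wnorm_cintegrable s0 mV Voo.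
have Ib : cintegrable_on Leb (bessel (-2) w).
  apply: (wnorm_cintegrable s0); first exact: cmeasurable_bessel.
  by rewrite wnorm_bessel (le_lt_trans (le_wnorm _ mw) woo)// gerBl.
apply/funext => x; rewrite -inv_fourier_convol// /inv_fourier -mulrN; congr (_ * _).
rewrite -cintN.
  by apply: eq_cint => xi; rewrite /potential_op; ring.
apply: (cintegrable_bndl (M := 1)); first exact: cmeasurable_cis_dotpr.
  by move=> xi; rewrite normc_cis.
apply: cintegrableZ; apply: (wnorm_cintegrable s0).
  by apply: cmeasurable_convol => //; exact: cmeasurable_bessel.
have mb := cmeasurable_bessel (-2) mw.
apply: (le_lt_trans (wnorm_convol s0 mV mb)); rewrite wnorm_bessel.
rewrite -(fineK (_ : wnorm s V \is a fin_num)); last by rewrite ge0_fin_numE ?wnorm_ge0.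
rewrite -(fineK (_ : wnorm (s - 2) w \is a fin_num)) ?ltry//.
rewrite ge0_fin_numE; last exact: wnorm_ge0.
apply: le_lt_trans woo; by apply: le_wnorm => //; rewrite gerBl.
Qed.

Lemma inv_fourier_neumannS k x : inv_fourier (neumann k.+1) x =
  - (inv_fourier V x * inv_fourier (bessel (-2) (neumann k)) x).
Proof.
rewrite /= inv_fourier_potential_op//; first exact: neumann_cintegrable.
apply: (le_lt_trans (wnorm_neumann k)).
have : wnorm s f \is a fin_num by rewrite ge0_fin_numE ?wnorm_ge0.
by move=> ffin; rewrite -(fineK ffin) ltry.
Qed.

(** Both series converge absolutely at each [x]. By [inv_fourier_neumannS], multiplying the second
    by the potential gives minus the first shifted by one index, so only the zeroth term
    survives. *)
Lemma neumann_sum_eq x :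
  inv_fourier neumann_sum x + inv_fourier V x * inv_fourier (bessel (-2) neumann_sum) x =
  inv_fourier f x.
Proof.
have [I0 E0] := inv_fourier_bessel_neumann_sum x (lexx 0).
have {}I0 : cintegrable_on cnt (fun k => inv_fourier (neumann k) x).
  by move: I0; under eq_fun do rewrite bessel0.
have [I2 ->] := inv_fourier_bessel_neumann_sum x (ler0n R 2).
have {}E0 : inv_fourier neumann_sum x = cint cnt (fun k => inv_fourier (neumann k) x).
  rewrite -[in LHS](bessel0 neumann_sum) E0; apply: eq_cint => k.
  by rewrite (bessel0 (neumann k)).
rewrite E0.
rewrite cint_counting_recl//; under [X in _ + X + _]eq_cint do rewrite inv_fourier_neumannS.
rewrite (cintN (cintegrableZ (inv_fourier V x) I2)) (cintZ _ I2).
by rewrite subrK.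
Qed.

End neumann_series.

(** * The Schrodinger equation in Barron spaces *)

Section barron_space.
Context {R : realType} {n : nat}.
Local Open Scope complex_scope.
Local Notation Leb := (@lebesgue_rV R n).
Local Notation Rn := 'rV[R]_n.
Local Notation c2pi := (@inv2pi R n).
Implicit Types (s : R) (V f g h u : Rn -> R[i]).

Lemma barron_cintegrable s V : barron s V -> cintegrable_on Leb (fourier V).
Proof. by case=> _ []. Qed.

Lemma barron_cmeasurable s V : barron s V -> cmeasurable (fourier V).
Proof. by move=> /barron_cintegrable /cintegrable_measurable. Qed.

Lemma barron_wnorm_lty s V : barron s V -> (wnorm s (fourier V) < +oo)%E.
Proof. by case=> _ _ /integrable_wnorm. Qed.

Lemma barron_normE s V : barron s V -> (barron_norm s V)%:E = wnorm s (fourier V).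
Proof.
move=> bV; rewrite /barron_norm /Rintegral fineK// ge0_fin_numE.
  exact: barron_wnorm_lty bV.
exact: wnorm_ge0.
Qed.

Lemma barron_inv_fourierE s V : barron s V -> V = inv_fourier (fourier V).
Proof. by case=> CV FV _; exact: has_fourierE. Qed.

(** The representative chosen by [fourier] agrees with [g] almost everywhere, so the norms
    coincide. *)
Lemma barron_inv_fourier s g : 0 <= s -> cmeasurable g -> (wnorm s g < +oo)%E ->
  barron s (inv_fourier g) /\ (barron_norm s (inv_fourier g))%:E = wnorm s g.
Proof.
move=> s0 mg goo; have Ig := wnorm_cintegrable s0 mg goo.
have H := fourierP (has_fourier_inv Ig).
have mF : cmeasurable (fourier (inv_fourier g)).
  by case: H => /cintegrable_measurable.
have E : wnorm s (fourier (inv_fourier g)) = wnorm s g.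
  by apply: ae_eq_wnorm => //; exact: fourier_inv_fourier.
have b : barron s (inv_fourier g).
  by split; [exact: inv_fourier_Cb0|exact: H|apply: wnorm_integrable => //; rewrite E].
by split => //; rewrite barron_normE.
Qed.

Lemma inv_fourier_inj g h : cintegrable_on Leb g -> cintegrable_on Leb h ->
  inv_fourier g = inv_fourier h -> \forall x \ae Leb, g x = h x.
Proof.
move=> Ig Ih gh; apply: (has_fourier_unique (has_fourier_inv Ig)).
by rewrite gh; exact: has_fourier_inv.
Qed.

(** The unweighted estimate with its constant enlarged to the weighted one, so that the same ratio
    [q] yields a contraction in L^1. *)
Lemma le_wnorm_convol s V h : 0 <= s -> cmeasurable V -> cmeasurable h ->
  (wnorm 0 (fun xi => c2pi%:C * convol V h xi)%R <=
   (2 `^ (s / 2) * c2pi)%:E * wnorm s V * wnorm 0 h)%E.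
Proof.
move=> s0 mV mh; rewrite wnormZ; last exact: cmeasurable_convol.
rewrite normc_real ger0_norm ?(ltW inv2pi_gt0)//.
apply: (le_trans (lee_wpmul2l _ (wnorm_convol (lexx 0) mV mh))).
  by rewrite lee_fin (ltW inv2pi_gt0).
rewrite mul0r powRr0 mul1e muleA; apply: lee_wpmul2r; first exact: wnorm_ge0.
apply: lee_pmul; [by rewrite lee_fin (ltW inv2pi_gt0)|exact: wnorm_ge0| |exact: le_wnorm].
rewrite lee_fin ler_peMl ?(ltW inv2pi_gt0)//.
by rewrite -[leLHS](powRr0 (2 : R)) ler_powR ?ler1n// divr_ge0.
Qed.

Section schrodinger.
Variables (s : R) (V f : Rn -> R[i]).
Hypotheses (s0 : 0 <= s) (bV : barron s V) (bf : barron s f).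
Let q := 2 `^ (s / 2) * (2 * pi) ^- n * barron_norm s V.
Hypothesis q1 : q < 1.

Let qE : q%:E = ((2 `^ (s / 2) * c2pi)%:E * wnorm s (fourier V))%E.
Proof. by rewrite -(barron_normE bV). Qed.

Lemma schrodinger_exists : exists u, [/\ barron (s + 2) u, schrodinger_sol V f u &
  barron_norm (s + 2) u <= (1 - q)^-1 * barron_norm s f].
Proof.
have mV := barron_cmeasurable bV; have mf := barron_cmeasurable bf.
have Voo := barron_wnorm_lty bV; have foo := barron_wnorm_lty bf.
pose w := neumann_sum (fourier V) (fourier f).
have mw : cmeasurable w by exact: cmeasurable_neumann_sum.
have wle : (wnorm s w <= ((1 - q)^-1)%:E * wnorm s (fourier f))%E.
  exact: wnorm_neumann_sum.
have woo : (wnorm s w < +oo)%E.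
  by apply: (le_lt_trans wle); rewrite -(barron_normE bf) ltry.
have mb : cmeasurable (bessel (-2) w) by exact: cmeasurable_bessel.
have bE : wnorm (s + 2) (bessel (-2) w) = wnorm s w by rewrite wnorm_bessel addrK.
have s20 : 0 <= s + 2 by rewrite addr_ge0.
have boo : (wnorm (s + 2) (bessel (-2) w) < +oo)%E by rewrite bE.
have [bu uE] := barron_inv_fourier s20 mb boo.
(* Two powers of the weight make the solution of class C^2 and put its Laplacian under the
   integral. *)
have b2oo : (wnorm 2 (bessel (-2) w) < +oo)%E.
  by apply: le_lt_trans boo; apply: le_wnorm => //; rewrite lerDr.
exists (inv_fourier (bessel (-2) w)); split.
- exact: bu.
- split; first exact: inv_fourier_Ck.
  move=> x; have := congr1 (@^~ x) (inv_fourier_laplacian mb b2oo); rewrite /= => ->.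
  have -> : bessel 2 (bessel (-2) w) = w.
    apply/funext => xi; rewrite /bessel mulrA -rmorphM/=.
    by rewrite -japanese_powRD subrr powRr0 mul1r.
  rewrite [f in RHS](barron_inv_fourierE bf) {1}[V](barron_inv_fourierE bV).
  exact: (neumann_sum_eq s0 mV mf Voo foo qE q1 x).
- rewrite -lee_fin uE bE (_ : (_ * barron_norm s f)%:E = ((1 - q)^-1%:E * (barron_norm s f)%:E)%E)//.
  by rewrite (barron_normE bf).
Qed.

(** For [d = u^ - v^], the L^1 norm of [d] is at most that of [J^2 d], which equals that of
    [(2 pi)^-n V^ * d] and so is at most [q] times that of [d]. As this norm is finite and [q < 1],
    it is 0, and the bound on [inv_fourier] gives [u = v] at every point. *)
Lemma schrodinger_unique u v : barron (s + 2) u -> schrodinger_sol V f u ->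
  barron (s + 2) v -> schrodinger_sol V f v -> u = v.
Proof.
move=> bu [_ uE] bv [_ vE].
have Iu := barron_cintegrable bu; have Iv := barron_cintegrable bv.
have mu := cintegrable_measurable Iu; have mv := cintegrable_measurable Iv.
have IV := barron_cintegrable bV; have mV := cintegrable_measurable IV.
have w2 (w : Rn -> R[i]) : barron (s + 2) w -> (wnorm 2 (fourier w) < +oo)%E.
  move=> bw; apply: le_lt_trans (barron_wnorm_lty bw).
  by apply: le_wnorm; [rewrite lerDr|exact: barron_cmeasurable bw].
have Ib (w : Rn -> R[i]) : barron (s + 2) w -> cintegrable_on Leb (bessel 2 (fourier w)).
  move=> bw; apply: (wnorm_cintegrable (lexx 0)).
    by apply: cmeasurable_bessel; exact: barron_cmeasurable bw.
  by rewrite wnorm_bessel add0r w2.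
have HE (w : Rn -> R[i]) x : barron (s + 2) w -> w x - laplacian w x + V x * w x = f x ->
    inv_fourier (bessel 2 (fourier w)) x = f x - V x * w x.
  move=> bw; rewrite -(inv_fourier_laplacian (barron_cmeasurable bw) (w2 w bw)).
  by rewrite -(barron_inv_fourierE bw) => <-; rewrite addrK.
pose d xi := fourier u xi - fourier v xi.
have Id : cintegrable_on Leb d by exact: cintegrableB.
have md := cintegrable_measurable Id.
have dE : inv_fourier d = (fun x => u x - v x).
  by rewrite inv_fourierB// -(barron_inv_fourierE bu) -(barron_inv_fourierE bv).
pose r xi := c2pi%:C * convol (fourier V) d xi.
have mr : cmeasurable r.
  by apply: cmeasurableM; [exact: cmeasurable_cst|exact: cmeasurable_convol].
have rle := le_wnorm_convol s0 mV md; rewrite -qE -/r in rle.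
have d0oo : (wnorm 0 d < +oo)%E by rewrite wnorm0; exact: cintegrable_L1norm.
have d0fin : wnorm 0 d \is a fin_num by rewrite ge0_fin_numE ?wnorm_ge0.
have Ir : cintegrable_on Leb r.
  apply: (wnorm_cintegrable (lexx 0) mr); apply: (le_lt_trans rle).
  by rewrite -(fineK d0fin) ltry.
have rE x : inv_fourier r x = V x * (u x - v x).
  rewrite inv_fourier_convol// -(barron_inv_fourierE bV).
  by rewrite dE.
(* The equations are subtracted in physical space; injectivity of [inv_fourier] carries the result
   back to the Fourier side. The order [v - u] absorbs the sign of the potential term. *)
have ae_dr : \forall xi \ae Leb, bessel 2 (fourier v) xi - bessel 2 (fourier u) xi = r xi.
  apply: inv_fourier_inj => //; first by apply: cintegrableB; exact: Ib.
  rewrite inv_fourierB; [|exact: Ib|exact: Ib]; apply/funext => x.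
  by rewrite rE (HE _ _ bv (vE x)) (HE _ _ bu (uE x)); ring.
have d20 : (wnorm 0 d <= wnorm 0 r)%E.
  have <- : wnorm 0 (fun xi => (-1) * bessel 2 d xi) = wnorm 0 r.
    apply: ae_eq_wnorm => //.
      apply: cmeasurableM; first exact: cmeasurable_cst.
      exact: cmeasurable_bessel.
    by apply: filterS ae_dr => xi <-; rewrite /bessel /d; ring.
  rewrite wnormZ; last exact: cmeasurable_bessel.
  rewrite normcN Normc.normc1 mul1e wnorm_bessel add0r.
  exact: le_wnorm.
have d00 : wnorm 0 d = 0%E.
  have := le_trans d20 rle; rewrite -(fineK d0fin) -EFinM lee_fin => dq.
  congr EFin; apply/eqP; rewrite eq_le fine_ge0 ?wnorm_ge0// andbT.
  rewrite -(pmulr_rle0 _ (_ : 0 < 1 - q)) ?subr_gt0//.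
  by rewrite mulrBl mul1r subr_le0.
apply/funext => x; apply/eqP; rewrite -subr_eq0; apply/eqP.
have <- : inv_fourier d x = u x - v x by rewrite dE.
apply: normc_eq0; apply/eqP; rewrite eq_le normc_ge0 andbT.
by rewrite (le_trans (normc_inv_fourier _ Id))// -wnorm0 d00 mulr0.
Qed.

End schrodinger.
End barron_space.

Theorem theorem3p3 (R : realType) (n : nat) (n_gt0 : (0 < n)%N) (s : R)
    (s_ge0 : 0 <= s) (V : 'rV[R]_n -> R[i]) (V_barron : barron s V)
    (V_small : 2 `^ (s / 2) * (2 * pi) ^- n * barron_norm s V < 1)
    (f : 'rV[R]_n -> R[i]) (f_barron : barron s f) :
  exists u : 'rV[R]_n -> R[i],
    unique (fun w => barron (s + 2) w /\ schrodinger_sol V f w) u /\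
    barron_norm (s + 2) u <=
      (1 - 2 `^ (s / 2) * (2 * pi) ^- n * barron_norm s V)^-1
      * barron_norm s f.
Proof.
have [u [bu solu ule]] := schrodinger_exists s_ge0 V_barron f_barron V_small.
exists u; split=> //; split=> // v [bv solv].
exact: (schrodinger_unique s_ge0 V_barron V_small bu solu bv solv).
Qed.
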